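(* Let $c_0$ be a Rayleigh eigenvalue with $\Im c_0>0$ and decaying eigenmode $\phi_{c_0}^-$, and let $\{(c_\nu,\nu)\}_{\nu>0}$ be a family of eigenvalues of the Orr-Sommerfeld operator (equivalently, of its adjoint) with $c_\nu\to c_0$ at a rate $c_\nu-c_0=O(\sqrt\nu)$ as $\nu\to0$. Let $\phi_{c_\nu,\nu}$ and $\phi^*_{c_\nu,\nu}$ be the corresponding Orr-Sommerfeld eigenmode and adjoint eigenmode. Then for $\nu>0$ small enough, $\overline{\phi_{c_\nu,\nu}}\notin\operatorname{Img}\mathrm{Orr}_{c_\nu,\nu}$ and $\overline{\phi^*_{c_\nu,\nu}}\notin\operatorname{Img}\mathrm{Orr}^*_{c_\nu,\nu}$. Furthermore, if $\phi_{c_0}^-\notin\operatorname{Img}\mathrm{Ray}_{c_0}$, then $\phi_{c_\nu,\nu}\notin\operatorname{Img}\mathrm{Orr}_{c_\nu,\nu}$ and $\phi^*_{c_\nu,\nu}\notin\operatorname{Img}\mathrm{Orr}^*_{c_\nu,\nu}$ for $\nu$ small enough.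
   Context: Shear flow: $U_s:[0,\infty)\to\mathbb{R}$ is smooth and bounded, $U_s(0)=U_s'(0)=U_s''(0)=0$, $U_s$ has a finite limit at $+\infty$, and there are $\eta_0>0$, $C_k>0$ with $|U_s^{(k)}(y)|\le C_ke^{-\eta_0y}$ for all $k\ge1$, $y\ge0$. Fix a positive integer $\alpha$ and $\gamma\in\mathbb{R}$; $\Delta_\alpha:=\partial_{yy}-\alpha^2$. $\mathrm{Ray}_c\phi:=(U_s-c)\Delta_\alpha\phi-U_s''\phi$ on $\mathcal{D}_0:=\{\phi\in H^2(\mathbb{R}_+;\mathbb{C}):\phi(0)=0\}$; $c_0$ is a Rayleigh eigenvalue if there is $0\ne\phi_{c_0}^-\in\mathcal{D}_0$ (the eigenmode) with $\mathrm{Ray}_{c_0}\phi_{c_0}^-=0$. $\mathrm{Orr}_{c,\nu}\phi:=(U_s-c)\Delta_\alpha\phi-U_s''\phi-\frac{\nu}{i\alpha}\Delta_\alpha^2\phi$ and $\mathrm{Orr}^*_{c,\nu}\phi:=\Delta_\alpha((U_s-\bar c)\phi)-U_s''\phi+\frac{\nu}{i\alpha}\Delta_\alpha^2\phi$, both on $\mathcal{D}_\nu:=\{\phi\in H^4(\mathbb{R}_+;\mathbb{C}):\phi(0)=0,\ \phi'(0)=\nu^\gamma\phi''(0)\}\subset L^2(\mathbb{R}_+;\mathbb{C})$. A pair $(c,\nu)$ with $\Im c>0$, $\nu>0$ is an Orr-Sommerfeld eigenvalue (resp. adjoint eigenvalue) if $\mathrm{Orr}_{c,\nu}$ (resp.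 $\mathrm{Orr}^*_{c,\nu}$) has a nonzero element of $\mathcal{D}_\nu$ in its kernel, called the eigenmode (resp. adjoint eigenmode); the two notions of eigenvalue coincide. $\operatorname{Img}$ denotes the image of an operator on the domain given above. *)

(* Defs.v *)
From HB Require Import structures.
From mathcomp Require Import all_boot all_order all_algebra.
From mathcomp Require Import all_classical all_reals all_analysis.
From mathcomp Require Import complex.
Set Implicit Arguments.
Unset Strict Implicit.
Unset Printing Implicit Defensive.
Import Order.TTheory GRing.Theory Num.Theory.
Import numFieldNormedType.Exports.
Local Open Scope classical_set_scope.
Local Open Scope ring_scope.
Local Open Scope complex_scope.

(* Functions on [0, +oo) are encoded as total functions on R whose values on
   the negative axis are never inspected. Elements of L^2 and of Sobolev
   spaces are represented by functions, equality being a.e. equality. *)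

Section HalfLineClassical.
Variable R : realType.
Implicit Types (U : R -> R) (x : R).

Definition halfline : set R := `[0, +oo[.

(* Difference quotients restricted to points x + h >= 0: the usual derivative
   at x > 0 and the right derivative at x = 0. *)
Definition halfline_quotient U x : set_system R :=
  (h^-1 * (U (h + x) - U x)) @[h --> within [set h | 0 <= h + x] 0^'].

Definition halfline_deriv U x : R := lim (halfline_quotient U x).

Definition halfline_derivn (k : nat) U : R -> R := iter k halfline_deriv U.

Definition halfline_smooth U : Prop :=
  forall (k : nat) x, 0 <= x -> cvg (halfline_quotient (halfline_derivn k U) x).

Definition shear_flow U : Prop :=
  [/\ halfline_smooth U,
      exists M : R, forall y, 0 <= y -> `|U y| <= M,
      [/\ U 0 = 0, halfline_derivn 1 U 0 = 0 & halfline_derivn 2 U 0 = 0],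
      exists l : R, U y @[y --> +oo] --> l
    & exists2 eta0 : R, 0 < eta0 & forall k : nat, (1 <= k)%N ->
        exists2 C : R, 0 < C & forall y, 0 <= y ->
          `|halfline_derivn k U y| <= C * expR (- eta0 * y)].

End HalfLineClassical.

Section Sobolev.
Variable R : realType.
Implicit Types (f g phi : R -> R[i]) (chi : R -> R).

Local Notation mu := (@lebesgue_measure R).
Local Notation Rp := (@halfline R).

Definition aeeq f g : Prop := f = g %[ae mu in Rp].

(* L^2(R_+; C): the zero extensions of the real and imaginary parts belong to
   L^2(R). *)
Definition L2 f : Prop :=
  ((@complex.Re R \o f) \_ Rp) \in Lfun mu 2%:E /\
  ((@complex.Im R \o f) \_ Rp) \in Lfun mu 2%:E.

Definition cintegral f : R[i] :=
  (\int[mu]_(y in Rp) @complex.Re R (f y)) +i* (\int[mu]_(y in Rp) @complex.Im R (f y)).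

(* C^1 functions with compact support in (0, +oo). *)
Definition test_function chi : Prop :=
  [/\ forall x, derivable chi x 1,
      continuous (derive1 chi)
    & exists a b : R, 0 < a /\ forall x, ~~ (a <= x <= b) -> chi x = 0].

(* f \in H^1(R_+; C) with weak derivative g. As is usual in dimension one
   (e.g. Brezis, Functional Analysis, Section 8.2), it is enough to test
   against C^1_c functions. *)
Definition weak_derivative f g : Prop :=
  [/\ L2 f, L2 g & forall chi, test_function chi ->
    cintegral (fun y => f y * (derive1 chi y)%:C)
    = - cintegral (fun y => g y * (chi y)%:C)].

Fixpoint sobolev (k : nat) f : Prop :=
  if k is k'.+1 then exists2 g, weak_derivative f g & sobolev k' g else L2 f.

(* A representative of the weak derivative; unique up to a.e. equality, and
   meaningful for f in H^1. *)
Definition wderiv f : R -> R[i] := xget (fun _ => 0) [set g | weak_derivative f g].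

(* The value f(0) of an H^1 function, i.e. the value at 0 of its continuous
   representative. *)
Definition trace0 f : R[i] :=
  xget 0 [set z | exists g, [/\ {within Rp, continuous (g : R -> R[i]^o)}, aeeq f g & g 0 = z]].

Definition image_on (T : (R -> R[i]) -> R -> R[i]) (D : set (R -> R[i])) :
  set (R -> R[i]) := [set f | exists2 phi, D phi & aeeq (T phi) f].

Definition eigenmode (T : (R -> R[i]) -> R -> R[i]) (D : set (R -> R[i])) phi :
  Prop := [/\ D phi, ~ aeeq phi (fun _ => 0) & aeeq (T phi) (fun _ => 0)].

End Sobolev.

Section Operators.
Variables (R : realType) (U : R -> R) (alpha : nat) (gamma : R).
Implicit Types (phi : R -> R[i]) (c : R[i]) (nu : R).

Local Notation U2 := (halfline_derivn 2 U).

Definition laplacian phi : R -> R[i] :=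
  fun y => wderiv (wderiv phi) y - (alpha%:R ^+ 2) * phi y.

Definition D0 : set (R -> R[i]) := [set phi | sobolev 2 phi /\ trace0 phi = 0].

Definition Dnu nu : set (R -> R[i]) :=
  [set phi | [/\ sobolev 4 phi, trace0 phi = 0 &
    trace0 (wderiv phi) = (nu `^ gamma)%:C * trace0 (wderiv (wderiv phi))]].

Definition Ray c phi : R -> R[i] :=
  fun y => ((U y)%:C - c) * laplacian phi y - (U2 y)%:C * phi y.

Definition Orr c nu phi : R -> R[i] :=
  fun y => ((U y)%:C - c) * laplacian phi y - (U2 y)%:C * phi y
           - nu%:C / ('i * alpha%:R) * laplacian (laplacian phi) y.

Definition Orr_adj c nu phi : R -> R[i] :=
  fun y => laplacian (fun z => ((U z)%:C - c^*) * phi z) y - (U2 y)%:C * phi y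
           + nu%:C / ('i * alpha%:R) * laplacian (laplacian phi) y.

Definition Rayleigh_eigenvalue c : Prop :=
  exists phi, eigenmode (Ray c) D0 phi.

Definition OS_eigenvalue c nu : Prop :=
  [/\ 0 < @complex.Im R c, 0 < nu & exists phi, eigenmode (Orr c nu) (Dnu nu) phi].

End Operators.

(* Main.v *)
(** Write eps = nu / alpha and L = (U - c0)^-1 Ray_c0. Integration by parts shows
    that the image of Orr is orthogonal, for the bilinear pairing, to the
    conjugate of the adjoint eigenmode, and likewise with the roles exchanged.
    So it is enough that the pairings of phi_nu with phi_nu^* and with its
    conjugate do not vanish, and these converge, after normalisation, to
    int phi0 k and int phi0 conj(k), where k = phi0 / (U - c0).

    The convergence is quantitative. Testing an eigenmode F with its own
    conjugate bounds F' in L^2 and sqrt(eps) Delta F; testing it with a boundary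
    layer of width sqrt(eps) bounds eps F''(0) by eps^(1/4). Hence the inviscid
    form of F is O(|c - c0| + eps^(1/4)) on every H^2 test function. If r is the
    component of F orthogonal to phi0, then L chi = conj(r) is solvable, by
    variation of constants between the decaying solution phi0 and a growing one,
    and the test function chi / (U - c0) gives |r|^2 = O(|c - c0| + eps^(1/4)) |F| |r|.

    Finally Im (int phi0 conj(k)) = - Im c0 |k|^2 is not zero, and int phi0 k = 0
    would make L chi = k solvable, that is, phi0 would lie in the image of Ray_c0. *)

Require Import Defs.
From HB Require Import structures.
From mathcomp Require Import all_boot all_order all_algebra.
From mathcomp Require Import all_classical all_reals all_analysis.
From mathcomp Require Import measurable_realfun.
From mathcomp Require Import complex ring lra.
Set Implicit Arguments.
Unset Strict Implicit.
Unset Printing Implicit Defensive.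
Import Order.TTheory GRing.Theory Num.Theory.
Import numFieldNormedType.Exports.
Local Open Scope classical_set_scope.
Local Open Scope ring_scope.
Local Open Scope complex_scope.
Import ComplexField.Normc.

(** * Absolutely continuous functions on the half-line *)

(** The pairing is bilinear, so the adjoint mode enters through its conjugate, which is in the
    kernel of the transposed operator and keeps the slip condition, whose coefficient is real. As
    Ray_c0 = (U - c0) L with L symmetric for this pairing, the transposed inviscid operator kills k
    when L ((U - c0) k) = 0; hence k = phi0 / (U - c0). The obstacle is the trace F''(0). A test
    function that only vanishes at 0 leaves the term eps F''(0) G'(0), while the energy identity
    controls just F' and sqrt(eps) Delta F. A test function with G(0) = 0, G'(0) = 1 concentrated on
    width w has |G'| of order w^(1/2) and |G''| of order w^(-1/2) in L^2; the inviscid part |G'| and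
    the viscous part sqrt(eps) |G''| balance at w = sqrt(eps), where both are eps^(1/4). Writing s =
    eps^(1/4) keeps all estimates polynomial in s. Since Im c0 > 0, U - c0 never vanishes: division
    by it is bounded on H^2, and the Rayleigh equation becomes y'' = (a^2 + q) y with q = U'' / (U -
    c0) exponentially small. Constants are tracked explicitly instead of extracting convergent
    subsequences. *)

Section RealAC.
Variable R : realType.
Notation mu := (@lebesgue_measure R).
Notation ri D f := (mu.-integrable D (EFin \o f)).
Notation Rp := (@halfline R).

Lemma ri_restrict (D : set R) (f : R -> R) : measurable D -> ri D f <-> ri setT (f \_ D).
Proof.
move=> mD; rewrite -restrict_EFin.
exact: integrable_mkcond.
Qed.

(** Both sides integrate [a t * b s] over the triangle s <= t <= x. Extending by zero outside
    [[0, x]] and inserting the indicator [k] of the half-plane s <= t reduces this to Fubini on the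
    plane. It is the source of the product rule [acM]. *)
Lemma Rint_fubini (a b : R -> R) x : 0 <= x -> ri `[0, x] a -> ri `[0, x] b ->
  \int[mu]_(t in `[0, x]) (a t * \int[mu]_(s in `[0, t]) b s) =
  \int[mu]_(s in `[0, x]) (\int[mu]_(t in `[s, x]) a t * b s).
Proof.
move=> x0 ia ib.
pose A : R -> R := a \_ `[0, x]; pose B : R -> R := b \_ `[0, x].
have iA : mu.-integrable setT (EFin \o A).
  exact: (@ri_restrict `[0, x] _ (measurable_itv _)).1.
have iB : mu.-integrable setT (EFin \o B).
  exact: (@ri_restrict `[0, x] _ (measurable_itv _)).1.
have mA : measurable_fun setT A by apply/measurable_EFinP; exact: measurable_int iA.
have mB : measurable_fun setT B by apply/measurable_EFinP; exact: measurable_int iB.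
pose K := [set p : R * R | p.2 <= p.1].
pose k (p : R * R) : R := \1_K p.
pose f (p : R * R) : \bar R := (A p.1 * (B p.2 * k p))%:E.
have mk : measurable_fun setT k.
  apply: measurable_indic; rewrite -[X in measurable X]setTI.
  have := @measurable_fun_ler _ _ R setT (@snd R R) (@fst R R) measurable_snd measurable_fst.
  move=> /(_ measurableT [set true] I).
  by rewrite (_ : _ @^-1` [set true] = K).
have mf : measurable_fun setT f.
  apply/measurable_EFinP; apply: measurable_funM.
    exact: (measurableT_comp mA measurable_fst).
  apply: measurable_funM => //.
  exact: (measurableT_comp mB measurable_snd).
have k01 p : 0 <= k p <= 1 by rewrite /k indicE; case: (_ \in _); rewrite ?lexx ?ler01.
have iB' t : mu.-integrable setT (fun s => (B s * k (t, s))%:E).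
  apply: le_integrable iB => //.
    apply/measurable_EFinP; apply: measurable_funM => //.
    exact: (measurableT_comp mk (pair1_measurable t)).
  move=> s _ /=; rewrite lee_fin normrM.
  by rewrite ler_piMr// ger0_norm//; case/andP: (k01 (t, s)).
have imf : ((mu \x mu)%E).-integrable setT f.
  apply/integrable12ltyP => //.
  have mBn : measurable_fun setT (fun s => `|(B s)%:E|%E) by apply: measurableT_comp => //; exact/measurable_EFinP.
  have mAn : measurable_fun setT (fun s => `|(A s)%:E|%E) by apply: measurableT_comp => //; exact/measurable_EFinP.
  have mfn : measurable_fun setT (abse \o f) by exact: measurableT_comp.
  apply: (@le_lt_trans _ _ (\int[mu]_t (`|(A t)%:E| * \int[mu]_s `|(B s)%:E|))%E).
    apply: ge0_le_integral => //.
    - by move=> t _; exact: integral_ge0.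
    - by apply: (measurable_fun_fubini_tonelli_F (m2 := mu) (abse \o f)) => // ?; exact: abse_ge0.
    - by apply: emeasurable_funM => //; exact: measurable_cst.
    - move=> t _; rewrite -ge0_integralZl//.
      apply: ge0_le_integral => //.
      + exact: (measurableT_comp mfn (pair1_measurable t)).
      + by apply: emeasurable_funM => //; exact: measurable_cst.
      + move=> s _; rewrite /f /= -EFinM lee_fin !normrM ler_wpM2l// ler_piMr//.
        by rewrite ger0_norm; case/andP: (k01 (t, s)).
  rewrite ge0_integralZr//; last exact: integral_ge0.
  apply: lte_mul_pinfty => //.
  - exact: integral_ge0.
  - rewrite ge0_fin_numE; last exact: integral_ge0.
    by have /integrableP[] := iA.
  - by have /integrableP[] := iB.
have := Fubini imf.
have -> : (\int[mu]_t \int[mu]_s f (t, s) = \int[mu]_(t in `[0%R, x]) (a t * \int[mu]_(s in `[0%R, t]) b s)%R%:E)%E.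
  rewrite [RHS]integral_mkcond; apply: eq_integral => t _.
  rewrite patchE; case: ifPn => [|tx].
    rewrite inE /= in_itv/= => /andP[t0 tx].
    rewrite EFinM /Rintegral.
    rewrite fineK; last first.
      apply: integrable_fin_num => //; apply: integrableS ib => //.
      by apply: subset_itvl; rewrite bnd_simp.
    rewrite [in RHS]integral_mkcond -integralZl//; last first.
      rewrite restrict_EFin -restrict_EFin; apply/(integrable_mkcond _ _).1 => //.
      apply: integrableS ib => //.
      by apply: subset_itvl; rewrite bnd_simp.
    apply: eq_integral => s _.
    have tI : `[0, x]%classic t by rewrite /= in_itv/= t0.
    rewrite /f/= /A /B /k indicE !patchE (mem_set tI) /K.
    have [s0x|ns] := pselect (`[0, x]%classic s).
      have /andP[s0 sx] : 0 <= s <= x by move: s0x; rewrite /= in_itv.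
      rewrite (mem_set s0x); case: (leP s t) => st.
        rewrite (mem_set (st : [set p | p.2 <= p.1] (t, s))) mulr1 mem_set ?EFinM//.
        by rewrite /= in_itv/= s0.
      rewrite memNset ?mulr0/=; last by apply/negP; rewrite -ltNge.
      rewrite memNset ?mulr0 ?mule0//= in_itv/=; apply/negP.
      by rewrite negb_and -!ltNge st orbT.
    rewrite (memNset ns) mul0r mulr0 memNset ?mule0//= in_itv/= => /andP[s0 st].
    by apply: ns; rewrite /= in_itv/= s0 (le_trans st).
  apply: integral0_eq => s _; rewrite /f /A/= patchE (negbTE tx) mul0r//.
have -> : (\int[mu]_s \int[mu]_t f (t, s) = \int[mu]_(s in `[0%R, x]) (\int[mu]_(t in `[s, x]) a t * b s)%R%:E)%E.
  rewrite [RHS]integral_mkcond; apply: eq_integral => s _.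
  rewrite patchE; case: ifPn => [|sx].
    rewrite inE /= in_itv/= => /andP[s0 sx].
    have ias : ri `[s, x] a.
      by apply: integrableS ia => //; apply: subset_itvr; rewrite bnd_simp.
    rewrite EFinM /Rintegral fineK; last exact: integrable_fin_num.
    rewrite [in RHS]integral_mkcond -integralZr//; last first.
      by rewrite restrict_EFin; exact: (@ri_restrict `[s, x] _ (measurable_itv _)).1.
    apply: eq_integral => t _.
    have sI : `[0, x]%classic s by rewrite /= in_itv/= s0.
    rewrite /f/= /A /B /k indicE !patchE (mem_set sI) /K.
    have [t0x|ns] := pselect (`[0, x]%classic t).
      have /andP[t0 tx] : 0 <= t <= x by move: t0x; rewrite /= in_itv.
      rewrite (mem_set t0x); case: (leP s t) => st.
        rewrite (mem_set (st : [set p | p.2 <= p.1] (t, s))) mulr1 mem_set ?EFinM//.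
        by rewrite /= in_itv/= tx st.
      rewrite memNset ?mulr0/=; last by apply/negP; rewrite -ltNge.
      rewrite memNset ?mulr0 ?mul0e//= in_itv/=; apply/negP.
      by rewrite negb_and -!ltNge st.
    rewrite (memNset ns) mul0r memNset ?mul0e//= in_itv/= => /andP[st tx].
    by apply: ns; rewrite /= in_itv/= tx (le_trans s0).
  by apply: integral0_eq => t _; rewrite /f /B/= patchE (negbTE sx) mul0r mulr0.
by rewrite /Rintegral => ->.
Qed.

Implicit Types (f g : R -> R) (x y b c M : R) (D E : set R).

(** Absolute continuity encoded as the fundamental theorem of calculus. The derivative [g] matters
    only up to null sets, so that an L^2 weak derivative fits, while [f] is pinned down at every
    point of the half-line. *)
Definition ac (f g : R -> R) := forall x, 0 <= x ->
  ri `[0, x] g /\ f x = f 0 + \int[mu]_(t in `[0, x]) g t.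

Lemma measurable_halfline : measurable Rp.
Proof. exact: measurable_itv. Qed.
Hint Resolve measurable_halfline : core.

Lemma riS (D E : set R) f : measurable E -> measurable D -> D `<=` E ->
  ri E f -> ri D f.
Proof. by move=> mE mD DE; exact: integrableS. Qed.

Lemma ri_itvS (x y b : R) f : 0 <= x -> y <= b -> ri `[0, b] f -> ri `[x, y] f.
Proof.
move=> x0 yb; apply: integrableS => //.
by apply: subset_itv; rewrite bnd_simp.
Qed.

Lemma Rint_cat g x y : 0 <= x <= y -> ri `[0, y] g ->
  \int[mu]_(t in `[0, y]) g t =
  \int[mu]_(t in `[0, x]) g t + \int[mu]_(t in `[x, y]) g t.
Proof.
move=> /andP[x0 xy] ig; apply/eqP; rewrite addrC -subr_eq; apply/eqP.
rewrite Rintegral_itvB//= ?bnd_simp//.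
rewrite Rintegral_itv_obnd_cbnd//.
apply: integrableS ig => //.
by apply: subset_itvr; rewrite bnd_simp.
Qed.

Lemma ac_ri f g x : ac f g -> 0 <= x -> ri `[0, x] g.
Proof. by move=> h /h[]. Qed.

Lemma acE f g x : ac f g -> 0 <= x -> f x = f 0 + \int[mu]_(t in `[0, x]) g t.
Proof. by move=> h /h[]. Qed.

Lemma acB f g x y : ac f g -> 0 <= x <= y ->
  f y - f x = \int[mu]_(t in `[x, y]) g t.
Proof.
move=> h /andP[x0 xy]; have y0 := le_trans x0 xy.
rewrite (acE h x0) (acE h y0) (@Rint_cat g x y) ?x0//; last exact: ac_ri h _.
by ring.
Qed.

Lemma ac_cont_itv f g b : ac f g -> 0 <= b -> {within `[0, b], continuous f}.
Proof.
move=> h b0.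
have H := parameterized_integral_continuous b0 (ac_ri h b0).
apply: (@subspace_eq_continuous _ _ _ (fun x => f 0 + parameterized_integral mu 0 x g)).
  by move=> x /[!inE]/= /[!in_itv]/= /andP[x0 _]; rewrite [RHS](acE h x0).
by move=> x; apply: cvgD; [exact: cvg_cst|exact: H].
Qed.

Lemma ac_cont f g : ac f g -> {within Rp, continuous f}.
Proof.
move=> h; apply/continuous_within_itvcyP; split.
  move=> x /[!in_itv]/= /andP[x0 _].
  have x10 : 0 < x + 1 by rewrite ltr_wpDl// ltW.
  have /(continuous_within_itvP _ x10)[H _ _] := ac_cont_itv h (ltW x10).
  by apply: H; rewrite in_itv/= x0 ltrDl ltr01.
by have /(continuous_within_itvP _ ltr01)[_ + _] := ac_cont_itv h ler01.
Qed.

Lemma within_halfline_measurable f : {within Rp, continuous f} -> measurable_fun Rp f.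
Proof. by move=> cf; apply: subspace_continuous_measurable_fun. Qed.

Lemma within_halflineS f b : {within Rp, continuous f} -> {within `[0, b], continuous f}.
Proof. by apply: continuous_subspaceW; apply: subset_itvl. Qed.

Lemma ac_measurable f g : ac f g -> measurable_fun Rp f.
Proof. by move=> /ac_cont; exact: within_halfline_measurable. Qed.

Lemma within_bounded f b : {within Rp, continuous f} ->
  exists2 M, 0 <= M & forall x, 0 <= x <= b -> `|f x| <= M.
Proof.
move=> /(@within_halflineS _ b) cf.
have /compact_bounded[M [_ HM]] := continuous_compact cf (@segment_compact _ 0 b).
exists (`|M| + 1) => [|x x0b]; first by rewrite addr_ge0.
by apply: (HM (`|M| + 1)); [rewrite ltr_pwDr// ler_norm|exists x; rewrite //= in_itv].
Qed.

Lemma riMb (D : set R) f g M : measurable D -> measurable_fun D f ->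
  (forall x, D x -> `|f x| <= M) -> ri D g -> ri D (f \* g).
Proof.
move=> mD mf fM ig.
have [[x Dx]|D0] := pselect (exists x, D x); last first.
  have -> : D = set0 by apply/seteqP; split=> // x Dx; case: D0; exists x.
  exact: integrable_set0.
have M0 : 0 <= M by rewrite (le_trans _ (fM _ Dx)).
have iM : mu.-integrable D (fun x => M%:E * (g x)%:E)%E by apply: integrableZl.
apply: le_integrable iM => //.
  by apply/measurable_EFinP; apply: measurable_funM => //; apply/measurable_EFinP; exact: measurable_int ig.
move=> t Dt; change (`|(f t * g t)%:E| <= `|(M * g t)%:E|)%E; rewrite /= lee_fin !normrM ler_wpM2r//.
by rewrite (le_trans (fM _ Dt))// ler_norm.
Qed.

Lemma riMcont f g b : {within Rp, continuous f} -> ri `[0, b] g -> ri `[0, b] (f \* g).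
Proof.
move=> cf ig; have [M M0 HM] := within_bounded b cf.
apply: (@riMb _ _ _ M) => //.
apply: measurable_funS (within_halfline_measurable cf) => //; exact: subset_itvl.
Qed.

Lemma ri_cst (a b c : R) : ri `[a, b] (fun=> c).
Proof.
apply/integrableP; split; first exact/measurable_EFinP.
rewrite integral_cst//= lebesgue_measure_itv/=; case: ifP => _.
  by rewrite -EFinB -EFinM ltry.
by rewrite mule0 ltry.
Qed.

Lemma ri_cont f b : {within Rp, continuous f} -> ri `[0, b] f.
Proof.
move=> cf; have := riMcont cf (ri_cst 0 b 1).
by apply: eq_integrable => // x _ /=; rewrite mulr1.
Qed.

Lemma riD (D : set R) f g : measurable D -> ri D f -> ri D g -> ri D (f \+ g).
Proof. by move=> mD fi gi; have H : mu.-integrable D ((EFin \o f) \+ (EFin \o g))%E; [apply: integrableD|exact: H]. Qed.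

Lemma riZ (D : set R) c f : measurable D -> ri D f -> ri D (fun x => c * f x).
Proof. by move=> mD fi; have H : mu.-integrable D (fun x => c%:E * (f x)%:E)%E; [apply: integrableZl|exact: H]. Qed.

Lemma eq_ri (D : set R) f g : measurable D -> (forall x, D x -> f x = g x) -> ri D f -> ri D g.
Proof. by move=> mD fg; apply: eq_integrable => // x /[!inE] Dx; rewrite /= fg. Qed.

Lemma eq_Rint (D : set R) f g : (forall x, D x -> f x = g x) ->
  \int[mu]_(t in D) f t = \int[mu]_(t in D) g t.
Proof. by move=> fg; apply: eq_Rintegral => x /[!inE]; exact: fg. Qed.

Lemma eq_ac f f1 g g1 : (forall x, 0 <= x -> f x = f1 x) ->
  (forall x, 0 <= x -> g x = g1 x) -> ac f g -> ac f1 g1.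
Proof.
move=> ff gg h x x0.
have gg' t : `[0, x]%classic t -> g t = g1 t by rewrite /= in_itv/= => /andP[t0 _]; exact: gg.
split; first by apply: eq_ri (ac_ri h x0).
by rewrite -!ff// (acE h x0); congr (_ + _); apply: eq_Rint.
Qed.

Lemma acD f f' g g' : ac f f' -> ac g g' -> ac (f \+ g) (f' \+ g').
Proof.
move=> hf hg x x0; have rf := ac_ri hf x0; have rg := ac_ri hg x0.
split; first exact: riD.
by rewrite /= RintegralD// (acE hf x0) (acE hg x0); ring.
Qed.

Lemma acZ c f f' : ac f f' -> ac (fun x => c * f x) (fun x => c * f' x).
Proof.
move=> hf x x0; have rf := ac_ri hf x0.
split; first exact: riZ.
by rewrite /= RintegralZl// (acE hf x0); ring.
Qed.

Lemma ac_cst c : ac (fun=> c) (fun=> 0).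
Proof. by move=> x x0; split; [exact: ri_cst|rewrite Rintegral_cst// mul0r addr0]. Qed.

(** Writing [g t] as [g 0] plus the integral of [g'] and exchanging the order of integration over
    the triangle turns the integral of [f' t * (g t - g 0)] into that of [(f x - f s) * g' s]; the
    terms then recombine. *)
Lemma acM f f' g g' : ac f f' -> ac g g' ->
  ac (f \* g) (fun x => f' x * g x + f x * g' x).
Proof.
move=> hf hg x x0; have rf := ac_ri hf x0; have rg := ac_ri hg x0.
have r1 : ri `[0, x] (fun t => f' t * g t).
  by apply: eq_ri (riMcont (ac_cont hg) rf) => // t _ /=; rewrite mulrC.
have r2 : ri `[0, x] (fun t => f t * g' t) := riMcont (ac_cont hf) rg.
split; first exact: riD.
rewrite RintegralD//=.
have -> : \int[mu]_(t in `[0, x]) (f' t * g t) =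
  g 0 * \int[mu]_(t in `[0, x]) f' t +
  \int[mu]_(s in `[0, x]) (\int[mu]_(t in `[s, x]) f' t * g' s).
  rewrite -Rint_fubini//.
  have E t : `[0, x]%classic t -> f' t * \int[mu]_(s in `[0, t]) g' s = f' t * g t - g 0 * f' t.
    by rewrite /= in_itv/= => /andP[t0 _]; rewrite (acE hg t0); ring.
  rewrite (eq_Rint E) RintegralB//; last exact: riZ.
  by rewrite RintegralZl//; ring.
have E s : `[0, x]%classic s -> \int[mu]_(t in `[s, x]) f' t * g' s = f x * g' s - f s * g' s.
  by rewrite /= in_itv/= => s0x; rewrite -(acB hf s0x) mulrBl.
rewrite (eq_Rint E) RintegralB//; last exact: riZ.
rewrite RintegralZl// (acE hf x0) (acE hg x0).
by ring.
Qed.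
(** Differentiability is asked only at interior points, where one-sided and ordinary derivatives
    agree; continuity of [f] and [g] up to 0 supplies the rest. *)
Lemma ac_C1 f g : {within Rp, continuous f} -> {within Rp, continuous g} ->
  (forall x, 0 < x -> is_derive x 1 f (g x)) -> ac f g.
Proof.
move=> cf cg dfg x x0; split; first exact: ri_cont.
move: x0; rewrite le_eqVlt => /predU1P[<-|x0].
  by rewrite set_itv1 Rintegral_set1 addr0.
have dF : derivable_oo_LRcontinuous f 0 x.
  have /(continuous_within_itvP _ x0)[_ f0 fx] := @within_halflineS f x cf.
  by split=> // t /[!in_itv]/= /andP[t0 _]; by have [] := dfg _ t0.
have F'f : {in `]0, x[, derive1 f =1 g}.
  move=> t /[!in_itv]/= /andP[t0 _]; rewrite derive1E.
  by case: (dfg t t0) => _ ->.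
rewrite /Rintegral (continuous_FTC2 x0 _ dF F'f); last exact: within_halflineS.
by rewrite -EFinB /=; ring.
Qed.

Lemma Rint_supp D E f : measurable D -> measurable E -> D `<=` E ->
  (forall x, E x -> ~ D x -> f x = 0) ->
  \int[mu]_(x in E) f x = \int[mu]_(x in D) f x.
Proof.
move=> mD mE DE f0; rewrite -{1}(setIidr DE) Rintegral_mkcondr.
apply: eq_Rint => x Ex; rewrite patchE; case: ifPn => // /negP xD.
by apply: f0 => // Dx; apply: xD; rewrite inE.
Qed.

Lemma ri_supp D E f : measurable D -> measurable E -> D `<=` E ->
  (forall x, E x -> ~ D x -> f x = 0) -> ri D f -> ri E f.
Proof.
move=> mD mE DE f0 /(ri_restrict _ mD).1 /(riS measurableT mE (@subsetT _ _)).
apply: eq_ri => // x Ex; rewrite patchE; case: ifPn => // /negP xD.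
by rewrite f0// => Dx; apply: xD; rewrite inE.
Qed.

Lemma Rint_lim g : ri Rp g ->
  \int[mu]_(t in `[0, n%:R]) g t @[n --> \oo] --> \int[mu]_(t in Rp) g t.
Proof.
move=> ig.
pose f_ (n : nat) x : \bar R := ((g \_ `[0, n%:R]) x)%:E.
have mg : measurable_fun Rp g by apply/measurable_EFinP; exact: measurable_int ig.
have mf_ n : measurable_fun Rp (f_ n).
  apply/measurable_EFinP; apply/measurable_restrict => //.
  by apply: measurable_funS mg => //; apply: subIsetr.
have lim x : Rp x -> f_ ^~ x @ \oo --> (g x)%:E.
  rewrite /halfline/= in_itv/= andbT => x0.
  apply: cvg_near_cst; exists (Num.truncn x).+1 => // n /= nx; rewrite /f_ patchE mem_set//=.
  by rewrite in_itv/= x0/= ltW// (lt_le_trans (truncnS_gt _))// ler_nat.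
have dom : {ae mu, forall x n, Rp x -> (`|f_ n x| <= `|(g x)%:E|)%E}.
  apply: aeW => x n _; rewrite /f_ patchE; case: ifP => //= _.
  by rewrite normr0 lee_fin.
have iabs : mu.-integrable Rp (abse \o (EFin \o g)) by apply: integrable_abse.
have aelim : {ae mu, forall x, Rp x -> f_ ^~ x @ \oo --> (EFin \o g) x} by exact: aeW.
have mEg : measurable_fun Rp (EFin \o g) by exact: measurable_int ig.
have [_ _] := @dominated_convergence _ _ R mu Rp measurable_halfline f_ (EFin \o g) (abse \o (EFin \o g)) mf_ mEg aelim iabs dom.
have E n : (\int[mu]_(x in Rp) f_ n x = (\int[mu]_(t in `[0%R, n%:R]) g t)%R%:E)%E.
  rewrite /f_ -[LHS]fineK.
    congr (_ %:E); rewrite -[LHS]/(Rintegral mu Rp (g \_ `[0, n%:R])) -Rintegral_mkcondr.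
    by rewrite setIidr//; apply: subset_itvl.
  apply: integrable_fin_num => //.
  apply: (@ri_supp `[0, n%:R]) => //.
  - by apply: subset_itvl.
  - by move=> x _ nx; rewrite patchE memNset.
  - apply: (@eq_ri _ g) => //; first by move=> x xD; rewrite patchE mem_set.
    by apply: riS ig => //; apply: subset_itvl.
rewrite (_ : [sequence _]_n = EFin \o (fun n : nat => (\int[mu]_(t in `[0, n%:R]) g t))); last first.
  by apply/funext => n; rewrite /= E.
rewrite [X in _ --> X -> _](_ : _ = (\int[mu]_(t in Rp) g t)%:E).
  by move/fine_cvg.
by rewrite fineK//; exact: integrable_fin_num.
Qed.

(** The boundary term at infinity disappears because [f] tends to 0 along the integers: averaging
    over the unit interval after n bounds |f n| by the integrals of |f| and |g| there, which are
    differences of consecutive terms of convergent sequences. *)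
Lemma ac_int0 f g : ac f g -> ri Rp f -> ri Rp g ->
  \int[mu]_(t in Rp) g t = - f 0.
Proof.
move=> h rf rg.
have L1 : f n%:R @[n --> \oo] --> f 0 + \int[mu]_(t in Rp) g t.
  under eq_fun do rewrite (acE h)//.
  by apply: cvgD; [exact: cvg_cst|exact: Rint_lim].
have L2 (k : R -> R) : ri Rp k -> \int[mu]_(t in `[n%:R, n.+1%:R]) `|k t| @[n --> \oo] --> (0:R).
  move=> rk; have ra : ri Rp (Num.norm \o k) by exact: integrable_norm.
  pose u (n : nat) := \int[mu]_(t in `[0, n%:R]) `|k t|.
  have Hu : u @ \oo --> \int[mu]_(t in Rp) `|k t| by exact: (Rint_lim ra).
  have H1 : (fun n => u n.+1) @ \oo --> \int[mu]_(t in Rp) `|k t| by rewrite (cvg_shiftS u).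
  rewrite (_ : (fun n : nat => _) = (fun n => u n.+1 - u n)).
    by rewrite -(subrr (\int[mu]_(t in Rp) `|k t|)); exact: cvgB.
  apply/funext => n; rewrite /u (@Rint_cat _ n%:R n.+1%:R) ?ler0n ?ler_nat ?leqnSn//; first by ring.
  by apply: riS ra => //; apply: subset_itvl.
have L3 : f n%:R @[n --> \oo] --> (0:R).
  apply/norm_cvg0P.
  apply: (@squeeze_cvgr _ _ _ _ (cst 0) (fun n : nat => \int[mu]_(t in `[n%:R, n.+1%:R]) `|f t| + \int[mu]_(t in `[n%:R, n.+1%:R]) `|g t|)).
  - near=> n; rewrite normr_ge0/=.
    have Sn : `[n%:R, n.+1%:R]%classic `<=` Rp.
      by rewrite /halfline; apply: subset_itv; rewrite bnd_simp.
    have rfn : ri `[n%:R, n.+1%:R] (Num.norm \o f) by apply: integrable_norm; exact: riS rf.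
    have rgn : ri `[n%:R, n.+1%:R] (Num.norm \o g) by apply: integrable_norm; exact: riS rg.
    set G := \int[mu]_(t in _) `|g t|.
    have -> : `|f n%:R| = \int[mu]_(t in `[n%:R, n.+1%:R]) `|f n%:R|.
      rewrite Rintegral_cst//= lebesgue_measure_itv/= lte_fin ltr_nat ltnSn.
      by rewrite -EFinB/= -natrB// subSnn mulr1.
    have -> : G = \int[mu]_(t in `[n%:R, n.+1%:R]) G.
      rewrite Rintegral_cst//= lebesgue_measure_itv/= lte_fin ltr_nat ltnSn.
      by rewrite -EFinB/= -natrB// subSnn mulr1.
    rewrite -RintegralD//; last exact: ri_cst.
    apply: le_Rintegral => //; first exact: ri_cst.
      by apply: riD => //; exact: ri_cst.
    move=> x; rewrite /= in_itv/= => /andP[nx xn].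
    have -> : f n%:R = f x - \int[mu]_(t in `[n%:R, x]) g t.
      by rewrite -(acB h) ?ler0n//; ring.
    rewrite (le_trans (ler_normB _ _))// lerD2l.
    have S' : `[n%:R, x]%classic `<=` `[n%:R, n.+1%:R] by apply: subset_itvl; rewrite bnd_simp.
    rewrite (le_trans (le_normr_Rintegral _ _))//; first by apply: riS rg => //; exact: subset_trans S' Sn.
    rewrite /G -(setIidr S') Rintegral_mkcondr; apply: le_Rintegral => //.
      apply: (@ri_supp `[n%:R, x]) => //.
        by move=> t _ nt; rewrite patchE memNset.
      by apply: (@eq_ri _ (Num.norm \o g)) => //; [move=> t xD; rewrite patchE mem_set|exact: riS rgn].
    by move=> t _; rewrite patchE; case: ifP => // _; exact: normr_ge0.
  - exact: cvg_cst.
  - by rewrite -[X in _ --> X]addr0; apply: cvgD; exact: L2.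
have E : f 0 + \int[mu]_(t in Rp) g t = 0.
  by apply: cvg_unique L1 L3; exact: Rhausdorff.
by apply/eqP; rewrite -addr_eq0 addrC E.
Unshelve. all: by end_near. Qed.

Lemma aeS (P Q : R -> Prop) : (forall x, P x -> Q x) ->
  {ae mu, forall x, P x} -> {ae mu, forall x, Q x}.
Proof.
move=> PQ [A [mA A0 PA]]; exists A; split=> // x nQ.
by apply: PA => Px; apply: nQ; exact: PQ.
Qed.

Lemma aeI (P Q : R -> Prop) : {ae mu, forall x, P x} -> {ae mu, forall x, Q x} ->
  {ae mu, forall x, P x /\ Q x}.
Proof.
move=> HP HQ; apply: negligibleS (negligibleU HP HQ) => x /=.
by move=> /not_andP.
Qed.

Lemma ae_neq c : {ae mu, forall x, x <> c}.
Proof.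
exists [set c]; split=> //; first exact: lebesgue_measure_set1.
by move=> x /=; apply: contra_notP => nxc xc; apply: nxc.
Qed.

(** Lebesgue differentiation asks for integrability on the whole line, so it is applied to the
    truncation of [h] to each [[0, n]], and the countably many null sets are united. The origin,
    where the truncations jump, is set aside as a null set. *)
Lemma Rint_eq0_ae h : (forall x, 0 <= x -> ri `[0, x] h) ->
  (forall x, 0 <= x -> \int[mu]_(t in `[0, x]) h t = 0) ->
  {ae mu, forall x, Rp x -> h x = 0}.
Proof.
move=> rh h0.
have H (n : nat) : {ae mu, forall x, 0 < x <= n%:R -> h x = 0}.
  pose k : R -> R := h \_ `[0, n%:R].
  have rk : ri setT k by apply: (ri_restrict _ (measurable_itv _)).1; exact: rh.
  have rky y : ri `[0, y] k by exact: riS rk.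
  have lk : locally_integrable setT k by apply: integrable_locally => //; exact: rh.
  have F0 : (fun x => \int[mu]_(t in [set` Interval (BLeft 0) (BRight x)]) k t) = cst 0.
    apply/funext => x; rewrite /k -Rintegral_mkcondr.
    have -> : `[0, x]%classic `&` `[0, n%:R]%classic = `[0, Num.min x n%:R]%classic.
      apply/seteqP; split=> y /=; rewrite !in_itv/= le_min.
        by move=> [/andP[-> ->] /andP[_ ->]].
      by move=> /and3P[-> -> ->].
    have [x0|x0] := leP 0 (Num.min x n%:R); first exact: h0.
    by rewrite set_itv_ge ?Rintegral_set0// bnd_simp -ltNge.
  have := FTC1 rky lk; apply: aeS => x /=.
  rewrite F0 => + /andP[x0 xn].
  case; first by rewrite lte_fin.
  by move=> _; rewrite derive1_cst /k patchE mem_set//= in_itv/= ltW.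
have := aeI (ae_foralln H) (ae_neq 0); apply: aeS => x [Hx x0].
rewrite /halfline/= in_itv/= andbT le_eqVlt => /predU1P[/esym//|xgt0].
by apply: (Hx (Num.truncn x).+1); rewrite xgt0/= ltW// truncnS_gt.
Qed.
(** Trapezoid with sides of slope [n] over [[a, b]], a continuous stand-in for the indicator: its
    primitives are C^1, as test functions must be. *)
Definition trap (a b : R) (n : nat) (x : R) : R :=
  Num.min 1 (n%:R * Num.max 0 (Num.min (x - a) (b - x))).

Lemma trap_continuous a b n : continuous (trap a b n).
Proof.
move=> x; rewrite /trap.
apply: (@continuous_min R R (cst 1) (fun x => n%:R * Num.max 0 (Num.min (x - a) (b - x)))).
  exact: cvg_cst.
apply: (@continuousM R R (cst n%:R) (fun x => Num.max 0 (Num.min (x - a) (b - x)))); first exact: cvg_cst.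
apply: (@continuous_max R R (cst 0) (fun x => Num.min (x - a) (b - x))); first exact: cvg_cst.
apply: (@continuous_min R R (fun x => x - a) (fun x => b - x)).
  by apply: (@continuousB R R R id (cst a)); [exact: cvg_id|exact: cvg_cst].
by apply: (@continuousB R R R (cst b) id); [exact: cvg_cst|exact: cvg_id].
Qed.

Lemma trap_ge0 a b n x : 0 <= trap a b n x.
Proof. by rewrite /trap le_min ler01 mulr_ge0// le_max lexx. Qed.

Lemma trap_le1 a b n x : trap a b n x <= 1.
Proof. by rewrite /trap ge_min lexx. Qed.

Lemma trap_out a b n x : ~ (a < x < b) -> trap a b n x = 0.
Proof.
move=> nx; rewrite /trap (_ : Num.max 0 _ = 0); last first.
  apply/eqP; rewrite eq_le le_max lexx andbT ge_max lexx/= ge_min !subr_le0.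
  by apply/negPn/negP; rewrite negb_or -!ltNge; exact: nx.
by rewrite mulr0 minEle ler10.
Qed.

Lemma trap_cvg a b x : a < x < b -> trap a b n x @[n --> \oo] --> (1 : R).
Proof.
move=> /andP[ax xb]; set d := Num.min (x - a) (b - x).
have d0 : 0 < d by rewrite lt_min !subr_gt0 ax.
apply: cvg_near_cst; exists (Num.truncn d^-1).+1 => // n /= nd.
rewrite /trap -/d; have -> : Num.max 0 d = d by rewrite maxEle ltW.
rewrite minEle -ler_pdivrMr// mul1r ifT// ltW// (lt_le_trans (truncnS_gt _))//.
by rewrite ler_nat.
Qed.

Lemma trap_int_cvg a b h : 0 <= a -> ri `[0, b] h ->
  \int[mu]_(x in Rp) (h x * trap a b n x) @[n --> \oo] --> \int[mu]_(x in `[a, b]) h x.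
Proof.
move=> a0 rh.
have So : `]a, b[%classic `<=` Rp.
  by move=> x; rewrite /halfline/= !in_itv/= andbT => /andP[ax _]; rewrite ltW// (le_lt_trans a0).
have So' : `]a, b[%classic `<=` `[0, b].
  by move=> x; rewrite /= !in_itv/= => /andP[ax xb]; rewrite (ltW xb) ltW// (le_lt_trans a0).
have ro : ri `]a, b[ h by exact: riS rh.
have rc : ri `[a, b] h by apply: ri_itvS rh.
have E n : \int[mu]_(x in Rp) (h x * trap a b n x) = \int[mu]_(x in `]a, b[) (h x * trap a b n x).
  apply: Rint_supp => // x _ nx; by rewrite trap_out ?mulr0.
under eq_fun do rewrite E.
have -> : \int[mu]_(x in `[a, b]) h x = \int[mu]_(x in `]a, b[) h x.
  rewrite -Rintegral_itv_obnd_cbnd ?Rintegral_itv_bndo_bndc//.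
  by apply: riS rc => //; apply: subset_itv; rewrite bnd_simp.
pose f_ (n : nat) x : \bar R := (h x * trap a b n x)%:E.
have mh : measurable_fun `]a, b[ h by apply/measurable_EFinP; exact: measurable_int ro.
have mt n : measurable_fun `]a, b[ (trap a b n).
  by apply: measurable_funS (continuous_measurable_fun (@trap_continuous a b n)).
have mf_ n : measurable_fun `]a, b[ (f_ n).
  by apply/measurable_EFinP; exact: measurable_funM.
have mEh : measurable_fun `]a, b[ (EFin \o h) by exact: measurable_int ro.
have aelim : {ae mu, forall x, `]a, b[%classic x -> f_ ^~ x @ \oo --> (EFin \o h) x}.
  apply: aeW => x; rewrite /= in_itv/= => axb.
  apply: cvg_EFin; first by near=> n.
  rewrite /comp /= -[X in _ --> X]mulr1; apply: cvgM; [exact: cvg_cst|exact: trap_cvg].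
have dom : {ae mu, forall x n, `]a, b[%classic x -> (`|f_ n x| <= `|(h x)%:E|)%E}.
  apply: aeW => x n _; rewrite /f_ /= lee_fin normrM ler_piMr//.
  by rewrite ger0_norm ?trap_ge0 ?trap_le1.
have iabs : mu.-integrable `]a, b[ (abse \o (EFin \o h)) by apply: integrable_abse.
have [_ _] := @dominated_convergence _ _ R mu `]a, b[%classic (measurable_itv _) f_ (EFin \o h) (abse \o (EFin \o h)) mf_ mEh aelim iabs dom.
rewrite [X in _ --> X -> _](_ : _ = (\int[mu]_(t in `]a, b[) h t)%:E).
  by move/fine_cvg.
by rewrite fineK//; exact: integrable_fin_num.
Unshelve. all: by end_near. Qed.

(** Integrating from -oo makes the primitive vanish to the left of [a], and the zero mean of [w]
    makes it vanish to the right of [b], so its support is compact in the open half-line. *)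
Lemma test_primitive (w : R -> R) a b : 0 < a -> continuous w ->
  (forall x, ~ (a <= x <= b) -> w x = 0) -> \int[mu]_(x in `[a, b]) w x = 0 ->
  exists2 chi, test_function chi & derive1 chi = w.
Proof.
move=> a0 cw w0 iw.
have rab : ri `[a, b] w.
  apply: (@ri_itvS a b b) => //; first exact: ltW.
  by apply: ri_cont; exact: continuous_subspaceT.
have wE x : w x = (w \_ `[a, b]) x.
  rewrite patchE; case: ifPn => // /negP nx; apply: w0 => axb; apply: nx.
  by rewrite inE/= in_itv.
have rw : ri setT w.
  by apply: eq_ri ((ri_restrict _ (measurable_itv `[a, b])).1 rab) => // x _; rewrite -wE.
pose chi x := \int[mu]_(t in `]-oo, x]) w t.
have D x : derivable chi x 1 /\ derive1 chi x = w x.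
  apply: (@continuous_FTC1 R w -oo%O x (x + 1)).
  - by rewrite ltrDl.
  - exact: riS rw.
  - by rewrite ltNyr.
  - exact: cw.
have chi' : derive1 chi = w by apply/funext => x; case: (D x).
exists chi => //; split.
- by move=> x; case: (D x).
- by rewrite chi'.
exists a, b; split=> // x; rewrite negb_and -!ltNge => xab.
have -> : chi x = \int[mu]_(t in `]-oo, x] `&` `[a, b]) w t.
  by rewrite Rintegral_mkcondr; apply: eq_Rint => t _; rewrite -wE.
case/orP: xab => [xa|bx].
  rewrite (_ : _ `&` _ = set0) ?Rintegral_set0//.
  apply/seteqP; split=> // t [] /=; rewrite !in_itv/= => tx /andP[at_ _].
  by have := lt_le_trans (le_lt_trans tx xa) at_; rewrite ltxx.
rewrite (_ : _ `&` _ = `[a, b]%classic)//.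
apply/seteqP; split=> [t []//|t tab]; split=> //.
by move: tab; rewrite /= !in_itv/= => /andP[_ tb]; rewrite (le_trans tb)// ltW.
Qed.

(** The constant has to be the mean of [h] over any interval; [[1, 2]] is a reference interval of
    length one, against which every other interval is compared. *)
Lemma du_bois_reymond h : (forall x, 0 <= x -> ri `[0, x] h) ->
  (forall chi, test_function chi -> \int[mu]_(x in Rp) (h x * derive1 chi x) = 0) ->
  exists C, {ae mu, forall x, Rp x -> h x = C}.
Proof.
move=> rh hchi; set C := \int[mu]_(x in `[1, 2]) h x; exists C.
have rtr k a b n : (forall x, 0 <= x -> ri `[0, x] k) -> 0 <= a -> ri Rp (fun x => k x * trap a b n x).
  move=> rk a0; have [b0|b0] := leP 0 b; last first.
    apply: (@eq_ri _ (fun=> 0)) => //; last by apply: integrable0.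
    move=> x; rewrite /halfline/= in_itv/= andbT => x0; rewrite trap_out ?mulr0// => /andP[_ xb].
    by have := lt_trans xb b0; rewrite ltNge x0.
  apply: (@ri_supp `[0, b]) => //.
  - exact: subset_itvl.
  - move=> x _ nx; rewrite trap_out ?mulr0// => /andP[ax xb]; apply: nx.
    by rewrite /= in_itv/= (le_trans a0 (ltW ax)) ltW.
  - apply: (@eq_ri _ (trap a b n \* k)) => //; first by move=> x _; rewrite /= mulrC.
    by apply: riMcont; [exact: continuous_subspaceT (@trap_continuous a b n)|exact: rk].
have r1 x : 0 <= x -> ri `[0, x] (fun=> 1) by move=> _; exact: ri_cst.
(* Weighting each of the two trapezoids by the mass of the other gives a function of zero mean,
   hence the derivative of a test function, on which [h] integrates to zero. *)
have key a b n : 0 < a -> a <= b ->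
  (\int[mu]_(x in Rp) (1 * trap 1 2 n x)) * (\int[mu]_(x in Rp) (h x * trap a b n x)) =
  (\int[mu]_(x in Rp) (1 * trap a b n x)) * (\int[mu]_(x in Rp) (h x * trap 1 2 n x)).
  move=> a0 ab.
  set M := \int[mu]_(x in Rp) (1 * trap 1 2 n x).
  set m := \int[mu]_(x in Rp) (1 * trap a b n x).
  pose w x := M * trap a b n x - m * trap 1 2 n x.
  pose a' := Num.min a 1; pose b' := Num.max b 2.
  have w0 x : ~ (a' <= x <= b') -> w x = 0.
    move=> nx; rewrite /w !trap_out ?mulr0 ?subr0//.
      move=> /andP[x1 x2]; apply: nx; rewrite /a' /b' ge_min le_max (ltW x1) (ltW x2).
      by rewrite !orbT.
    by move=> /andP[x1 x2]; apply: nx; rewrite /a' /b' ge_min le_max (ltW x1) (ltW x2).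
  have a'0 : 0 < a' by rewrite lt_min a0 ltr01.
  have cw : continuous w.
    by move=> x; apply: cvgB; apply: cvgM; try exact: cvg_cst; exact: trap_continuous.
  have r1a := rtr _ a b n r1 (ltW a0); have r112 := rtr _ 1 2 n r1 ler01.
  have rha := rtr _ a b n rh (ltW a0); have rh12 := rtr _ 1 2 n rh ler01.
  have iw : \int[mu]_(x in `[a', b']) w x = 0.
    rewrite -(@Rint_supp _ Rp)//; last 2 first.
    - by move=> x; rewrite /halfline/= !in_itv/= andbT => /andP[ax _]; rewrite (le_trans (ltW a'0)).
    - by move=> x _ nx; apply: w0 => xab; apply: nx; rewrite /= in_itv.
    rewrite (@eq_Rint _ _ (fun x => M * (1 * trap a b n x) - m * (1 * trap 1 2 n x))); last first.
      by move=> x _; rewrite !mul1r.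
    rewrite RintegralB//; [|exact: riZ|exact: riZ].
    have -> : \int[mu]_(x in Rp) (M * (1 * trap a b n x)) = M * m by rewrite RintegralZl.
    have -> : \int[mu]_(x in Rp) (m * (1 * trap 1 2 n x)) = m * M by rewrite RintegralZl.
    by ring.
  have [chi tchi chiw] := test_primitive a'0 cw w0 iw.
  have := hchi _ tchi; rewrite chiw.
  rewrite (@eq_Rint _ _ (fun x => M * (h x * trap a b n x) - m * (h x * trap 1 2 n x))); last first.
    by move=> x _; rewrite /w; ring.
  rewrite RintegralB//; [|exact: riZ|exact: riZ].
  by rewrite !RintegralZl// => /eqP; rewrite subr_eq0 => /eqP.
have one a b : 0 <= a -> a <= b -> \int[mu]_(x in Rp) (1 * trap a b n x) @[n --> \oo] --> b - a.
  move=> a0 ab; have := @trap_int_cvg a b (fun=> 1) a0 (ri_cst _ _ _).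
  rewrite Rintegral_cst//= lebesgue_measure_itv/= lte_fin.
  move: ab; rewrite le_eqVlt => /predU1P[->|ab]; first by rewrite ltxx/= mulr0 subrr.
  by rewrite ab -EFinB/= mul1r.
have K a b : 0 < a -> a <= b -> \int[mu]_(x in `[a, b]) h x = (b - a) * C.
  move=> a0 ab.
  have L : (\int[mu]_(x in Rp) (1 * trap 1 2 n x)) * (\int[mu]_(x in Rp) (h x * trap a b n x)) @[n --> \oo]
      --> (2 - 1) * \int[mu]_(x in `[a, b]) h x.
    apply: cvgM; first by apply: one => //; rewrite ler1n.
    by apply: trap_int_cvg; [exact: ltW|apply: rh; rewrite (le_trans (ltW a0))].
  have L' : (\int[mu]_(x in Rp) (1 * trap 1 2 n x)) * (\int[mu]_(x in Rp) (h x * trap a b n x)) @[n --> \oo]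
      --> (b - a) * C.
    under eq_fun do rewrite key//.
    apply: cvgM; first by apply: one => //; exact: ltW.
    by apply: trap_int_cvg => //; exact: rh.
  have E : (2 - 1) * \int[mu]_(x in `[a, b]) h x = (b - a) * C.
    by apply: cvg_unique L L'; exact: Rhausdorff.
  by rewrite -E; ring.
have rhC x : 0 <= x -> ri `[0, x] (fun t => h t - C).
  by move=> x0; apply: (@riD _ h (fun=> - C)) => //; [exact: rh|exact: ri_cst].
suff Z : {ae mu, forall x, Rp x -> h x - C = 0}.
  by apply: aeS Z => x /[apply] /eqP; rewrite subr_eq0 => /eqP.
apply: Rint_eq0_ae => // x; rewrite le_eqVlt => /predU1P[<-|x0].
  by rewrite set_itv1 Rintegral_set1.
pose H y := \int[mu]_(t in `[0, y]) (h t - C).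
have Hac : ac H (fun t => h t - C).
  by move=> y y0; split; [exact: rhC|rewrite /H set_itv1 Rintegral_set1 add0r].
have Hc y : 0 < y <= x -> H y = H x.
  move=> /andP[y0 yx]; apply/eqP; rewrite eq_sym -subr_eq0 (acB Hac) ?(ltW y0)//.
  rewrite RintegralB//; [|by apply: ri_itvS (rh x (ltW x0)); [exact: ltW|]|exact: ri_cst].
  rewrite K// Rintegral_cst//= lebesgue_measure_itv/= lte_fin.
  move: yx; rewrite le_eqVlt => /predU1P[->|yx]; first by rewrite ltxx/= mulr0 subrr mul0r subr0.
  by rewrite yx -EFinB/= mulrC subrr.
(* Test functions are supported away from 0, so [H] is only known to be constant on []0, x]]; its
   right continuity at 0 brings the constant down to [H 0], an integral over a point. *)
have /(continuous_within_itvP _ x0)[_ H0 _] := ac_cont_itv Hac (ltW x0).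
have H1 : H y @[y --> 0^'+] --> H x.
  apply: cvg_near_cst; near=> y; apply: Hc.
  by apply/andP; split; near: y; [exact: nbhs_right_gt|exact: nbhs_right_le].
have HE : H x = H 0 by apply: cvg_unique H1 H0; exact: Rhausdorff.
by rewrite -[LHS]/(H x) HE /H set_itv1 Rintegral_set1.
Unshelve. all: by end_near. Qed.
End RealAC.

#[local] Hint Extern 0 (measurable (@halfline _)) => solve [exact: measurable_halfline] : core.

(** * Complex-valued integrals and the L^2 norm *)

Section ComplexAC.
Variable R : realType.
Notation mu := (@lebesgue_measure R).
Notation ri D f := (mu.-integrable D (EFin \o f)).
Notation Rp := (@halfline R).
Notation Re := (@complex.Re R).
Notation Im := (@complex.Im R).
Implicit Types (f g : R -> R) (F G H : R -> R[i]) (x y b M : R) (z w c : R[i]) (D E : set R).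

Lemma cReD z w : Re (z + w) = Re z + Re w. Proof. by case: z; case: w. Qed.
Lemma cImD z w : Im (z + w) = Im z + Im w. Proof. by case: z; case: w. Qed.
Lemma cReN z : Re (- z) = - Re z. Proof. by case: z. Qed.
Lemma cImN z : Im (- z) = - Im z. Proof. by case: z. Qed.
Lemma cReM z w : Re (z * w) = Re z * Re w - Im z * Im w.
Proof. by case: z; case: w. Qed.
Lemma cImM z w : Im (z * w) = Re z * Im w + Im z * Re w.
Proof. by case: z; case: w. Qed.
Lemma cReJ z : Re z^* = Re z. Proof. by case: z. Qed.
Lemma cImJ z : Im z^* = - Im z. Proof. by case: z. Qed.
Lemma cReC x : Re x%:C = x. Proof. by []. Qed.
Lemma cImC x : Im x%:C = 0. Proof. by []. Qed.
Lemma cReMr x z : Re (x%:C * z) = x * Re z. Proof. by rewrite cReM cReC cImC mul0r subr0. Qed.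
Lemma cImMr x z : Im (x%:C * z) = x * Im z. Proof. by rewrite cImM cReC cImC mul0r addr0. Qed.
Definition cint D F : R[i] :=
  (\int[mu]_(x in D) Re (F x)) +i* (\int[mu]_(x in D) Im (F x)).
Lemma Re_cint D F : Re (cint D F) = \int[mu]_(x in D) Re (F x). Proof. by []. Qed.
Lemma Im_cint D F : Im (cint D F) = \int[mu]_(x in D) Im (F x). Proof. by []. Qed.
Definition reimE := (Re_cint, Im_cint, cReD, cImD, cReN, cImN, cReJ, cImJ, cReMr, cImMr, cReM, cImM, cReC, cImC).

Lemma complex_eq z w : Re z = Re w -> Im z = Im w -> z = w.
Proof. by case: z => a b; case: w => c d /= -> ->. Qed.

Definition sqn z : R := Re z ^+ 2 + Im z ^+ 2.

Lemma sqn_ge0 z : 0 <= sqn z.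
Proof. by rewrite addr_ge0// sqr_ge0. Qed.

Lemma sqn_normc z : sqn z = normc z ^+ 2.
Proof. by case: z => a b; rewrite /normc sqr_sqrtr// addr_ge0// sqr_ge0. Qed.

Lemma normc_ge0 z : 0 <= normc z.
Proof. by case: z => a b; exact: sqrtr_ge0. Qed.

Lemma sqnM z w : sqn (z * w) = sqn z * sqn w.
Proof. by rewrite /sqn !reimE; ring. Qed.

Lemma sqnJ z : sqn z^* = sqn z.
Proof. by rewrite /sqn !reimE sqrrN. Qed.

Lemma normc_conjc z : normc z^* = normc z.
Proof. by case: z => a b; rewrite /= sqrrN. Qed.

Lemma normcR x : normc x%:C = `|x|.
Proof. by rewrite /= expr0n/= addr0 sqrtr_sqr. Qed.

Lemma Re_le_normc z : `|Re z| <= normc z.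
Proof. by case: z => a b /=; rewrite -sqrtr_sqr ler_wsqrtr// lerDl sqr_ge0. Qed.

Lemma Im_le_normc z : `|Im z| <= normc z.
Proof. by case: z => a b /=; rewrite -sqrtr_sqr ler_wsqrtr// lerDr sqr_ge0. Qed.

Lemma normc_le_ReIm z : normc z <= `|Re z| + `|Im z|.
Proof.
rewrite -(@ler_pXn2r _ 2)// ?nnegrE ?normc_ge0 ?addr_ge0//.
rewrite -sqn_normc /sqn sqrrD !real_normK ?num_real//.
by have := mulr_ge0 (normr_ge0 (Re z)) (normr_ge0 (Im z)); lra.
Qed.

Lemma mulJ z : z * z^* = (sqn z)%:C.
Proof. by apply: complex_eq; rewrite !reimE /sqn; ring. Qed.

Lemma Re_le z : Re z <= normc z.
Proof. exact: le_trans (ler_norm _) (Re_le_normc z). Qed.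

(** A phase rotating [z] onto the nonnegative axis: the modulus of an integral becomes the real part
    of a rotated integral, which can be bounded pointwise. *)
Lemma normc_unit z : exists2 u, normc u = 1 & u * z = (normc z)%:C.
Proof.
have [->|z0] := eqVneq z 0.
  by exists 1; [exact: normc1|rewrite mulr0 normc0].
have n0 : normc z != 0 by apply: contra z0 => /eqP/eq0_normc ->.
exists (z^* * (normc z)^-1%:C).
  by rewrite normcM normc_conjc normcR ger0_norm ?invr_ge0 ?normc_ge0// divff.
rewrite mulrAC [z^* * z]mulrC mulJ sqn_normc -rmorphM.
by rewrite expr2 -mulrA divff ?mulr1.
Qed.

Definition cmeas D F := measurable_fun D (fun x => Re (F x)) /\ measurable_fun D (fun x => Im (F x)).
Definition ci D F := ri D (fun x => Re (F x)) /\ ri D (fun x => Im (F x)).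
Definition cac F G := ac (fun x => Re (F x)) (fun x => Re (G x)) /\
  ac (fun x => Im (F x)) (fun x => Im (G x)).

Lemma eq_ci D F G : measurable D -> (forall x, D x -> F x = G x) -> ci D F -> ci D G.
Proof. by move=> mD FG [F1 F2]; split; [move: F1|move: F2]; apply: eq_ri => // x Dx; rewrite FG. Qed.

Lemma eq_cint D F G : (forall x, D x -> F x = G x) -> cint D F = cint D G.
Proof. by move=> FG; congr (_ +i* _); apply: eq_Rint => x Dx; rewrite FG. Qed.

Lemma ciS D E F : measurable E -> measurable D -> D `<=` E -> ci E F -> ci D F.
Proof. by move=> mE mD DE [F1 F2]; split; [move: F1|move: F2]; exact: riS. Qed.

Lemma riN D f : measurable D -> ri D f -> ri D (fun x => - f x).
Proof. by move=> mD /(riZ (-1) mD); apply: eq_ri => // x _; rewrite mulN1r. Qed.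

Lemma riB D f g : measurable D -> ri D f -> ri D g -> ri D (fun x => f x - g x).
Proof. by move=> mD fi gi; apply: riD => //; exact: riN. Qed.

Lemma ciD D F G : measurable D -> ci D F -> ci D G -> ci D (fun x => F x + G x).
Proof.
move=> mD [F1 F2] [G1 G2]; split.
  by apply: (eq_ri _ _ (riD mD F1 G1)) => // x _; rewrite /= cReD.
by apply: (eq_ri _ _ (riD mD F2 G2)) => // x _; rewrite /= cImD.
Qed.

Lemma ciZ D c F : measurable D -> ci D F -> ci D (fun x => c * F x).
Proof.
move=> mD [F1 F2]; split.
  by apply: (eq_ri _ _ (riB mD (riZ (Re c) mD F1) (riZ (Im c) mD F2))) => // x _; rewrite cReM.
by apply: (eq_ri _ _ (riD mD (riZ (Re c) mD F2) (riZ (Im c) mD F1))) => // x _; rewrite cImM.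
Qed.

Lemma ciN D F : measurable D -> ci D F -> ci D (fun x => - F x).
Proof. by move=> mD /(ciZ (-1) mD); apply: eq_ci => // x _; rewrite mulN1r. Qed.

Lemma cintD D F G : measurable D -> ci D F -> ci D G ->
  cint D (fun x => F x + G x) = cint D F + cint D G.
Proof.
move=> mD [F1 F2] [G1 G2]; apply: complex_eq; rewrite !reimE.
  by rewrite -RintegralD//; apply: eq_Rint => x _; rewrite cReD.
by rewrite -RintegralD//; apply: eq_Rint => x _; rewrite cImD.
Qed.

Lemma cintZ D c F : measurable D -> ci D F -> cint D (fun x => c * F x) = c * cint D F.
Proof.
move=> mD [F1 F2]; apply: complex_eq; rewrite !reimE.
  rewrite -!RintegralZl// -RintegralB//; [|exact: riZ|exact: riZ].
  by apply: eq_Rint => x _; rewrite cReM.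
rewrite -!RintegralZl// -RintegralD//; [|exact: riZ|exact: riZ].
by apply: eq_Rint => x _; rewrite cImM.
Qed.

Lemma cintN D F : measurable D -> ci D F -> cint D (fun x => - F x) = - cint D F.
Proof.
move=> mD iF; rewrite -[RHS]mulN1r -cintZ//; apply: eq_cint => x _.
by rewrite mulN1r.
Qed.

Lemma cintB D F G : measurable D -> ci D F -> ci D G ->
  cint D (fun x => F x - G x) = cint D F - cint D G.
Proof. by move=> mD hF hG; rewrite cintD// ?cintN//; exact: ciN. Qed.

Lemma cintJ D F : measurable D -> ci D F -> cint D (fun x => (F x)^*) = (cint D F)^*.
Proof.
move=> mD [F1 F2]; apply: complex_eq; rewrite !reimE.
  by apply: eq_Rint => x _; rewrite cReJ.
rewrite -mulN1r -RintegralZl//; apply: eq_Rint => x _; by rewrite cImJ mulN1r.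
Qed.

Lemma Re_cint_le D F f : measurable D -> ci D F -> ri D f ->
  (forall x, D x -> Re (F x) <= f x) -> Re (cint D F) <= \int[mu]_(x in D) f x.
Proof. by move=> mD [F1 F2] If Ff; apply: le_Rintegral. Qed.

Lemma normc_cint_le D F f : measurable D -> ci D F -> ri D f ->
  (forall x, D x -> normc (F x) <= f x) -> normc (cint D F) <= \int[mu]_(x in D) f x.
Proof.
move=> mD iF If Ff; have [u u1 uF] := normc_unit (cint D F).
have <- : Re (u * cint D F) = normc (cint D F) by rewrite uF.
rewrite -cintZ//; apply: Re_cint_le => //; first exact: ciZ.
by move=> x Dx; rewrite (le_trans (Re_le _))// normcM u1 mul1r Ff.
Qed.

Lemma le_ri D f g : measurable D -> measurable_fun D f -> (forall x, D x -> `|f x| <= g x) ->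
  ri D g -> ri D f.
Proof.
move=> mD mf fg; apply: le_integrable => //; first exact/measurable_EFinP.
by move=> x Dx; rewrite /= lee_fin (le_trans (fg x Dx))// ler_norm.
Qed.

Lemma le_ci D F g : measurable D -> cmeas D F -> (forall x, D x -> normc (F x) <= g x) ->
  ri D g -> ci D F.
Proof.
move=> mD [m1 m2] Fg ig; split; apply: (@le_ri _ _ g) => // x Dx.
  exact: le_trans (Re_le_normc _) (Fg _ Dx).
exact: le_trans (Im_le_normc _) (Fg _ Dx).
Qed.

Lemma eq_cmeas D F G : (forall x, D x -> F x = G x) -> cmeas D F -> cmeas D G.
Proof.
move=> FG [F1 F2]; split.
  by apply: eq_measurable_fun F1 => x /[!inE] Dx; rewrite FG.
by apply: eq_measurable_fun F2 => x /[!inE] Dx; rewrite FG.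
Qed.

Lemma cmeasS D E F : measurable E -> D `<=` E -> cmeas E F -> cmeas D F.
Proof. by move=> mE DE [F1 F2]; split; [move: F1|move: F2]; exact: measurable_funS. Qed.

Lemma cmeasM D F G : cmeas D F -> cmeas D G -> cmeas D (fun x => F x * G x).
Proof.
move=> [F1 F2] [G1 G2]; split.
  under eq_fun do rewrite cReM.
  by apply: measurable_funB; apply: measurable_funM.
under eq_fun do rewrite cImM.
by apply: measurable_funD; apply: measurable_funM.
Qed.

Lemma cmeasD D F G : cmeas D F -> cmeas D G -> cmeas D (fun x => F x + G x).
Proof.
move=> [F1 F2] [G1 G2]; split.
  under eq_fun do rewrite cReD.
  exact: measurable_funD.
under eq_fun do rewrite cImD.
exact: measurable_funD.
Qed.

Lemma cmeas_cst D c : cmeas D (fun=> c).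
Proof. by split; exact: measurable_cst. Qed.

Lemma cmeasC D f : measurable_fun D f -> cmeas D (fun x => (f x)%:C).
Proof. by move=> mf; split => //; exact: measurable_cst. Qed.

Lemma cmeasJ D F : cmeas D F -> cmeas D (fun x => (F x)^*).
Proof.
move=> [F1 F2]; split; first by under eq_fun do rewrite cReJ.
under eq_fun do rewrite cImJ.
exact: measurableT_comp.
Qed.

Lemma cmeasN D F : cmeas D F -> cmeas D (fun x => - F x).
Proof.
move=> mF; apply: (eq_cmeas _ (cmeasM (cmeas_cst D (-1)) mF)) => x _.
by rewrite mulN1r.
Qed.

Lemma cmeasB D F G : cmeas D F -> cmeas D G -> cmeas D (fun x => F x - G x).
Proof. by move=> mF mG; apply: cmeasD => //; exact: cmeasN. Qed.

Lemma measurable_sqn D F : cmeas D F -> measurable_fun D (fun x => sqn (F x)).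
Proof.
by move=> [F1 F2]; apply: measurable_funD; apply: measurable_funX.
Qed.

Lemma measurable_normc D F : cmeas D F -> measurable_fun D (fun x => normc (F x)).
Proof.
move=> mF; have H := measurable_sqn mF.
apply: (@eq_measurable_fun _ _ _ _ _ (Num.sqrt \o (fun x => sqn (F x)))).
  by move=> x _ /=; rewrite sqn_normc sqrtr_sqr ger0_norm ?normc_ge0.
by apply: measurableT_comp => //; apply: continuous_measurable_fun; exact: sqrt_continuous.
Qed.
Lemma ae_eqR_EFin D f g : {ae mu, forall x, D x -> f x = g x} ->
  ae_eq mu D (EFin \o f) (EFin \o g).
Proof. by apply: aeS => x H Dx; rewrite /= H. Qed.

Lemma ae_Rint D f g : measurable D -> measurable_fun D f -> measurable_fun D g ->
  {ae mu, forall x, D x -> f x = g x} ->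
  \int[mu]_(x in D) f x = \int[mu]_(x in D) g x.
Proof.
move=> mD mf mg fg; congr fine; apply: ae_eq_integral => //.
- exact/measurable_EFinP.
- exact/measurable_EFinP.
- exact: ae_eqR_EFin.
Qed.

Lemma ae_ri D f g : measurable D -> measurable_fun D g ->
  {ae mu, forall x, D x -> f x = g x} -> ri D f -> ri D g.
Proof.
move=> mD mg fg /integrableP[mf fi]; apply/integrableP; split; first exact/measurable_EFinP.
rewrite (@ge0_ae_eq_integral _ _ _ mu D (abse \o (EFin \o g)) (abse \o (EFin \o f)))//.
- by apply: measurableT_comp => //; exact/measurable_EFinP.
- exact: measurableT_comp.
- by move=> x _; exact: abse_ge0.
- by move=> x _; exact: abse_ge0.
- by move: fg; apply: aeS => x H Dx; rewrite /= H.
Qed.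

Lemma ac_ae f g h : ac f g -> measurable_fun Rp h ->
  {ae mu, forall x, Rp x -> g x = h x} -> ac f h.
Proof.
move=> fg mh gh x x0; have rg := ac_ri fg x0.
have S : `[0, x]%classic `<=` Rp by exact: subset_itvl.
have mh' : measurable_fun `[0, x] h by exact: measurable_funS mh.
have gh' : {ae mu, forall t, `[0, x]%classic t -> g t = h t}.
  by move: gh; apply: aeS => t H /S.
split; first exact: ae_ri rg.
rewrite (acE fg x0); congr (_ + _); apply: ae_Rint => //.
by apply/measurable_EFinP; exact: measurable_int rg.
Qed.

Definition sq f := measurable_fun Rp f /\ ri Rp (fun x => f x ^+ 2).

Lemma LfunP f : ((f \_ Rp) \in Lfun mu 2%:E) <-> sq f.
Proof.
split=> [f2|[mf f2]].
  have mf : measurable_fun setT (f \_ Rp).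
    by move: f2; rewrite inE => /andP[+ _]; rewrite inE.
  split; first exact/(measurable_restrictT _ (@measurable_halfline R)).
  have := Lfun2_integrable_sqr f2 => H.
  have H' : ri setT ((fun x => f x ^+ 2) \_ Rp).
    apply: eq_ri H => // x _; rewrite !patchE; case: ifP => //.
    by rewrite expr0n.
  exact: (ri_restrict _ (@measurable_halfline R)).2.
have mf' : measurable_fun setT (f \_ Rp).
  exact/(measurable_restrictT _ (@measurable_halfline R)).
rewrite inE; apply/andP; split; rewrite inE//=.
rewrite /finite_norm unlock /=; apply: poweR_lty.
have /integrableP[_] : ri setT ((fun x => f x ^+ 2) \_ Rp).
  exact: (ri_restrict _ (@measurable_halfline R)).1.
apply: le_lt_trans; apply: ge0_le_integral => //.
- apply/measurable_EFinP.
  by apply: (@measurableT_comp _ _ _ _ _ _ (fun x : R => x `^ 2)) => //; exact: measurableT_comp.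
- apply: measurableT_comp => //; apply/measurable_EFinP.
  apply/(measurable_restrictT _ (@measurable_halfline R)); exact: measurable_funX.
- move=> x _; rewrite /= lee_fin !patchE; case: ifP => _ /=.
    by rewrite normrX powR_mulrn.
  by rewrite !normr0 powR0.
Qed.

Lemma L2P F : L2 F <-> sq (fun x => Re (F x)) /\ sq (fun x => Im (F x)).
Proof. by split=> -[/LfunP ? /LfunP ?]; split. Qed.

Lemma L2_meas F : L2 F -> cmeas Rp F.
Proof. by move=> /L2P[[? _] [? _]]. Qed.

(** [n2] is the squared L^2 norm and [nn] the norm. A divergent integral would be read as 0, which
    is why norm estimates are accompanied by [L2] facts. *)
Definition n2 F : R := \int[mu]_(x in Rp) sqn (F x).
Definition nn F : R := Num.sqrt (n2 F).

Lemma L2sqn F : L2 F <-> cmeas Rp F /\ ri Rp (fun x => sqn (F x)).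
Proof.
split=> [/L2P[[m1 r1] [m2 r2]]|[[m1 m2] r]].
  by split=> //; exact: riD.
apply/L2P; split; split=> //; apply: (@le_ri _ _ (fun x => sqn (F x))) => //.
- exact: measurable_funX.
- by move=> x _; rewrite ger0_norm ?sqr_ge0// /sqn lerDl sqr_ge0.
- exact: measurable_funX.
- by move=> x _; rewrite ger0_norm ?sqr_ge0// /sqn lerDr sqr_ge0.
Qed.

Lemma n2_ge0 F : 0 <= n2 F.
Proof. by apply: Rintegral_ge0 => x _; exact: sqn_ge0. Qed.

Lemma nn_ge0 F : 0 <= nn F. Proof. exact: sqrtr_ge0. Qed.

Lemma nn_sqr F : nn F ^+ 2 = n2 F.
Proof. by rewrite sqr_sqrtr// n2_ge0. Qed.

Lemma eq_n2 F G : (forall x, 0 <= x -> sqn (F x) = sqn (G x)) -> n2 F = n2 G.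
Proof.
by move=> FG; apply: eq_Rint => x; rewrite /halfline/= in_itv/= andbT => x0; rewrite FG.
Qed.

Lemma eq_nn F G : (forall x, 0 <= x -> F x = G x) -> nn F = nn G.
Proof. by move=> FG; rewrite /nn (@eq_n2 F G)// => x x0; rewrite FG. Qed.

Lemma eq_L2 F G : (forall x, 0 <= x -> F x = G x) -> L2 F -> L2 G.
Proof.
have S x : Rp x -> 0 <= x by rewrite /halfline/= in_itv/= andbT.
move=> FG /L2sqn[m r]; apply/L2sqn; split.
  by apply: eq_cmeas m => x /S x0; rewrite FG.
by apply: eq_ri r => // x /S x0; rewrite FG.
Qed.

Lemma L2_le F G M : 0 <= M -> L2 F -> cmeas Rp G ->
  (forall x, 0 <= x -> normc (G x) <= M * normc (F x)) -> L2 G /\ nn G <= M * nn F.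
Proof.
have S x : Rp x -> 0 <= x by rewrite /halfline/= in_itv/= andbT.
move=> M0 /L2sqn[mF rF] mG GF.
have H x : Rp x -> sqn (G x) <= M ^+ 2 * sqn (F x).
  by move=> /S x0; rewrite !sqn_normc -exprMn ler_pXn2r ?nnegrE ?mulr_ge0 ?normc_ge0// GF.
have rM : ri Rp (fun x => M ^+ 2 * sqn (F x)) by exact: riZ.
have rG : ri Rp (fun x => sqn (G x)).
  apply: le_ri rM => //; first exact: measurable_sqn.
  by move=> x Dx; rewrite ger0_norm ?sqn_ge0// H.
split; first exact/L2sqn.
rewrite -(@ler_pXn2r _ 2)// ?nnegrE ?nn_ge0 ?mulr_ge0 ?nn_ge0//.
rewrite exprMn !nn_sqr /n2 -RintegralZl//.
exact: le_Rintegral.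
Qed.

Lemma L2Z c F : L2 F -> L2 (fun x => c * F x) /\ nn (fun x => c * F x) = normc c * nn F.
Proof.
move=> hF; split.
  have := @L2_le F (fun x => c * F x) (normc c) (normc_ge0 _) hF.
  case=> //; first by apply: cmeasM (L2_meas hF); exact: cmeas_cst.
  by move=> x _; rewrite normcM.
apply/eqP; rewrite -(@eqrXn2 _ 2)// ?nn_ge0 ?mulr_ge0 ?nn_ge0 ?normc_ge0//.
rewrite exprMn !nn_sqr -sqn_normc /n2 -RintegralZl//; last by have /L2sqn[] := hF.
by apply/eqP; apply: eq_Rint => x _; rewrite sqnM.
Qed.

Lemma L2J F : L2 F -> L2 (fun x => (F x)^*).
Proof.
move=> hF; have := @L2_le F (fun x => (F x)^*) 1 ler01 hF.
case=> //; first by apply: cmeasJ (L2_meas hF).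
by move=> x _; rewrite normc_conjc mul1r.
Qed.

Lemma nnJ F : nn (fun x => (F x)^*) = nn F.
Proof. by rewrite /nn (@eq_n2 _ F)// => x _; rewrite sqnJ. Qed.

Lemma young2 (t p q : R) : 0 < t -> 2 * (p * q) <= t * p ^+ 2 + t^-1 * q ^+ 2.
Proof.
move=> t0; have := sqr_ge0 (t * p - q) => H.
rewrite -(ler_pM2l t0) mulrDr (mulrA t t^-1) divff ?gt_eqF// mul1r.
by nra.
Qed.

Lemma L2_ciM F G : L2 F -> L2 G -> ci Rp (fun x => F x * G x).
Proof.
move=> hF hG; have /L2sqn[mF rF] := hF; have /L2sqn[mG rG] := hG.
apply: (@le_ci _ _ (fun x => sqn (F x) + sqn (G x))) => //.
- exact: cmeasM.
- move=> x _; rewrite normcM !sqn_normc.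
  have := @young2 1 (normc (F x)) (normc (G x)) ltr01; rewrite invr1 !mul1r.
  by have := mulr_ge0 (normc_ge0 (F x)) (normc_ge0 (G x)); lra.
- exact: riD.
Qed.

Lemma L2D F G : L2 F -> L2 G -> L2 (fun x => F x + G x).
Proof.
move=> /L2sqn[mF rF] /L2sqn[mG rG]; apply/L2sqn; split; first exact: cmeasD.
apply: (@le_ri _ _ (fun x => 2 * (sqn (F x) + sqn (G x)))) => //.
- by apply: measurable_sqn; exact: cmeasD.
- move=> x _; rewrite ger0_norm ?sqn_ge0// /sqn !reimE.
  have := sqr_ge0 (Re (F x) - Re (G x)); have := sqr_ge0 (Im (F x) - Im (G x)); nra.
- by apply: riZ => //; exact: riD.
Qed.

Lemma L2N F : L2 F -> L2 (fun x => - F x).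
Proof.
by move=> hF; have [H _] := L2Z (-1) hF; apply: eq_L2 H => x _; rewrite mulN1r.
Qed.

Lemma nnN F : nn (fun x => - F x) = nn F.
Proof. by rewrite /nn (@eq_n2 _ F)// => x _; rewrite /sqn !reimE !sqrrN. Qed.

Lemma L2B F G : L2 F -> L2 G -> L2 (fun x => F x - G x).
Proof. by move=> hF hG; apply: L2D => //; exact: L2N. Qed.

(** The optimal parameter q / p may be zero or meaningless, so (q + e) / (p + e) is used. It costs
    only e (p + q), and [e] is chosen so that this stays below the supposed gap N - p q. *)
Lemma young_opt (N p q : R) : 0 <= p -> 0 <= q ->
  (forall t, 0 < t -> 2 * N <= t * p ^+ 2 + t^-1 * q ^+ 2) -> N <= p * q.
Proof.
move=> p0 q0 key; rewrite leNgt; apply/negP => lt.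
have pq1 : 0 < p + q + 1 by lra.
have [e e0 E] : exists2 e, 0 < e & e * (p + q + 1) = N - p * q.
  exists ((N - p * q) / (p + q + 1)); first by rewrite divr_gt0// subr_gt0.
  by rewrite divfK// gt_eqF.
have pe : 0 < p + e by lra.
have qe : 0 < q + e by lra.
have A1 : (q + e) / (p + e) * p ^+ 2 <= (q + e) * p.
  rewrite -mulrA ler_wpM2l ?(ltW qe)// mulrC ler_pdivrMr// expr2 ler_wpM2l//; lra.
have A2 : (p + e) / (q + e) * q ^+ 2 <= (p + e) * q.
  rewrite -mulrA ler_wpM2l ?(ltW pe)// mulrC ler_pdivrMr// expr2 ler_wpM2l//; lra.
have := key ((q + e) / (p + e)); rewrite divr_gt0// invf_div => /(_ isT) H.
have := le_trans H (lerD A1 A2); nra.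
Qed.

Lemma cauchy_schwarz F G : L2 F -> L2 G ->
  normc (cint Rp (fun x => F x * G x)) <= nn F * nn G.
Proof.
move=> hF hG; have iFG := L2_ciM hF hG.
have /L2sqn[mF rF] := hF; have /L2sqn[mG rG] := hG.
set N := normc _; set p := nn F; set q := nn G.
have p0 : 0 <= p := nn_ge0 _; have q0 : 0 <= q := nn_ge0 _.
have key t : 0 < t -> 2 * N <= t * p ^+ 2 + t^-1 * q ^+ 2.
  move=> t0; rewrite /p /q !nn_sqr /n2 -!RintegralZl// -RintegralD//; [|exact: riZ|exact: riZ].
  have rr : ri Rp (fun x => t * sqn (F x) + t^-1 * sqn (G x)) by apply: riD => //; exact: riZ.
  have -> : 2 * N = normc (cint Rp (fun x => 2%:C * (F x * G x))).
    by rewrite cintZ// normcM normcR ger0_norm.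
  apply: normc_cint_le => //; first exact: ciZ.
  move=> x _; rewrite !normcM normcR ger0_norm// !sqn_normc.
  exact: young2.
exact: young_opt.
Qed.

Lemma cint_sqn F : cint Rp (fun x => F x * (F x)^*) = (n2 F)%:C.
Proof.
apply: complex_eq; rewrite /cint/=.
  by apply: eq_Rint => x _; rewrite mulJ.
rewrite (@eq_Rint _ _ _ (fun=> 0)); last by move=> x _; rewrite mulJ.
by rewrite Rintegral_cst// mul0r.
Qed.

Lemma nnD F G : L2 F -> L2 G -> nn (fun x => F x + G x) <= nn F + nn G.
Proof.
move=> hF hG; have hFG := L2D hF hG.
rewrite -(@ler_pXn2r _ 2)// ?nnegrE ?nn_ge0 ?addr_ge0 ?nn_ge0//.
have -> : nn (fun x => F x + G x) ^+ 2 = n2 F + n2 G + 2 * Re (cint Rp (fun x => F x * (G x)^*)).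
  have /L2sqn[mF rF] := hF; have /L2sqn[mG rG] := hG; have [i1 i2] := L2_ciM hF (L2J hG).
  rewrite nn_sqr /n2 /cint/= -RintegralZl// -RintegralD// -RintegralD//; last 2 first.
  - exact: riD.
  - exact: riZ.
  by apply: eq_Rint => x _; rewrite /sqn !reimE; ring.
rewrite sqrrD !nn_sqr.
have := cauchy_schwarz hF (L2J hG); rewrite nnJ.
have := Re_le (cint Rp (fun x => F x * (G x)^*)).
rewrite -mulr_natr; lra.
Qed.

Lemma L2_ae F G : cmeas Rp G -> {ae mu, forall x, Rp x -> F x = G x} -> L2 F -> L2 G.
Proof.
move=> mG FG /L2sqn[mF rF]; apply/L2sqn; split=> //.
apply: ae_ri rF => //; first exact: measurable_sqn.
by move: FG; apply: aeS => x H Dx; rewrite H.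
Qed.

Lemma nn_eq0 F : L2 F -> nn F = 0 -> {ae mu, forall x, Rp x -> F x = 0}.
Proof.
move=> /L2sqn[mF rF] n0.
have i0 : (\int[mu]_(x in Rp) `|(sqn (F x))%:E| = 0)%E.
  have := nn_sqr F; rewrite n0 expr0n/= /n2 /Rintegral => /esym H.
  under eq_integral => x _ do rewrite /= ger0_norm ?sqn_ge0//.
  by rewrite -[LHS]fineK ?H//; exact: integrable_fin_num.
have mE : measurable_fun Rp (fun x => (sqn (F x))%:E) by exact: measurable_int rF.
have /= := (ae_eq_integral_abs mu (@measurable_halfline R) mE).1 i0.
apply: aeS => x H Dx; move: (H Dx) => /= -[].
move=> /eqP; rewrite /sqn paddr_eq0 ?sqr_ge0// !sqrf_eq0 => /andP[/eqP a /eqP b].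
exact: complex_eq.
Qed.

Lemma nn0_ae F : {ae mu, forall x, Rp x -> F x = 0} -> L2 F -> nn F = 0.
Proof.
move=> F0 /L2sqn[mF rF]; rewrite /nn /n2 (@ae_Rint _ _ (fun=> 0))//.
- by rewrite Rintegral_cst// mul0r sqrtr0.
- exact: measurable_sqn.
- by move: F0; apply: aeS => x H Dx; rewrite H// /sqn /= expr0n/= addr0.
Qed.
Lemma halfline_ge0 x : Rp x -> 0 <= x.
Proof. by rewrite /halfline/= in_itv/= andbT. Qed.

Lemma ge0_halfline x : 0 <= x -> Rp x.
Proof. by rewrite /halfline/= in_itv/= andbT. Qed.

Lemma itv_halfline x y : 0 <= x -> `[x, y]%classic `<=` Rp.
Proof. by move=> x0 t; rewrite /= in_itv/= => /andP[xt _]; apply: ge0_halfline; exact: le_trans xt. Qed.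

Lemma cacP F G : cac F G <-> forall x, 0 <= x -> ci `[0, x] G /\ F x = F 0 + cint `[0, x] G.
Proof.
split=> [[h1 h2] x x0|h].
  split; first by split; [exact: ac_ri h1 x0|exact: ac_ri h2 x0].
  by apply: complex_eq; rewrite !reimE/=; [exact: (acE h1 x0)|exact: (acE h2 x0)].
by split=> x x0; have [[r1 r2] ->] := h x x0; split=> //; rewrite !reimE.
Qed.

Lemma cacE F G x : cac F G -> 0 <= x -> F x = F 0 + cint `[0, x] G.
Proof. by move=> /cacP h /h[]. Qed.

Lemma cac_ci F G x : cac F G -> 0 <= x -> ci `[0, x] G.
Proof. by move=> /cacP h /h[]. Qed.

Lemma eq_cac F F1 G G1 : (forall x, 0 <= x -> F x = F1 x) ->
  (forall x, 0 <= x -> G x = G1 x) -> cac F G -> cac F1 G1.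
Proof.
move=> FF GG [h1 h2]; split.
  by apply: eq_ac h1 => x x0; rewrite ?FF ?GG.
by apply: eq_ac h2 => x x0; rewrite ?FF ?GG.
Qed.

Lemma cac_ae F G H : cac F G -> cmeas Rp H -> {ae mu, forall x, Rp x -> G x = H x} -> cac F H.
Proof.
move=> [h1 h2] [m1 m2] GH; split.
  by apply: ac_ae h1 m1 _; move: GH; apply: aeS => x E Dx; rewrite E.
by apply: ac_ae h2 m2 _; move: GH; apply: aeS => x E Dx; rewrite E.
Qed.

Lemma cac_meas F G : cac F G -> cmeas Rp F.
Proof. by move=> [h1 h2]; split; [exact: ac_measurable h1|exact: ac_measurable h2]. Qed.

Lemma cac_cst c : cac (fun=> c) (fun=> 0).
Proof. by split; exact: ac_cst. Qed.

Lemma cacC f g : ac f g -> cac (fun x => (f x)%:C) (fun x => (g x)%:C).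
Proof. by move=> h; split=> //; exact: ac_cst. Qed.

Lemma cacD F F1 G G1 : cac F F1 -> cac G G1 ->
  cac (fun x => F x + G x) (fun x => F1 x + G1 x).
Proof.
move=> [h1 h2] [k1 k2]; split.
  by apply: eq_ac (acD h1 k1) => x _; rewrite /= cReD.
by apply: eq_ac (acD h2 k2) => x _; rewrite /= cImD.
Qed.

Lemma acB' f f' g g' : ac f f' -> ac g g' -> ac (fun x => f x - g x) (fun x => f' x - g' x).
Proof. by move=> h k; apply: eq_ac (acD h (acZ (-1) k)) => x _; rewrite /= mulN1r. Qed.

Lemma cacM F F1 G G1 : cac F F1 -> cac G G1 ->
  cac (fun x => F x * G x) (fun x => F1 x * G x + F x * G1 x).
Proof.
move=> [h1 h2] [k1 k2]; split.
  by apply: eq_ac (acB' (acM h1 k1) (acM h2 k2)) => x _; rewrite !reimE//=; ring.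
by apply: eq_ac (acD (acM h1 k2) (acM h2 k1)) => x _; rewrite !reimE//=; ring.
Qed.

Lemma cacZ c F F1 : cac F F1 -> cac (fun x => c * F x) (fun x => c * F1 x).
Proof. by move=> h; apply: eq_cac (cacM (cac_cst c) h) => x _; rewrite ?mul0r ?add0r. Qed.

Lemma cacN F F1 : cac F F1 -> cac (fun x => - F x) (fun x => - F1 x).
Proof. by move=> h; apply: eq_cac (cacZ (-1) h) => x _; rewrite mulN1r. Qed.

Lemma cacB F F1 G G1 : cac F F1 -> cac G G1 ->
  cac (fun x => F x - G x) (fun x => F1 x - G1 x).
Proof. by move=> h k; apply: cacD => //; exact: cacN. Qed.

Lemma cacJ F F1 : cac F F1 -> cac (fun x => (F x)^*) (fun x => (F1 x)^*).
Proof.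
move=> [h1 h2]; split; first by apply: eq_ac h1 => x _; rewrite cReJ.
by apply: eq_ac (acZ (-1) h2) => x _; rewrite cImJ mulN1r.
Qed.

Lemma cac_bounded F G b : cac F G -> exists2 M, 0 <= M & forall x, 0 <= x <= b -> normc (F x) <= M.
Proof.
move=> [/ac_cont h1 /ac_cont h2].
have [M1 M10 H1] := within_bounded b h1; have [M2 M20 H2] := within_bounded b h2.
exists (M1 + M2) => [|x xb]; first exact: addr_ge0.
by rewrite (le_trans (normc_le_ReIm _))// lerD ?H1 ?H2.
Qed.

Lemma cac_int0 F G : cac F G -> ci Rp F -> ci Rp G -> cint Rp G = - F 0.
Proof.
move=> [h1 h2] [F1 F2] [G1 G2]; apply: complex_eq; rewrite !reimE.
  exact: (ac_int0 h1).
exact: (ac_int0 h2).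
Qed.

Lemma Rint_halfline_split f x : 0 <= x -> ri Rp f ->
  \int[mu]_(t in Rp) f t = \int[mu]_(t in `[0, x]) f t + \int[mu]_(t in `]x, +oo[) f t.
Proof.
move=> x0 rf; rewrite -(@Rintegral_itvB _ f (BLeft 0) +oo%O x)//.
by rewrite -/Rp addrC subrK.
Qed.

Lemma cint_setU x G : 0 <= x -> ci Rp G ->
  cint Rp G = cint `[0, x] G + cint `]x, +oo[ G.
Proof.
move=> x0 [G1 G2].
by apply: complex_eq; rewrite !reimE; exact: Rint_halfline_split.
Qed.

Lemma cac_tail F G x : cac F G -> ci Rp F -> ci Rp G -> 0 <= x ->
  F x = - cint `]x, +oo[ G.
Proof.
move=> h iF iG x0; rewrite (cacE h x0).
have := cac_int0 h iF iG; rewrite (cint_setU x0 iG) => H.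
by apply/eqP; rewrite -subr_eq0 opprK -addrA H subrr.
Qed.

Lemma tail_halfline x : 0 <= x -> `]x, +oo[%classic `<=` Rp.
Proof. by move=> x0 t; rewrite /= in_itv/= andbT => xt; apply/ge0_halfline/ltW/(le_lt_trans x0). Qed.

Lemma cac_tail_le F G g x : cac F G -> ci Rp F -> ci Rp G -> 0 <= x -> ri Rp g ->
  (forall t, x < t -> normc (G t) <= g t) -> normc (F x) <= \int[mu]_(t in `]x, +oo[) g t.
Proof.
move=> h iF iG x0 rg Gg; rewrite (cac_tail h iF iG x0) normcN.
apply: normc_cint_le => //.
- by apply: ciS iG => //; exact: tail_halfline.
- by apply: riS rg => //; exact: tail_halfline.
- by move=> t; rewrite /= in_itv/= andbT => xt; exact: Gg.
Qed.

Lemma L2_ci_itv F x : 0 <= x -> L2 F -> ci `[0, x] F.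
Proof.
move=> x0 /L2sqn[mF rF]; have S := @itv_halfline 0 x (lexx _).
apply: (@le_ci _ _ (fun t => 1 + sqn (F t))) => //.
- exact: cmeasS mF.
- move=> t _; rewrite sqn_normc; have := sqr_ge0 (normc (F t) - 1); nra.
- by apply: riD => //; [exact: ri_cst|exact: riS rF].
Qed.

Lemma cint_by_parts F F1 G G1 : cac F F1 -> cac G G1 -> L2 F -> L2 F1 -> L2 G -> L2 G1 ->
  cint Rp (fun x => F1 x * G x) + cint Rp (fun x => F x * G1 x) = - (F 0 * G 0).
Proof.
move=> hF hG F0 F10 G0 G10.
rewrite -cintD//; [|exact: L2_ciM|exact: L2_ciM].
apply: (cac_int0 (cacM hF hG)); first exact: L2_ciM.
by apply: ciD => //; exact: L2_ciM.
Qed.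

(** |F|^2 and its derivative are integrable, so |F x|^2 is a tail integral of that derivative, at
    most the integral I of |F|^2 + |F1|^2. The bound 1 + I avoids a square root, since r^2 <= I
    implies r <= 1 + I. *)
Lemma L2_bounded F F1 : cac F F1 -> L2 F -> L2 F1 ->
  exists2 M, 0 <= M & forall x, 0 <= x -> normc (F x) <= M.
Proof.
move=> hF F0 F10.
have /L2sqn[mF rF] := F0; have /L2sqn[mG rG] := F10.
have rg : ri Rp (fun x => sqn (F x) + sqn (F1 x)) by exact: riD.
exists (1 + \int[mu]_(x in Rp) (sqn (F x) + sqn (F1 x))).
  by rewrite addr_ge0// Rintegral_ge0// => x _; rewrite addr_ge0// sqn_ge0.
move=> x x0; set I := \int[mu]_(x in _) _.
have := @cac_tail_le _ _ (fun x => sqn (F x) + sqn (F1 x)) x (cacM hF (cacJ hF)) (L2_ciM F0 (L2J F0)).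
have iG : ci Rp (fun x => F1 x * (F x)^* + F x * (F1 x)^*).
  apply: ciD => //; first exact: L2_ciM F10 (L2J F0).
  exact: L2_ciM F0 (L2J F10).
move=> /(_ iG x0 rg) H.
have {}H : sqn (F x) <= I.
  have <- : normc (F x * (F x)^*) = sqn (F x) by rewrite normcM normc_conjc -expr2 sqn_normc.
  apply: le_trans (H _) _.
    move=> t _; rewrite (le_trans (le_normcD _ _))// !normcM !normc_conjc !sqn_normc.
    by have := sqr_ge0 (normc (F t) - normc (F1 t)); nra.
  rewrite -(@Rintegral_itvB _ _ (BLeft 0) +oo%O x)// gerBl.
  by apply: Rintegral_ge0 => t _; rewrite addr_ge0// sqn_ge0.
move: H; rewrite sqn_normc.
by have := sqr_ge0 (normc (F x) - 1); have := normc_ge0 (F x); nra.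
Qed.

Lemma ac_expR (k : R) : ac (fun x => expR (k * x)) (fun x => k * expR (k * x)).
Proof.
have c1 : continuous (fun x => expR (k * x)).
  move=> x; apply: (@continuous_comp R R R (fun x => k * x) expR).
    by apply: cvgM; [exact: cvg_cst|exact: cvg_id].
  exact: continuous_expR.
apply: ac_C1.
- exact: continuous_subspaceT.
- by apply: continuous_subspaceT => x; apply: cvgM; [exact: cvg_cst|exact: c1].
- by move=> x _; apply: is_derive_eq; rewrite /GRing.scale/=; ring.
Qed.

Lemma expR_halfline (k : R) : 0 < k -> ri Rp (fun x => expR (- k * x)) /\
  forall y, 0 <= y -> \int[mu]_(x in `]y, +oo[) expR (- k * x) = k^-1 * expR (- k * y).
Proof.
move=> k0.
have c1 : continuous (fun x => expR (- k * x)).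
  move=> x; apply: (@continuous_comp R R R (fun x => - k * x) expR).
    by apply: cvgM; [exact: cvg_cst|exact: cvg_id].
  exact: continuous_expR.
pose E x := - k^-1 * expR (- k * x).
have dE x : is_derive x 1 E (expR (- k * x)).
  by apply: is_derive_eq; rewrite /GRing.scale/=; field; rewrite gt_eqF.
have H y : (\int[mu]_(x in `[y, +oo[) (expR (- k * x))%:E = 0%:E - (E y)%:E)%E.
  apply: ge0_continuous_FTC2y.
  - by move=> x _; exact: expR_ge0.
  - exact: continuous_subspaceT.
  - rewrite -(mulr0 (- k^-1)); apply: cvgM; first exact: cvg_cst.
    have -> : (fun x : R => expR (- k * x)) = (fun t : R => expR (- t)) \o (fun x : R => k * x).
      by apply/funext => x /=; rewrite mulNr.
    apply: cvg_comp; last exact: cvgr_expR.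
    by apply: gt0_cvgMry => //; exact: cvg_id.
  - by move=> x _; case: (dE x).
  - apply: cvg_at_right_filter; apply: cvgM; [exact: cvg_cst|exact: c1].
  - by move=> x _; rewrite derive1E; case: (dE x) => _ ->.
have r : ri Rp (fun x => expR (- k * x)).
  apply/integrableP; split.
    apply/measurable_EFinP; apply: measurable_funS (continuous_measurable_fun c1) => //.
  under eq_integral => x _ do rewrite /= ger0_norm ?expR_ge0//.
  by rewrite /halfline H -EFinB ltry.
split=> // y y0; rewrite Rintegral_itv_obnd_cbnd; last first.
  by apply: riS r => //; exact: tail_halfline.
by rewrite /Rintegral H -EFinB /E /= sub0r mulNr opprK.
Qed.
End ComplexAC.

(** * Weak derivatives and absolutely continuous representatives *)

Section Bridge.
Variable R : realType.
Notation mu := (@lebesgue_measure R).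
Notation ri D f := (mu.-integrable D (EFin \o f)).
Notation Rp := (@halfline R).
Notation Re := (@complex.Re R).
Notation Im := (@complex.Im R).
Implicit Types (f g : R -> R) (F G H : R -> R[i]) (x y b M : R) (z w c : R[i]) (D E : set R).

(** The primitive of [f] is identically zero and its derivative at an interior point is [f] by
    continuity; the origin is reached by right continuity. *)
Lemma cont_ae0 f : {within Rp, continuous f} -> {ae mu, forall x, Rp x -> f x = 0} ->
  forall x, 0 <= x -> f x = 0.
Proof.
move=> cf f0.
have rf x : ri `[0, x] f by exact: ri_cont.
have H0 : (fun x => \int[mu]_(t in `[0, x]) f t) = cst 0.
  apply/funext => x; rewrite (@ae_Rint _ _ _ (fun=> 0))//.
  - by rewrite Rintegral_cst// mul0r.
  - by apply/measurable_EFinP; exact: measurable_int (rf x).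
  - by move: f0; apply: aeS => t H /(itv_halfline (lexx 0)).
have /continuous_within_itvcyP[ci cr] : {within `[0, +oo[, continuous f} by [].
have pos x : 0 < x -> f x = 0.
  move=> x0; have cx : {for x, continuous f} by apply: ci; rewrite in_itv/= x0.
  have x1 : x < x + 1 by rewrite ltrDl.
  have [_ <-] := continuous_FTC1_closed x1 (rf _) x0 cx.
  by rewrite H0 derive1_cst.
move=> x; rewrite le_eqVlt => /predU1P[<-|]; last exact: pos.
have c0 : f x @[x --> 0^'+] --> (0:R).
  by apply: cvg_near_cst; near=> t; apply: pos; near: t; exact: nbhs_right_gt.
by apply: cvg_unique cr c0; exact: Rhausdorff.
Unshelve. all: by end_near. Qed.

Lemma test_ac (chi : R -> R) : test_function chi -> ac chi (derive1 chi).
Proof.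
move=> [d c _]; apply: ac_C1.
- apply: continuous_subspaceT => x; apply: differentiable_continuous.
  by apply/derivable1_diffP; exact: d.
- exact: continuous_subspaceT.
- by move=> x _; split; [exact: d|rewrite derive1E].
Qed.

Lemma test_supp (chi : R -> R) : test_function chi ->
  exists2 b, chi 0 = 0 & forall x, b < x -> chi x = 0 /\ derive1 chi x = 0.
Proof.
move=> [d c [a [b [a0 s]]]]; exists b.
  by apply: s; rewrite negb_and -!ltNge a0.
move=> x bx; split; first by apply: s; rewrite negb_and -!ltNge bx orbT.
rewrite derive1E -(derive_cst (0:R) x (1:R)); apply: near_eq_derive.
near=> t; rewrite /cst; apply: s; rewrite negb_and -!ltNge; apply/orP; right.
near: t; exact: lt_nbhsr.
Unshelve. all: by end_near. Qed.

Lemma ri_compact f k b : (forall x, 0 <= x -> ri `[0, x] f) -> {within Rp, continuous k} ->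
  (forall x, b < x -> k x = 0) -> ri Rp (fun x => f x * k x).
Proof.
move=> rf ck k0; have b0 : 0 <= Num.max 0 b by rewrite le_max lexx.
apply: (@ri_supp _ `[0, Num.max 0 b]) => //.
- exact: itv_halfline.
- move=> x /halfline_ge0 x0 nx; rewrite k0 ?mulr0//.
  rewrite ltNge; apply/negP => xb; apply: nx; rewrite /= in_itv/= x0 le_max xb orbT//.
- apply: (eq_ri _ _ (riMcont ck (rf _ b0))) => // x _; by rewrite /= mulrC.
Qed.

Lemma ac_by_parts_test f g chi : ac f g -> test_function chi ->
  \int[mu]_(x in Rp) (f x * derive1 chi x) = - \int[mu]_(x in Rp) (g x * chi x).
Proof.
move=> h tchi; have hc := test_ac tchi; have [b c0 cb] := test_supp tchi.
have cc : {within Rp, continuous (derive1 chi)} by case: tchi => _ + _; exact: continuous_subspaceT.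
have r1 : ri Rp (fun x => f x * derive1 chi x).
  apply: (@ri_compact _ _ b) => //; last by move=> x /cb[].
  by move=> x x0; apply: ri_cont; exact: ac_cont h.
have r2 : ri Rp (fun x => g x * chi x).
  apply: (@ri_compact _ _ b) => //; last by move=> x /cb[].
    by move=> x; exact: ac_ri h.
  exact: ac_cont hc.
have r3 : ri Rp (fun x => f x * chi x).
  apply: (@ri_compact _ _ b) => //; last by move=> x /cb[].
    by move=> x x0; apply: ri_cont; exact: ac_cont h.
  exact: ac_cont hc.
have := ac_int0 (acM h hc) r3 (riD (@measurable_halfline R) r2 r1).
rewrite /= c0 mulr0 oppr0 RintegralD// => /eqP.
by rewrite addrC addr_eq0 => /eqP.
Qed.

(** The difference between [f] and a primitive of [g] integrates to zero against derivatives of test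
    functions, hence is almost everywhere constant; adding that constant to the primitive gives the
    representative. *)
Lemma weak_real f g : (forall x, 0 <= x -> ri `[0, x] f) -> (forall x, 0 <= x -> ri `[0, x] g) ->
  (forall chi, test_function chi ->
    \int[mu]_(x in Rp) (f x * derive1 chi x) = - \int[mu]_(x in Rp) (g x * chi x)) ->
  exists2 k, ac k g & {ae mu, forall x, Rp x -> k x = f x}.
Proof.
move=> rf rg H; pose G x := \int[mu]_(t in `[0, x]) g t.
have hG : ac G g by move=> x x0; split; [exact: rg|rewrite /G set_itv1 Rintegral_set1 add0r].
have rG x : 0 <= x -> ri `[0, x] G by move=> _; apply: ri_cont; exact: ac_cont hG.
have [] := @du_bois_reymond _ (fun x => f x - G x).
- by move=> x x0; apply: riB => //; [exact: rf|exact: rG].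
- move=> chi tchi; have hc := test_ac tchi; have [b c0 cb] := test_supp tchi.
  have cc : {within Rp, continuous (derive1 chi)} by case: tchi => _ + _; exact: continuous_subspaceT.
  have r1 : ri Rp (fun x => f x * derive1 chi x).
    by apply: (@ri_compact _ _ b) => // x /cb[].
  have r2 : ri Rp (fun x => G x * derive1 chi x).
    by apply: (@ri_compact _ _ b) => // x /cb[].
  rewrite (@eq_Rint _ _ _ (fun x => f x * derive1 chi x - G x * derive1 chi x)); last first.
    by move=> x _; rewrite mulrBl.
  by rewrite RintegralB// H// (ac_by_parts_test hG tchi) subrr.
move=> C HC; exists (fun x => C + G x).
  by apply: eq_ac (acD (ac_cst C) hG) => x _ //=; rewrite add0r.
by move: HC; apply: aeS => x E Dx; rewrite -(E Dx) subrK.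
Qed.

Lemma cintegralE F : cintegral F = cint Rp F.
Proof. by []. Qed.

(** Exchanges the distributional definition for an absolutely continuous representative. All later
    calculus is done on representatives, and compactly supported test functions do not return. *)
Lemma weak_derivativeP F G : weak_derivative F G <->
  [/\ L2 F, L2 G & exists2 K, cac K G & aeeq K F].
Proof.
split.
  move=> [hF hG H]; split=> //.
  have HR chi : test_function chi ->
      (\int[mu]_(x in Rp) (Re (F x) * derive1 chi x) = - \int[mu]_(x in Rp) (Re (G x) * chi x)) /\
      (\int[mu]_(x in Rp) (Im (F x) * derive1 chi x) = - \int[mu]_(x in Rp) (Im (G x) * chi x)).
    move=> /H; rewrite !cintegralE => E.
    have := congr1 Re E; have := congr1 Im E; rewrite !reimE => e2 e1; split.
      rewrite (@eq_Rint _ _ _ (fun x => Re (F x * (derive1 chi x)%:C))); last first.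
        by move=> x _; rewrite cReM/= mulr0 subr0.
      rewrite e1; congr (- _); apply: eq_Rint => x _.
      by rewrite cReM/= mulr0 subr0.
    rewrite (@eq_Rint _ _ _ (fun x => Im (F x * (derive1 chi x)%:C))); last first.
      by move=> x _; rewrite cImM/= mulr0 add0r.
    rewrite e2; congr (- _); apply: eq_Rint => x _.
    by rewrite cImM/= mulr0 add0r.
  have [k1 h1 a1] : exists2 k, ac k (fun x => Re (G x)) & {ae mu, forall x, Rp x -> k x = Re (F x)}.
    apply: weak_real.
    - by move=> x x0; case: (L2_ci_itv x0 hF).
    - by move=> x x0; case: (L2_ci_itv x0 hG).
    - by move=> chi /HR[].
  have [k2 h2 a2] : exists2 k, ac k (fun x => Im (G x)) & {ae mu, forall x, Rp x -> k x = Im (F x)}.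
    apply: weak_real.
    - by move=> x x0; case: (L2_ci_itv x0 hF).
    - by move=> x x0; case: (L2_ci_itv x0 hG).
    - by move=> chi /HR[].
  exists (fun x => k1 x +i* k2 x) => //.
  have := aeI a1 a2; apply: aeS => x [e1 e2] Dx.
  by apply: complex_eq => /=; [exact: e1|exact: e2].
move=> [hF hG [K [h1 h2] KF]]; split=> // chi tchi.
have mF := L2_meas hF.
have mc : measurable_fun Rp (derive1 chi).
  by apply: within_halfline_measurable; case: tchi => _ + _; exact: continuous_subspaceT.
have mK : cmeas Rp K by split; [exact: ac_measurable h1|exact: ac_measurable h2].
have m1 : cmeas Rp (fun x => F x * (derive1 chi x)%:C) by apply: cmeasM => //; exact: cmeasC.
have m2 : cmeas Rp (fun x => K x * (derive1 chi x)%:C) by apply: cmeasM => //; exact: cmeasC.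
have e : {ae mu, forall x, Rp x -> F x * (derive1 chi x)%:C = K x * (derive1 chi x)%:C}.
  by move: KF; apply: aeS => x E Dx; rewrite E.
have -> : cintegral (fun x => F x * (derive1 chi x)%:C) = cintegral (fun x => K x * (derive1 chi x)%:C).
  case: m1 m2 => [m11 m12] [m21 m22]; congr (_ +i* _); apply: ae_Rint => //.
    by move: e; apply: aeS => x E Dx; rewrite E.
  by move: e; apply: aeS => x E Dx; rewrite E.
rewrite !cintegralE; apply: complex_eq; rewrite !reimE.
  rewrite (@eq_Rint _ _ _ (fun x => Re (K x) * derive1 chi x)); last first.
    by move=> x _; rewrite cReM/= mulr0 subr0.
  rewrite (ac_by_parts_test h1 tchi); congr (- _); apply: eq_Rint => x _.
  by rewrite cReM/= mulr0 subr0.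
rewrite (@eq_Rint _ _ _ (fun x => Im (K x) * derive1 chi x)); last first.
  by move=> x _; rewrite cImM/= mulr0 add0r.
rewrite (ac_by_parts_test h2 tchi); congr (- _); apply: eq_Rint => x _.
by rewrite cImM/= mulr0 add0r.
Qed.

Lemma aeeq_sym F G : aeeq F G -> aeeq G F.
Proof. by apply: aeS => x E Dx; rewrite E. Qed.

Lemma aeeq_trans G F H : aeeq F G -> aeeq G H -> aeeq F H.
Proof. by move=> h k; have := aeI h k; apply: aeS => x [E1 E2] Dx; rewrite E1// E2. Qed.

Lemma aeeq_refl F : aeeq F F.
Proof. by apply: aeW. Qed.

Lemma weak_derivative_congr F F' G G' : L2 F' -> L2 G' -> aeeq F F' -> aeeq G G' ->
  weak_derivative F G -> weak_derivative F' G'.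
Proof.
move=> hF hG FF GG /weak_derivativeP[_ _ [K hK KF]]; apply/weak_derivativeP; split=> //.
exists K; last exact: aeeq_trans KF FF.
exact: cac_ae hK (L2_meas hG) GG.
Qed.

Lemma cac_aeeq F F1 G G1 : cac F F1 -> cac G G1 -> aeeq F G ->
  (forall x, 0 <= x -> F x = G x) /\ aeeq F1 G1.
Proof.
move=> hF hG FG.
have [h1 h2] := cacB hF hG.
have E x : 0 <= x -> F x = G x.
  move=> x0; have z1 : Re (F x - G x) = 0.
    apply: (cont_ae0 (ac_cont h1)) => //.
    by move: FG; apply: aeS => t H Dt; rewrite H// subrr.
  have z2 : Im (F x - G x) = 0.
    apply: (cont_ae0 (ac_cont h2)) => //.
    by move: FG; apply: aeS => t H Dt; rewrite H// subrr.
  by apply/eqP; rewrite -subr_eq0; apply/eqP; exact: complex_eq.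
split=> //.
have Z f g : ac f g -> (forall x, 0 <= x -> f x = 0) -> {ae mu, forall x, Rp x -> g x = 0}.
  move=> h f0; apply: Rint_eq0_ae => x x0; first exact: ac_ri h x0.
  by have := acE h x0; rewrite !f0// add0r.
have Z1 : {ae mu, forall x, Rp x -> Re (F1 x - G1 x) = 0}.
  by apply: Z h1 _ => x x0; rewrite E// subrr.
have Z2 : {ae mu, forall x, Rp x -> Im (F1 x - G1 x) = 0}.
  by apply: Z h2 _ => x x0; rewrite E// subrr.
have := aeI Z1 Z2; apply: aeS => x [e1 e2] Dx; apply/eqP.
by rewrite -subr_eq0; apply/eqP; apply: complex_eq; [exact: e1|exact: e2].
Qed.
Lemma weak_derivative_unique F F' G G' : weak_derivative F G -> weak_derivative F' G' ->
  aeeq F F' -> aeeq G G'.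
Proof.
move=> /weak_derivativeP[_ _ [K hK KF]] /weak_derivativeP[_ _ [K' hK' KF']] FF.
have [] := cac_aeeq hK hK' => //.
exact: aeeq_trans (aeeq_trans KF FF) (aeeq_sym KF').
Qed.

Lemma weak_derivative_wderiv F G : weak_derivative F G -> weak_derivative F (wderiv F).
Proof. by move=> h; apply: (@xgetPex _ _ [set g | weak_derivative F g]); exists G. Qed.

Lemma wderivE F F' G : L2 F' -> aeeq F F' -> weak_derivative F G ->
  aeeq (wderiv F') G /\ L2 (wderiv F').
Proof.
move=> hF FF h; have hG : L2 G by case: h.
have h' := weak_derivative_congr hF hG FF (aeeq_refl G) h.
have hw := weak_derivative_wderiv h'; split; last by case: hw.
exact: weak_derivative_unique hw h' (aeeq_refl _).
Qed.

Lemma sobolev_L2 k F : sobolev k F -> L2 F.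
Proof. by case: k => [//|k] [G []]. Qed.

Lemma sobolev_congr k F G : aeeq F G -> L2 G -> sobolev k F -> sobolev k G.
Proof.
case: k => [//|k] FG hG [H h hk]; exists H => //.
by apply: weak_derivative_congr FG (aeeq_refl _) h => //; exact: sobolev_L2 hk.
Qed.

(** The predicate supplies some weak derivative; uniqueness up to null sets transports the remaining
    regularity to the chosen one, [wderiv]. *)
Lemma sobolevS k F : sobolev k.+1 F -> weak_derivative F (wderiv F) /\ sobolev k (wderiv F).
Proof.
move=> [G h hk]; have hw := weak_derivative_wderiv h; split=> //.
apply: sobolev_congr hk; last by case: hw.
exact: weak_derivative_unique h hw (aeeq_refl _).
Qed.

(* H2 F0 F1 F2: F0 is an everywhere defined representative of an H^2 function, with
   derivatives F1 and F2; the last one is determined only up to a null set. *)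
Definition H2 F0 F1 F2 := [/\ cac F0 F1, cac F1 F2 & [/\ L2 F0, L2 F1 & L2 F2]].

Lemma cac_weak F G : cac F G -> L2 F -> L2 G -> weak_derivative F G.
Proof.
move=> h hF hG; apply/weak_derivativeP; split=> //; exists F => //; exact: aeeq_refl.
Qed.

Lemma sobolev_H2 phi : sobolev 2 phi -> exists F0 F1 F2,
  [/\ H2 F0 F1 F2, aeeq F0 phi, aeeq F1 (wderiv phi) & aeeq F2 (wderiv (wderiv phi))].
Proof.
move=> /sobolevS[/weak_derivativeP[L0 L1 [F0 h0 e0]] /sobolevS[/weak_derivativeP[_ L2' [F1 h1 e1]] _]].
exists F0, F1, (wderiv (wderiv phi)); split=> //; last exact: aeeq_refl.
split=> //; first by apply: cac_ae h0 (cac_meas h1) (aeeq_sym e1).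
split=> //.
  by apply: L2_ae (cac_meas h0) (aeeq_sym e0) L0.
by apply: L2_ae (cac_meas h1) (aeeq_sym e1) L1.
Qed.

Lemma H2_sobolev F0 F1 F2 : H2 F0 F1 F2 -> sobolev 2 F0.
Proof.
move=> [h0 h1 [L0 L1 L2']]; exists F1; first exact: cac_weak.
by exists F2 => //; exact: cac_weak.
Qed.

Lemma laplacianE (alpha : nat) phi F0 F1 F2 : H2 F0 F1 F2 -> L2 phi -> aeeq phi F0 ->
  aeeq (laplacian alpha phi) (fun y => F2 y - alpha%:R ^+ 2 * F0 y) /\
  L2 (laplacian alpha phi).
Proof.
move=> [h0 h1 [L0 L1 L2']] Lphi e.
have [e1 l1] := wderivE Lphi (aeeq_sym e) (cac_weak h0 L0 L1).
have [e2 l2] := wderivE l1 (aeeq_sym e1) (cac_weak h1 L1 L2').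
split; last by apply: L2B => //; case: (L2Z (alpha%:R ^+ 2) Lphi).
have := aeI e e2; apply: aeS => y [E E2] Dy.
by rewrite /laplacian E2// E.
Qed.

Lemma sobolev_H4 phi : sobolev 4 phi -> exists F0 F1 F2 F3 F4,
  [/\ H2 F0 F1 F2, H2 F2 F3 F4,
   aeeq F0 phi, aeeq F1 (wderiv phi) & aeeq F2 (wderiv (wderiv phi))].
Proof.
move=> s4; have [_ s3] := sobolevS s4; have [_ s2] := sobolevS s3.
(* The value of the second derivative at 0 enters the slip condition, so [F2] must be an everywhere
   defined representative. It comes from the H^2 structure of the second derivative and later
   replaces the mere class [D2]. *)
have [F2 [F3 [F4 [h23 e2 _ _]]]] := sobolev_H2 s2.
have s2' : sobolev 2 phi.
  by case: s4 => G h [G' h' [G'' h'' _]]; exists G => //; exists G' => //; case: h''.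
have [F0 [F1 [D2 [[h0 h1 [L0 L1 LD]] e0 e1 eD]]]] := sobolev_H2 s2'.
exists F0, F1, F2, F3, F4; split=> //; split=> //.
  apply: cac_ae h1 _ (aeeq_trans eD (aeeq_sym e2)).
  by case: h23 => h _ _; exact: cac_meas h.
by split=> //; case: h23 => _ _ [].
Qed.

Lemma cac_within F G : cac F G -> {within Rp, continuous (F : R -> R[i]^o)}.
Proof.
move=> [/ac_cont h1 /ac_cont h2] x.
apply/cvgrPdist_lt => e e0.
have e' : 0 < Re e by move: e0; rewrite ltcE => /andP[].
have eE : e = (Re e)%:C by apply: complex_eq => //=; move: e0; rewrite ltcE => /andP[/eqP].
have d0 : 0 < Re e / 2 by rewrite divr_gt0.
have /cvgrPdist_lt/(_ _ d0) H1 := h1 x; have /cvgrPdist_lt/(_ _ d0) H2 := h2 x.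
near=> t; rewrite eE.
have -> : `|F x - F t| = (normc (F x - F t))%:C by [].
rewrite ltcR (le_lt_trans (normc_le_ReIm _))// !reimE [ltRHS]splitr ltrD//; near: t.
  exact: H1.
exact: H2.
Unshelve. all: by end_near. Qed.

Lemma within_ReIm F : {within Rp, continuous (F : R -> R[i]^o)} ->
  {within Rp, continuous (fun x => Re (F x))} /\ {within Rp, continuous (fun x => Im (F x))}.
Proof.
move=> cF; split=> x; apply/cvgrPdist_lt => e e0.
  have e0' : 0 < e%:C :> R[i] by rewrite ltcR.
  have /cvgrPdist_lt/(_ _ e0') H := cF x.
  near=> t; rewrite -[_ - _]/(Re (F x) + - Re (F t)) -cReN -cReD.
  rewrite (le_lt_trans (Re_le_normc _))// -ltcR.
  by near: t; exact: H.
have e0' : 0 < e%:C :> R[i] by rewrite ltcR.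
have /cvgrPdist_lt/(_ _ e0') H := cF x.
near=> t; rewrite -[_ - _]/(Im (F x) + - Im (F t)) -cImN -cImD.
rewrite (le_lt_trans (Im_le_normc _))// -ltcR.
by near: t; exact: H.
Unshelve. all: by end_near. Qed.

Lemma cont_aeeq F G : {within Rp, continuous (F : R -> R[i]^o)} ->
  {within Rp, continuous (G : R -> R[i]^o)} -> aeeq F G -> F 0 = G 0.
Proof.
move=> /within_ReIm[f1 f2] /within_ReIm[g1 g2] FG.
have sub0 f g : {within Rp, continuous f} -> {within Rp, continuous g} ->
    {ae mu, forall x, Rp x -> f x = g x} -> f 0 = g 0.
  move=> cf cg fg; apply/eqP; rewrite -subr_eq0; apply/eqP.
  apply: (@cont_ae0 (fun x => f x - g x)) => //.
    by move=> x; apply: cvgB; [exact: cf|exact: cg].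
  by move: fg; apply: aeS => x E Dx; rewrite E// subrr.
apply: complex_eq; [apply: (sub0 _ _ f1 g1)|apply: (sub0 _ _ f2 g2)].
  by move: FG; apply: aeS => x E Dx; rewrite E.
by move: FG; apply: aeS => x E Dx; rewrite E.
Qed.

(** The set from which [trace0] chooses is a singleton: two continuous representatives coincide
    almost everywhere, hence also at 0. *)
Lemma trace0E F G phi : cac F G -> aeeq F phi -> trace0 phi = F 0.
Proof.
move=> h e; rewrite /trace0; set P := [set z | _].
have [g [cg eg <-]] : P (xget 0 P).
  by apply: xgetPex; exists (F 0), F; split=> //; [exact: cac_within h|exact: aeeq_sym].
exact/esym/(cont_aeeq (cac_within h) cg (aeeq_trans e eg)).
Qed.
End Bridge.

(** * Solutions of y'' = (a^2 + q) y with q exponentially small *)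

Lemma half_pow_le0 (R : realType) (C x : R) : (forall n : nat, x <= C / 2 ^+ n) -> x <= 0.
Proof.
move=> H; rewrite leNgt; apply/negP => x0.
have C0 : 0 < C by have := H 0%N; rewrite expr0 divr1; exact: lt_le_trans.
have := H (Num.truncn (C / x)).+1; apply/negP; rewrite -ltNge.
rewrite ltr_pdivrMr ?exprn_gt0// mulrC -ltr_pdivrMr//.
apply: lt_le_trans (truncnS_gt _) _.
by rewrite -natrX ler_nat ltnW// ltn_expl.
Qed.

Lemma half_powS (R : realType) (C : R) n : C / 2 ^+ n.+1 = C / 2 ^+ n / 2.
Proof. by rewrite exprSr invfM mulrA. Qed.

Section Volterra.
Variable R : realType.
Notation mu := (@lebesgue_measure R).
Notation ri D f := (mu.-integrable D (EFin \o f)).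
Notation Rp := (@halfline R).
Notation Re := (@complex.Re R).
Notation Im := (@complex.Im R).
Implicit Types (f g : R -> R) (F G H u w : R -> R[i]) (x y b M s A : R) (z c : R[i]) (D E : set R).
Variables (q : R -> R[i]) (K eta a : R).
Hypotheses (mq : cmeas Rp q) (K0 : 0 < K) (eta0 : 0 < eta) (a0 : 0 < a)
  (qK : forall y, 0 <= y -> normc (q y) <= K * expR (- eta * y)).

Definition ex s y : R[i] := (expR (s * y))%:C.

Lemma cac_ex s : cac (ex s) (fun y => s%:C * ex s y).
Proof. by apply: eq_cac (cacC (ac_expR s)) => // y _; rewrite /ex rmorphM. Qed.

Lemma normc_ex s y : normc (ex s y) = expR (s * y).
Proof. by rewrite normcR ger0_norm ?expR_ge0. Qed.

Lemma exM s y : ex s y * ex (- s) y = 1.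
Proof. by rewrite /ex -rmorphM -expRD mulNr subrr expR0. Qed.

Definition lam : R := 2 * K / (a * eta).
(* Weighting by om makes the Volterra operator Tv halve norms, whatever the size of K. *)
Definition gw y : R := expR (- lam * expR (- eta * y)).
Definition om y : R := expR (a * y) * gw y.

Lemma lam_gt0 : 0 < lam.
Proof. by rewrite divr_gt0 ?mulr_gt0. Qed.

Lemma gw_gt0 y : 0 < gw y. Proof. exact: expR_gt0. Qed.

Lemma gw_le1 y : gw y <= 1.
Proof. by rewrite /gw -expR0 ler_expR mulNr oppr_le0 mulr_ge0 ?expR_ge0 ?(ltW lam_gt0). Qed.

Lemma gw_ge y : 0 <= y -> expR (- lam) <= gw y.
Proof.
move=> y0; rewrite /gw ler_expR mulNr lerN2 -[leRHS]mulr1 ler_wpM2l ?(ltW lam_gt0)//.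
by rewrite -expR0 ler_expR mulNr oppr_le0 mulr_ge0// ltW.
Qed.

Lemma om_ge0 y : 0 <= om y.
Proof. by rewrite mulr_ge0 ?expR_ge0// ltW// gw_gt0. Qed.

Lemma om_le y : om y <= expR (a * y).
Proof. by rewrite /om ler_piMr ?expR_ge0// gw_le1. Qed.

Lemma ac_gw : ac gw (fun y => lam * eta * (expR (- eta * y) * gw y)).
Proof.
have c1 : continuous (fun y : R => expR (- eta * y)).
  move=> x; apply: (@continuous_comp R R R (fun x => - eta * x) expR).
    by apply: cvgM; [exact: cvg_cst|exact: cvg_id].
  exact: continuous_expR.
have c2 : continuous gw.
  move=> x; apply: (@continuous_comp R R R (fun x => - lam * expR (- eta * x)) expR).
    by apply: cvgM; [exact: cvg_cst|exact: c1].
  exact: continuous_expR.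
apply: ac_C1.
- exact: continuous_subspaceT.
- apply: continuous_subspaceT => x; apply: cvgM; first exact: cvg_cst.
  by apply: cvgM; [exact: c1|exact: c2].
- by move=> x _; apply: is_derive_eq; rewrite /GRing.scale/= /gw; ring.
Qed.

(** Since [lam * eta = 2 * K / a], the integrand [K * expR (- eta * t) * gw t] is a / 2 times the
    derivative of [gw]. The factor 1 / 2 gained here is what makes [Tv] a contraction. *)
Lemma int_gw y : 0 <= y ->
  K * \int[mu]_(t in `[0, y]) (expR (- eta * t) * gw t) <= a / 2 * gw y.
Proof.
move=> y0; have le0 : lam * eta != 0 by rewrite mulf_neq0 ?gt_eqF ?lam_gt0.
have r : ri `[0, y] (fun t => expR (- eta * t) * gw t).
  apply: (@eq_ri _ _ (fun t => (lam * eta)^-1 * (lam * eta * (expR (- eta * t) * gw t)))) => //.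
    by move=> t _; rewrite mulKf.
  by apply: riZ => //; exact: ac_ri ac_gw y0.
have := acE ac_gw y0; rewrite RintegralZl// => E.
have -> : K * \int[mu]_(t in `[0, y]) (expR (- eta * t) * gw t) = a / 2 * (gw y - gw 0).
  rewrite E addrC addKr mulrA; congr (_ * _).
  by rewrite /lam; field; rewrite !gt_eqF.
by rewrite ler_wpM2l ?divr_ge0 ?(ltW a0)// gerBl ltW// gw_gt0.
Qed.

(** Membership in the ball of radius [A] for the weighted sup norm with weight [om]. *)
Definition adm A u := cmeas Rp u /\ forall y, 0 <= y -> normc (u y) <= A * om y.
Definition Pv s u y : R[i] := cint `[0, y] (fun t => ex s t * (q t * u t)).

Lemma adm_integrand s A u y : adm A u -> 0 <= A -> 0 <= y -> 0 <= a + s ->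
  ci `[0, y] (fun t => ex s t * (q t * u t)) /\
  normc (Pv s u y) <= expR ((a + s) * y) * (A * (a / 2 * gw y)).
Proof.
move=> [mu_ hu] A0 y0 as0.
have S := @itv_halfline _ 0 y (lexx _).
have le0 : lam * eta != 0 by rewrite mulf_neq0 ?gt_eqF ?lam_gt0.
have r : ri `[0, y] (fun t => expR ((a + s) * y) * A * K * (expR (- eta * t) * gw t)).
  apply: riZ => //; apply: (@eq_ri _ _ (fun t => (lam * eta)^-1 * (lam * eta * (expR (- eta * t) * gw t)))) => //.
    by move=> t _; rewrite mulKf.
  by apply: riZ => //; exact: ac_ri ac_gw y0.
have B t : `[0, y]%classic t -> normc (ex s t * (q t * u t)) <=
    expR ((a + s) * y) * A * K * (expR (- eta * t) * gw t).
  rewrite /= in_itv/= => /andP[t0 ty]; rewrite !normcM normc_ex.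
  have h1 := qK t0; have h2 := hu _ t0.
  have h3 : expR (s * t) * om t <= expR ((a + s) * y) * gw t.
    rewrite /om mulrA ler_wpM2r ?(ltW (gw_gt0 _))// -expRD ler_expR -mulrDl [s + a]addrC.
    by rewrite ler_wpM2l.
  apply: (@le_trans _ _ (expR (s * t) * ((K * expR (- eta * t)) * (A * om t)))).
    by rewrite ler_wpM2l ?expR_ge0// ler_pM ?normc_ge0.
  have -> : expR (s * t) * (K * expR (- eta * t) * (A * om t)) =
    A * K * expR (- eta * t) * (expR (s * t) * om t) by ring.
  have -> : expR ((a + s) * y) * A * K * (expR (- eta * t) * gw t) =
    A * K * expR (- eta * t) * (expR ((a + s) * y) * gw t) by ring.
  by rewrite ler_wpM2l// !mulr_ge0 ?expR_ge0// ltW.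
have i1 : ci `[0, y] (fun t => ex s t * (q t * u t)).
  apply: le_ci B r => //.
  apply: cmeasM; first by apply: cmeasS S (cac_meas (cac_ex s)).
  by apply: cmeasM; [apply: cmeasS S mq|apply: cmeasS S mu_].
split=> //; apply: le_trans (normc_cint_le _ i1 r B) _ => //.
rewrite RintegralZl//; last first.
  apply: (@eq_ri _ _ (fun t => (lam * eta)^-1 * (lam * eta * (expR (- eta * t) * gw t)))) => //.
    by move=> t _; rewrite mulKf.
  by apply: riZ => //; exact: ac_ri ac_gw y0.
rewrite -!mulrA ler_wpM2l ?expR_ge0// ler_wpM2l//.
by have := int_gw y0; rewrite -!mulrA.
Qed.

Lemma Pv_cac s A u : adm A u -> 0 <= A -> 0 <= a + s ->
  cac (Pv s u) (fun t => ex s t * (q t * u t)).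
Proof.
move=> hu A0 as0; apply/cacP => y y0; have [i _] := adm_integrand hu A0 y0 as0; split=> //.
rewrite /Pv [cint `[0, 0] _](_ : _ = 0) ?add0r//.
by apply: complex_eq; rewrite ?Re_cint ?Im_cint set_itv1 Rintegral_set1.
Qed.

Lemma Pv0 s u : Pv s u 0 = 0.
Proof. by apply: complex_eq; rewrite ?Re_cint ?Im_cint set_itv1 Rintegral_set1. Qed.

(** Volterra operator with kernel sinh (a (y - t)) / a, split into exponentials: [Tv u] solves w'' =
    a^2 w + q u with w(0) = w'(0) = 0, and [Tv'] is its derivative. *)
Definition Tv u y : R[i] := (2 * a%:C)^-1 * (ex a y * Pv (- a) u y - ex (- a) y * Pv a u y).
Definition Tv' u y : R[i] := 2^-1 * (ex a y * Pv (- a) u y + ex (- a) y * Pv a u y).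

Lemma as_a : 0 <= a + a. Proof. by rewrite addr_ge0// ltW. Qed.
Lemma as_Na : 0 <= a + - a. Proof. by rewrite subrr. Qed.
Lemma aC_neq0 : a%:C != 0 :> R[i].
Proof. by rewrite eq_complex /= gt_eqF. Qed.

(** Upon differentiation, the contributions of the two integrands cancel in [Tv] and add up to
    [q y * u y] in [Tv'], because the exponential factors are inverse to each other. *)
Lemma Tv_cac A u : adm A u -> 0 <= A ->
  cac (Tv u) (Tv' u) /\ cac (Tv' u) (fun y => a%:C ^+ 2 * Tv u y + q y * u y).
Proof.
move=> hu A0; have h1 := Pv_cac hu A0 as_Na; have h2 := Pv_cac hu A0 as_a.
have k1 := cacM (cac_ex a) h1; have k2 := cacM (cac_ex (- a)) h2.
have an : a%:C != 0 :> R[i] := aC_neq0.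
have aN : (- a)%:C = - a%:C :> R[i] by apply: complex_eq => //=; rewrite oppr0.
have E1 y : ex a y * (ex (- a) y * (q y * u y)) = q y * u y by rewrite mulrA exM mul1r.
have E2 y : ex (- a) y * (ex a y * (q y * u y)) = q y * u y by rewrite mulrA [ex (- a) y * _]mulrC exM mul1r.
split.
  apply: eq_cac (cacZ ((2 * a%:C)^-1) (cacB k1 k2)) => y _ //.
  rewrite E1 E2 /Tv' aN.
  move: (a%:C) (ex a y) (ex (- a) y) (Pv _ _ y) (Pv _ _ y) (q y * u y) an => c1 c2 c3 c4 c5 c6 cn.
  by field; rewrite cn.
apply: eq_cac (cacZ (2^-1) (cacD k1 k2)) => y _ //.
rewrite E1 E2 /Tv aN.
move: (a%:C) (ex a y) (ex (- a) y) (Pv _ _ y) (Pv _ _ y) (q y * u y) an => c1 c2 c3 c4 c5 c6 cn.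
by field; rewrite cn.
Qed.

Lemma Pv_bound s A u y : adm A u -> 0 <= A -> 0 <= y -> 0 <= a + s ->
  normc (ex (- s) y * Pv s u y) <= a / 2 * A * om y.
Proof.
move=> hu A0 y0 as0; have [_ H] := adm_integrand hu A0 y0 as0.
rewrite normcM normc_ex; apply: le_trans (ler_wpM2l (expR_ge0 _) H) _.
rewrite /om (_ : expR (a * y) = expR (- s * y) * expR ((a + s) * y)); last first.
  by rewrite -expRD; congr expR; ring.
move: (expR _) (expR _) (gw y) => e1 e2 e3.
by rewrite le_eqVlt; apply/orP; left; apply/eqP; ring.
Qed.

Lemma Tv_bound A u y : adm A u -> 0 <= A -> 0 <= y ->
  normc (Tv u y) <= A / 2 * om y /\ normc (Tv' u y) <= a * A / 2 * om y.
Proof.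
move=> hu A0 y0; have := Pv_bound hu A0 y0 as_Na; rewrite opprK => H1.
have H2 := Pv_bound hu A0 y0 as_a.
have S z c : normc z <= a / 2 * A * om y -> normc c <= a / 2 * A * om y ->
  normc (z + c) <= a * A * om y.
  move=> h h'; rewrite (le_trans (le_normcD _ _))// (le_trans (lerD h h'))//.
  by rewrite le_eqVlt; apply/orP; left; apply/eqP; move: (om y) => m; field.
split; rewrite /Tv /Tv' normcM normcV.
  have -> : normc (2 * a%:C : R[i]) = 2 * a.
    by rewrite -[2]/(2%:R) -(rmorph_nat (real_complex R)) -rmorphM normcR gtr0_norm// mulr_gt0.
  have -> : A / 2 * om y = (2 * a)^-1 * (a * A * om y).
    by move: (om y) => m; field; rewrite gt_eqF.
  rewrite ler_wpM2l ?invr_ge0 ?mulr_ge0 ?(ltW a0)//.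
  by apply: S; rewrite ?normcN.
have -> : normc (2 : R[i]) = 2.
  by rewrite -[2]/(2%:R) -(rmorph_nat (real_complex R)) normcR gtr0_norm.
have -> : a * A / 2 * om y = 2^-1 * (a * A * om y) by move: (om y) => m; ring.
by rewrite ler_wpM2l ?invr_ge0//; exact: S.
Qed.

Lemma Tv_adm A u : adm A u -> 0 <= A -> adm (A / 2) (Tv u).
Proof.
move=> hu A0; split; first by have [h _] := Tv_cac hu A0; exact: cac_meas h.
by move=> y y0; have [] := Tv_bound hu A0 y0.
Qed.

Lemma Pv_sub s A B u w y : adm A u -> adm B w -> 0 <= A -> 0 <= B -> 0 <= y -> 0 <= a + s ->
  Pv s (fun t => u t - w t) y = Pv s u y - Pv s w y.
Proof.
move=> hu hw A0 B0 y0 as0.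
have [i1 _] := adm_integrand hu A0 y0 as0; have [i2 _] := adm_integrand hw B0 y0 as0.
rewrite /Pv -cintB//; apply: eq_cint => t _.
by rewrite !mulrBr.
Qed.

Lemma Tv_sub A B u w y : adm A u -> adm B w -> 0 <= A -> 0 <= B -> 0 <= y ->
  Tv (fun t => u t - w t) y = Tv u y - Tv w y.
Proof.
move=> hu hw A0 B0 y0; rewrite /Tv (Pv_sub hu hw A0 B0 y0 as_Na) (Pv_sub hu hw A0 B0 y0 as_a).
move: (2 * _) (ex _ _) (ex _ _) (Pv _ _ _) (Pv _ _ _) (Pv _ _ _) (Pv _ _ _) => *; ring.
Qed.

Lemma Tv0 u : Tv u 0 = 0 /\ Tv' u 0 = 0.
Proof. by rewrite /Tv /Tv' !Pv0 !mulr0 subr0 addr0 !mulr0. Qed.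

(** Each application of the fixed point equation halves the admissible constant of [u]. *)
Lemma contraction_eq0 A u : adm A u -> 0 <= A -> (forall y, 0 <= y -> u y = Tv u y) ->
  forall y, 0 <= y -> u y = 0.
Proof.
move=> hu A0 uT.
have H n : adm (A / 2 ^+ n) u.
  elim: n => [|n IH]; first by rewrite expr0 divr1.
  have [m _] := hu; split=> // y y0; rewrite uT//.
  have An0 : 0 <= A / 2 ^+ n by rewrite divr_ge0// exprn_ge0.
  have [H _] := Tv_bound IH An0 y0; by rewrite half_powS.
move=> y y0; apply: eq0_normc; apply/eqP; rewrite eq_le normc_ge0 andbT.
apply: (@half_pow_le0 _ (A * om y)) => n.
have [_ /(_ y y0)] := H n; by rewrite mulrAC.
Qed.
(** The intervals of centre [z n] and radius [d n] are nested, and the limit is the supremum of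
    their left ends. The conclusion is a sigma type so that [dyadic_climit] can pick limits
    pointwise and form a function. *)
Lemma dyadic_limit (z : nat -> R) B : (forall n, `|z n.+1 - z n| <= B / 2 ^+ n) ->
  {l | forall n, `|z n - l| <= 2 * B / 2 ^+ n}.
Proof.
move=> H.
have B0 : 0 <= B by have := H 0%N; rewrite expr0 divr1; exact: le_trans (normr_ge0 _).
pose d n := 2 * B / 2 ^+ n.
have dS n : d n.+1 = B / 2 ^+ n by rewrite /d half_powS; field; rewrite expf_neq0.
have dd n : d n = d n.+1 + B / 2 ^+ n by rewrite dS /d; ring.
have d0 n : 0 <= d n by rewrite /d divr_ge0 ?mulr_ge0 ?exprn_ge0.
have up n : z n - d n <= z n.+1 - d n.+1 by have := H n; rewrite ler_norml (dd n); lra.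
have dn n : z n.+1 + d n.+1 <= z n + d n by have := H n; rewrite ler_norml (dd n); lra.
have upm m n : (m <= n)%N -> z m - d m <= z n - d n.
  by move=> /subnK <-; elim: (n - m)%N => [//|k IH]; rewrite addSn (le_trans IH).
have dnm m n : (m <= n)%N -> z n + d n <= z m + d m.
  by move=> /subnK <-; elim: (n - m)%N => [//|k IH]; rewrite addSn (le_trans _ IH).
have ub n m : z m - d m <= z n + d n.
  have := upm _ _ (leq_maxl m n); have := dnm _ _ (leq_maxr m n); have := d0 (maxn m n); lra.
pose S := [set z n - d n | n in setT].
exists (sup S) => n.
have hsup : has_sup S.
  by split; [exists (z 0%N - d 0%N), 0%N|exists (z n + d n) => _ [m _ <-]].
have h1 : z n - d n <= sup S by apply: ub_le_sup; [case: hsup|exists n].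
have h2 : sup S <= z n + d n by apply: ge_sup; [case: hsup|move=> _ [m _ <-]].
by rewrite ler_norml -/(d n); lra.
Qed.

Lemma dyadic_cvg (z : nat -> R) B l : (forall n, `|z n - l| <= B / 2 ^+ n) -> z @ \oo --> l.
Proof.
move=> H; apply/cvgrPdist_le => e e0.
have B0 : 0 <= B by have := H 0%N; rewrite expr0 divr1; exact: le_trans (normr_ge0 _).
exists (Num.truncn (B / e)).+1 => // n /= nb; rewrite distrC (le_trans (H n))//.
rewrite ler_pdivrMr ?exprn_gt0// mulrC -ler_pdivrMr// ltW//.
apply: lt_le_trans (truncnS_gt _) _.
by rewrite (le_trans (_ : _ <= n%:R)) ?ler_nat// -natrX ler_nat ltnW// ltn_expl.
Qed.

Lemma dyadic_climit (S : nat -> R -> R[i]) (B : R -> R) :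
  (forall n, cmeas Rp (S n)) ->
  (forall n y, 0 <= y -> normc (S n.+1 y - S n y) <= B y / 2 ^+ n) ->
  exists2 L, cmeas Rp L & forall n y, 0 <= y -> normc (S n y - L y) <= 4 * B y / 2 ^+ n.
Proof.
move=> mS HS.
have HR y : 0 <= y -> forall n, `|Re (S n.+1 y) - Re (S n y)| <= B y / 2 ^+ n.
  by move=> y0 n; rewrite -cReN -cReD (le_trans (Re_le_normc _))// HS.
have HI y : 0 <= y -> forall n, `|Im (S n.+1 y) - Im (S n y)| <= B y / 2 ^+ n.
  by move=> y0 n; rewrite -cImN -cImD (le_trans (Im_le_normc _))// HS.
pose l1 y := if pselect (0 <= y) is left y0 then sval (dyadic_limit (HR y y0)) else 0.
pose l2 y := if pselect (0 <= y) is left y0 then sval (dyadic_limit (HI y y0)) else 0.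
have H1 y n : 0 <= y -> `|Re (S n y) - l1 y| <= 2 * B y / 2 ^+ n.
  by move=> y0; rewrite /l1; case: pselect => // y0'; case: dyadic_limit.
have H2 y n : 0 <= y -> `|Im (S n y) - l2 y| <= 2 * B y / 2 ^+ n.
  by move=> y0; rewrite /l2; case: pselect => // y0'; case: dyadic_limit.
exists (fun y => l1 y +i* l2 y).
  split=> /=.
    apply: (@measurable_fun_cvg _ _ _ _ (fun n y => Re (S n y))) => [n|y /halfline_ge0 y0].
      by case: (mS n).
    by apply: (@dyadic_cvg _ (2 * B y)) => n; exact: H1.
  apply: (@measurable_fun_cvg _ _ _ _ (fun n y => Im (S n y))) => [n|y /halfline_ge0 y0].
    by case: (mS n).
  by apply: (@dyadic_cvg _ (2 * B y)) => n; exact: H2.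
move=> n y y0; rewrite (le_trans (normc_le_ReIm _))// !reimE/=.
by have := H1 y n y0; have := H2 y n y0; lra.
Qed.

Lemma ex_adm : adm (expR lam) (ex a).
Proof.
split; first exact: cac_meas (cac_ex a).
move=> y y0; rewrite normc_ex /om mulrCA -[leLHS]mulr1 ler_wpM2l ?expR_ge0//.
by rewrite -(mulVr (unitf_gt0 (expR_gt0 (- lam)))) expRN invrK ler_wpM2l ?expR_ge0// -expRN gw_ge.
Qed.

(** The solution is the fixed point of V = ex a + Tv V; as [Tv] preserves zero Cauchy data, V starts
    at 1 like the free exponential. The weight [om] is at most [expR (a * y)], which gives the
    growth bounds. *)
Lemma growing_solution : exists V V1 B,
  [/\ cac V V1, cac V1 (fun y => (a%:C ^+ 2 + q y) * V y), V 0 = 1 &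
   [/\ 0 <= B, forall y, 0 <= y -> normc (V y) <= B * expR (a * y) &
     forall y, 0 <= y -> normc (V1 y) <= B * expR (a * y)]].
Proof.
set A := expR lam; have A0 : 0 <= A := expR_ge0 _.
(* Picard iterates starting from 0. The ball of radius 2 * A is stable because A + (2 * A) / 2 = 2 *
   A, and consecutive differences halve at each step. *)
pose S := fix S n : R -> R[i] := if n is m.+1 then fun y => ex a y + Tv (S m) y else fun=> 0.
have hS n : adm (2 * A) (S n) /\ adm (A / 2 ^+ n) (fun y => S n.+1 y - S n y).
  have A20 : 0 <= 2 * A by rewrite mulr_ge0.
  elim: n => [|n [IH1 IH2]].
    have h0 : adm (2 * A) (S 0%N).
      split; first exact: cmeas_cst.
      by move=> y y0; rewrite normc0 mulr_ge0// om_ge0.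
    split=> //; rewrite expr0 divr1; have [m1 m2] := ex_adm.
    have z : adm 0 (fun=> 0) by split; [exact: cmeas_cst|move=> y _; rewrite normc0 mul0r].
    have E y : 0 <= y -> S 1%N y - S 0%N y = ex a y.
      move=> y0; rewrite /= subr0; have [_ /(_ y y0)] := Tv_adm z (lexx 0).
      rewrite mul0r mul0r => H; rewrite (eq0_normc (_ : normc (Tv _ y) = 0)) ?addr0//.
      by apply/eqP; rewrite eq_le H normc_ge0.
    split; last by move=> y y0; rewrite E//; exact: m2.
    by apply: eq_cmeas m1 => y /halfline_ge0 y0; rewrite E.
  have [m1 m2] := ex_adm; have [t1 t2] := Tv_adm IH1 A20.
  have h1 : adm (2 * A) (S n.+1).
    split; first exact: cmeasD.
    move=> y y0; rewrite (le_trans (le_normcD _ _))//.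
    by have := m2 y y0; have := t2 y y0; rewrite -/A; nra.
  split=> //.
  have An0 : 0 <= A / 2 ^+ n by rewrite divr_ge0// exprn_ge0.
  have [d1 d2] := Tv_adm IH2 An0.
  have E y : 0 <= y -> S n.+2 y - S n.+1 y = Tv (fun t => S n.+1 t - S n t) y.
    move=> y0; rewrite (Tv_sub h1 IH1)// /=.
    by move: (ex a y) (Tv _ _) (Tv _ _) => *; ring.
  split; first by apply: eq_cmeas d1 => y /halfline_ge0 y0; rewrite E.
  by move=> y y0; rewrite E// half_powS; exact: d2.
have [L mL HL] : exists2 L, cmeas Rp L & forall n y, 0 <= y -> normc (S n y - L y) <= 4 * (A * om y) / 2 ^+ n.
  apply: dyadic_climit => [n|n y y0]; first by case: (hS n) => -[].
  by have [_ [_ /(_ y y0)]] := hS n; rewrite mulrAC.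
have hL : adm (4 * A) L.
  split=> // y y0; have := HL 0%N y y0.
  by rewrite /= sub0r normcN expr0 divr1 mulrA.
have A40 : 0 <= 4 * A by rewrite mulr_ge0.
(* The residual of the limit is rewritten through the n-th iterate, as a distance between [L] and
   [S n.+1] plus the image under [Tv] of a distance between [S n] and [L]; both are of order
   2^-n. *)
have LE y : 0 <= y -> L y = ex a y + Tv L y.
  move=> y0; apply/eqP; rewrite -subr_eq0; apply/eqP/eq0_normc/eqP.
  rewrite eq_le normc_ge0 andbT; apply: (@half_pow_le0 _ (4 * (A * om y))) => n.
  have [hn _] := hS n; have A20 : 0 <= 2 * A by rewrite mulr_ge0.
  have hd : adm (4 * A / 2 ^+ n) (fun t => S n t - L t).
    split; first by apply: cmeasB => //; case: hn.
    by move=> t t0; have := HL n t t0; rewrite mulrA mulrAC.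
  have An0 : 0 <= 4 * A / 2 ^+ n by rewrite divr_ge0// exprn_ge0.
  have [_ /(_ y y0) b2] := Tv_adm hd An0; rewrite (Tv_sub hn hL)// in b2.
  have b1 := HL n.+1 y y0.
  have -> : L y - (ex a y + Tv L y) = - (S n.+1 y - L y) + (Tv (S n) y - Tv L y).
    by rewrite /=; move: (ex a y) (Tv _ _) (Tv _ _) (L y) => *; ring.
  rewrite (le_trans (le_normcD _ _))// normcN (le_trans (lerD b1 b2))//.
  rewrite half_powS; move: (om y) (2 ^- n) => m e.
  by rewrite le_eqVlt; apply/orP; left; apply/eqP; field.
have [c1 c2] := Tv_cac hL A40.
exists (fun y => ex a y + Tv L y), (fun y => a%:C * ex a y + Tv' L y), (a + 1 + 2 * A + a * (2 * A)).
split.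
- exact: cacD (cac_ex a) c1.
- apply: eq_cac (cacD (cacZ a%:C (cac_ex a)) c2) => y y0 //.
  rewrite (LE y y0); move: (a%:C) (ex a y) (Tv L y) (q y) => *; ring.
- by have [-> _] := Tv0 L; rewrite /ex mulr0 expR0 addr0.
have X y : 0 <= y -> normc (Tv L y) <= 2 * A * expR (a * y) /\ normc (Tv' L y) <= a * (2 * A) * expR (a * y).
  move=> y0; have [H1 H2] := Tv_bound hL A40 y0; split.
    apply: le_trans H1 _; rewrite (_ : 4 * A / 2 = 2 * A); last by field.
    by rewrite ler_wpM2l ?mulr_ge0// om_le.
  apply: le_trans H2 _; rewrite (_ : a * (4 * A) / 2 = a * (2 * A)); last by field.
  by rewrite ler_wpM2l ?mulr_ge0 ?(ltW a0)// om_le.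
have aA : 0 <= a * (2 * A) by rewrite !mulr_ge0// ltW.
split.
- by have := ltW a0; lra.
- move=> y y0; rewrite (le_trans (le_normcD _ _))// normc_ex.
  have [H _] := X y y0; apply: le_trans (lerD (lexx _) H) _.
  rewrite -[X in X + _]mul1r -mulrDl ler_wpM2r ?expR_ge0//; have := ltW a0; lra.
- move=> y y0; rewrite (le_trans (le_normcD _ _))// normcM normc_ex normcR gtr0_norm//.
  have [_ H] := X y y0; apply: le_trans (lerD (lexx _) H) _.
  rewrite -mulrDl ler_wpM2r ?expR_ge0//; have := ltW a0; lra.
Qed.
End Volterra.

Section RayleighODE.
Variable R : realType.
Notation mu := (@lebesgue_measure R).
Notation ri D f := (mu.-integrable D (EFin \o f)).
Notation Rp := (@halfline R).
Notation Re := (@complex.Re R).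
Notation Im := (@complex.Im R).
Implicit Types (f g : R -> R) (F G H u w : R -> R[i]) (x y b M s A : R) (z c : R[i]) (D E : set R).

(** Monotone convergence turns a bound uniform in x on [[0, x]] into integrability, so energy
    estimates on bounded intervals yield membership in L^2. *)
Lemma ri_exhaust g M : measurable_fun Rp g -> (forall x, 0 <= g x) ->
  (forall x, 0 <= x -> ri `[0, x] g) ->
  (forall x, 0 <= x -> \int[mu]_(t in `[0, x]) g t <= M) ->
  ri Rp g /\ \int[mu]_(t in Rp) g t <= M.
Proof.
move=> mg g0 rg gM.
pose f_ (n : nat) x : \bar R := ((g \_ `[0, n%:R]) x)%:E.
have mf_ n : measurable_fun Rp (f_ n).
  apply/measurable_EFinP; apply/measurable_restrict => //.
  by apply: measurable_funS mg => //; apply: subIsetl.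
have f0 n x : Rp x -> (0 <= f_ n x)%E by rewrite /f_ lee_fin patchE; case: ifP.
have nd x : Rp x -> nondecreasing_seq (f_ ^~ x).
  move=> _ m n mn; rewrite /f_ lee_fin !patchE; case: ifPn => [xm|_]; last by case: ifP.
  rewrite ifT//; move: xm; rewrite !inE/= !in_itv/= => /andP[-> xm]/=.
  by rewrite (le_trans xm)// ler_nat.
have lim x : Rp x -> f_ ^~ x @ \oo --> (g x)%:E.
  move=> /halfline_ge0 x0.
  apply: cvg_near_cst; exists (Num.truncn x).+1 => // n /= nx; rewrite /f_ patchE mem_set//=.
  by rewrite in_itv/= x0/= ltW// (lt_le_trans (truncnS_gt _))// ler_nat.
have MC : (\int[mu]_(x in Rp) f_ n x)%E @[n --> \oo] --> (\int[mu]_(x in Rp) limn (f_ ^~ x))%E.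
  exact: cvg_monotone_convergence.
have E n : (\int[mu]_(x in Rp) f_ n x = (\int[mu]_(t in `[0%R, n%:R]) g t)%R%:E)%E.
  have r : ri Rp (g \_ `[0, n%:R]).
    apply: (@ri_supp _ `[0, n%:R]) => //.
    - exact: itv_halfline.
    - by move=> x _ nx; rewrite patchE memNset.
    - by apply: (@eq_ri _ _ g) => [//|x xD|]; [rewrite patchE mem_set|exact: rg].
  rewrite /f_ -[LHS]fineK; last exact: integrable_fin_num.
  congr (_ %:E); rewrite -[LHS]/(Rintegral mu Rp (g \_ `[0, n%:R])) -Rintegral_mkcondr.
  by rewrite setIidr//; apply: itv_halfline.
have L : (\int[mu]_(x in Rp) (g x)%:E <= M%:E)%E.
  have -> : (\int[mu]_(x in Rp) (g x)%:E = \int[mu]_(x in Rp) limn (f_ ^~ x))%E.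
    by apply: eq_integral => x /[!inE] Dx; apply/esym/cvg_lim => //; exact: lim.
  rewrite -(cvg_lim _ MC)//.
  apply: lime_le; first by apply: cvgP MC.
  by near=> n; rewrite E lee_fin gM.
have r : ri Rp g.
  apply/integrableP; split; first exact/measurable_EFinP.
  under eq_integral => x _ do rewrite /= ger0_norm//.
  exact: le_lt_trans L (ltry _).
split=> //; rewrite -lee_fin /Rintegral fineK//.
exact: integrable_fin_num.
Unshelve. all: by end_near. Qed.

(** * Exponential convolutions in L^2 *)

Section Conv.
Variables (a : R) (f : R -> R[i]).
Hypotheses (a0 : 0 < a) (hf : L2 f).
Let s t : R := normc (f t).

Let s0 t : 0 <= s t. Proof. exact: normc_ge0. Qed.
Let ms : measurable_fun Rp s. Proof. by apply: measurable_normc; exact: L2_meas. Qed.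
Let rs2 : ri Rp (fun t => s t ^+ 2).
Proof.
by have /L2sqn[_] := hf; apply: eq_ri => // x _; rewrite sqn_normc.
Qed.
Let n2s : n2 f = \int[mu]_(t in Rp) s t ^+ 2.
Proof. by apply: eq_Rint => x _; rewrite sqn_normc. Qed.
Let rs y : 0 <= y -> ri `[0, y] s.
Proof.
move=> y0; have S := @itv_halfline _ 0 y (lexx _).
apply: (@le_ri _ _ _ (fun t => 1 + s t ^+ 2)) => //.
- exact: measurable_funS ms.
- by move=> t _; rewrite ger0_norm//; have := sqr_ge0 (s t - 1); nra.
- by apply: riD => //; [exact: ri_cst|exact: riS rs2].
Qed.

Let cexp k : {within Rp, continuous (fun t : R => expR (k * t))}.
Proof. by have := ac_cont (ac_expR k). Qed.

(** Convolution of |f| with exp (- a y) from the left. It solves w' = - a w + |f| with w(0) = 0, and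
    this equation replaces the convolution inequality. *)
Definition convL y : R := expR (- a * y) * \int[mu]_(t in `[0, y]) (expR (a * t) * s t).

Lemma ac_convL : ac convL (fun y => - a * convL y + s y).
Proof.
have h : ac (fun y => \int[mu]_(t in `[0, y]) (expR (a * t) * s t)) (fun t => expR (a * t) * s t).
  move=> y y0; split; first by apply: riMcont => //; exact: rs.
  by rewrite set_itv1 Rintegral_set1 add0r.
apply: eq_ac (acM (ac_expR (- a)) h) => y _ //=.
have E : expR (- a * y) * expR (a * y) = 1 by rewrite -expRD mulNr addNr expR0.
by rewrite mulrA E mul1r /convL; congr (_ + _); rewrite mulrA.
Qed.

Lemma int_sub_le y : 0 <= y -> \int[mu]_(t in `[0, y]) s t ^+ 2 <= n2 f.
Proof.
move=> y0; rewrite n2s (Rint_halfline_split y0 rs2) lerDl.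
by apply: Rintegral_ge0 => t _; exact: sqr_ge0.
Qed.

(** Energy estimate: the derivative of the square is at most |f|^2 / a - a w^2 by Young. Integrating
    from the initial value 0 bounds the L^2 norm; the constant 2 / a is generous, to be shared with
    [convR]. *)
Lemma convL_L2 : L2 (fun y => (convL y)%:C) /\ n2 (fun y => (convL y)%:C) <= (2 / a) ^+ 2 * n2 f.
Proof.
have mL : measurable_fun Rp convL := ac_measurable ac_convL.
have rL2 y : 0 <= y -> ri `[0, y] (fun t => convL t ^+ 2).
  move=> y0; have := ac_cont (acM ac_convL ac_convL) => /(@ri_cont _ _ y).
  by apply: eq_ri => // t _ /=; rewrite expr2.
have rs2' y : 0 <= y -> ri `[0, y] (fun t => s t ^+ 2).
  by move=> y0; apply: riS rs2 => //; exact: itv_halfline.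
have B y : 0 <= y -> \int[mu]_(t in `[0, y]) convL t ^+ 2 <= (2 / a) ^+ 2 * n2 f.
  move=> y0; have H := acM ac_convL ac_convL; have := acE H y0.
  have L0 : convL 0 = 0 by rewrite /convL set_itv1 Rintegral_set1 mulr0.
  rewrite /= L0 mulr0 add0r => E.
  have : 0 <= \int[mu]_(t in `[0, y]) (a^-1 * s t ^+ 2 - a * convL t ^+ 2).
    apply: le_trans (_ : convL y * convL y <= _); first by rewrite -expr2 sqr_ge0.
    rewrite E; apply: le_Rintegral => //.
    - exact: ac_ri H y0.
    - by apply: riB => //; apply: riZ => //; [exact: rs2'|exact: rL2].
    - move=> t _; have := @young2 _ a^-1 (s t) (convL t); rewrite invr_gt0 invrK => /(_ a0).
      by lra.
  rewrite RintegralB//; last 2 first.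
  - by apply: riZ => //; exact: rs2'.
  - by apply: riZ => //; exact: rL2.
  have -> : \int[mu]_(t in `[0, y]) (a^-1 * s t ^+ 2) = a^-1 * \int[mu]_(t in `[0, y]) s t ^+ 2.
    by apply: RintegralZl => //; exact: rs2'.
  have -> : \int[mu]_(t in `[0, y]) (a * convL t ^+ 2) = a * \int[mu]_(t in `[0, y]) convL t ^+ 2.
    by apply: RintegralZl => //; exact: rL2.
  have := int_sub_le y0; set I := \int[mu]_(t in _) _; set J := \int[mu]_(t in _) _ => h1 h2.
  have h3 : a * J <= a^-1 * n2 f.
    by apply: (@le_trans _ _ (a^-1 * I)); [lra|rewrite ler_wpM2l ?invr_ge0// ltW].
  rewrite -(ler_pM2l a0); apply: le_trans h3 _.
  have -> : a * ((2 / a) ^+ 2 * n2 f) = 4 * (a^-1 * n2 f) by move: (n2 f) => m; field; rewrite gt_eqF.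
  have := mulr_ge0 (ltW (_ : 0 < a^-1)) (n2_ge0 f); rewrite invr_gt0 => /(_ a0); lra.
have [r1 r2] := @ri_exhaust _ _ (measurable_funX 2 mL) (fun x => sqr_ge0 _) rL2 B.
have E x : sqn (convL x)%:C = convL x ^+ 2 by rewrite /sqn /= expr0n/= addr0.
split; last by apply: le_trans r2; rewrite /n2 le_eqVlt; apply/orP; left; apply/eqP/eq_Rint.
apply/L2sqn; split; first exact: cmeasC.
by apply: eq_ri r1.
Qed.

Let ra : ri Rp (fun t : R => expR (- a * t) * s t).
Proof.
have a20 : 0 < 2 * a by rewrite mulr_gt0.
have [re _] := expR_halfline a20.
apply: (@le_ri _ _ _ (fun t => expR (- (2 * a) * t) + s t ^+ 2)) => //.
- by apply: measurable_funM => //; exact: (ac_measurable (ac_expR _)).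
- move=> t _; rewrite ger0_norm ?mulr_ge0 ?expR_ge0//.
  have -> : expR (- (2 * a) * t) = expR (- a * t) ^+ 2 by rewrite expr2 -expRD; congr expR; ring.
  by have := sqr_ge0 (expR (- a * t) - s t); have := mulr_ge0 (expR_ge0 (- a * t)) (s0 t); nra.
- exact: riD.
Qed.

(** The convolution from the right, with the tail integral written as the whole minus the part over
    [[0, y]], a form to which the product rule for [ac] applies; [convRE] recovers the tail. *)
Definition convR y : R := expR (a * y) *
  (\int[mu]_(t in Rp) (expR (- a * t) * s t) - \int[mu]_(t in `[0, y]) (expR (- a * t) * s t)).

Lemma convRE y : 0 <= y -> convR y = expR (a * y) * \int[mu]_(t in `]y, +oo[) (expR (- a * t) * s t).
Proof.
by move=> y0; rewrite /convR (Rint_halfline_split y0 ra) addrC addKr.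
Qed.

Lemma ac_convR : ac convR (fun y => a * convR y - s y).
Proof.
have h : ac (fun y => \int[mu]_(t in `[0, y]) (expR (- a * t) * s t)) (fun t => expR (- a * t) * s t).
  move=> y y0; split; first by apply: riMcont => //; exact: rs.
  by rewrite set_itv1 Rintegral_set1 add0r.
apply: eq_ac (acM (ac_expR a) (acB' (ac_cst (\int[mu]_(t in Rp) (expR (- a * t) * s t))) h)) => y _ //=.
have E : expR (a * y) * expR (- a * y) = 1 by rewrite -expRD mulNr subrr expR0.
by rewrite sub0r mulrN mulrA E mul1r /convR; congr (_ + _); rewrite mulrA.
Qed.

Lemma convR_ge0 y : 0 <= y -> 0 <= convR y.
Proof.
move=> y0; rewrite convRE// mulr_ge0 ?expR_ge0// Rintegral_ge0// => t _.
by rewrite mulr_ge0// expR_ge0.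
Qed.

(** Cauchy-Schwarz on the tail, where the exponential kernel has squared norm [(2 * a)^-1]. The
    parameter t of [young_opt] plays the part of the usual discriminant argument. *)
Lemma convR_sup y : 0 <= y -> convR y ^+ 2 <= (2 * a)^-1 * n2 f.
Proof.
move=> y0; have S := tail_halfline y0.
have a20 : 0 < 2 * a by rewrite mulr_gt0.
have [re ie] := expR_halfline a20.
have q0 : 0 <= (2 * a)^-1 by rewrite invr_ge0 mulr_ge0// ltW.
have H : convR y <= nn f * Num.sqrt (2 * a)^-1.
  apply: young_opt; [exact: nn_ge0|exact: sqrtr_ge0|] => t t0.
  have rt : ri `]y, +oo[ (fun r : R => expR (- a * r) * s r) by exact: riS ra.
  have re' : ri `]y, +oo[ (fun r : R => expR (- (2 * a) * r)) by exact: riS re.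
  have rs' : ri `]y, +oo[ (fun r : R => s r ^+ 2) by exact: riS rs2.
  have rt2 : ri `]y, +oo[ (fun r : R => 2 * expR (a * y) * (expR (- a * r) * s r)) by exact: riZ.
  have r1 : ri `]y, +oo[ (fun r : R => t * s r ^+ 2) by exact: riZ.
  have r2 : ri `]y, +oo[ (fun r : R => t^-1 * expR (2 * a * y) * expR (- (2 * a) * r)) by exact: riZ.
  rewrite nn_sqr sqr_sqrtr// convRE// mulrA.
  have -> : 2 * expR (a * y) * \int[mu]_(r in `]y, +oo[) (expR (- a * r) * s r) =
      \int[mu]_(r in `]y, +oo[) (2 * expR (a * y) * (expR (- a * r) * s r)).
    by apply/esym/RintegralZl.
  apply: (@le_trans _ _ (\int[mu]_(r in `]y, +oo[) (t * s r ^+ 2 + t^-1 * expR (2 * a * y) * expR (- (2 * a) * r)))).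
    apply: le_Rintegral => //; first exact: riD.
    move=> r _; have := @young2 _ t (s r) (expR (a * y) * expR (- a * r)) t0.
    have -> : expR (2 * a * y) = expR (a * y) ^+ 2 by rewrite expr2 -expRD; congr expR; ring.
    have -> : expR (- (2 * a) * r) = expR (- a * r) ^+ 2 by rewrite expr2 -expRD; congr expR; ring.
    move: (expR _) (expR _) (s r) => e1 e2 e3.
    by move=> Y; apply: (le_trans _ (le_trans Y _)); rewrite le_eqVlt; apply/orP; left; apply/eqP; ring.
  rewrite RintegralD//.
  have -> : \int[mu]_(r in `]y, +oo[) (t * s r ^+ 2) = t * \int[mu]_(r in `]y, +oo[) (s r ^+ 2).
    exact: RintegralZl.
  have -> : \int[mu]_(r in `]y, +oo[) (t^-1 * expR (2 * a * y) * expR (- (2 * a) * r)) =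
      t^-1 * (2 * a)^-1.
    transitivity (t^-1 * expR (2 * a * y) * \int[mu]_(r in `]y, +oo[) expR (- (2 * a) * r)).
      exact: RintegralZl.
    have E : expR (2 * a * y) * expR (- (2 * a) * y) = 1 by rewrite -expRD mulNr subrr expR0.
    transitivity (t^-1 * (2 * a)^-1 * (expR (2 * a * y) * expR (- (2 * a) * y))); last by rewrite E mulr1.
    by rewrite ie//; move: (2 * a)^-1 (expR _) (expR _) => *; ring.
  rewrite lerD2r ler_wpM2l ?(ltW t0)// n2s (Rint_halfline_split y0 rs2) lerDr.
  by apply: Rintegral_ge0 => r _; exact: sqr_ge0.
have := lerXn2r 2 (convR_ge0 y0) _ H.
rewrite nnegrE mulr_ge0 ?nn_ge0 ?sqrtr_ge0// => /(_ isT) /le_trans; apply.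
by rewrite exprMn nn_sqr sqr_sqrtr// mulrC.
Qed.

(** The equation is now w' = a w - |f|, so Young bounds the derivative of w^2 from below by a w^2 -
    |f|^2 / a. Integrating leaves w^2 at the far end, which [convR_sup] controls uniformly. *)
Lemma convR_L2 : L2 (fun y => (convR y)%:C) /\ n2 (fun y => (convR y)%:C) <= (2 / a) ^+ 2 * n2 f.
Proof.
have mL : measurable_fun Rp convR := ac_measurable ac_convR.
have rL2 y : 0 <= y -> ri `[0, y] (fun t => convR t ^+ 2).
  move=> y0; have := ac_cont (acM ac_convR ac_convR) => /(@ri_cont _ _ y).
  by apply: eq_ri => // t _ /=; rewrite expr2.
have rs2' y : 0 <= y -> ri `[0, y] (fun t => s t ^+ 2).
  by move=> y0; apply: riS rs2 => //; exact: itv_halfline.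
have B y : 0 <= y -> \int[mu]_(t in `[0, y]) convR t ^+ 2 <= (2 / a) ^+ 2 * n2 f.
  move=> y0; have H := acM ac_convR ac_convR; have := acE H y0.
  rewrite /= => E.
  have : \int[mu]_(t in `[0, y]) (a * convR t ^+ 2 - a^-1 * s t ^+ 2) <= (2 * a)^-1 * n2 f.
    apply: le_trans (_ : convR y * convR y <= _); last by rewrite -expr2 convR_sup.
    rewrite E; apply: le_trans (_ : \int[mu]_(t in `[0, y]) ((a * convR t - s t) * convR t + convR t * (a * convR t - s t)) <= _).
      apply: le_Rintegral => //.
      - by apply: riB => //; apply: riZ => //; [exact: rL2|exact: rs2'].
      - exact: ac_ri H y0.
      - move=> t _; have := @young2 _ a^-1 (s t) (convR t); rewrite invr_gt0 invrK => /(_ a0).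
        by lra.
    by rewrite lerDr -expr2 sqr_ge0.
  rewrite RintegralB//; last 2 first.
  - by apply: riZ => //; exact: rL2.
  - by apply: riZ => //; exact: rs2'.
  have -> : \int[mu]_(t in `[0, y]) (a^-1 * s t ^+ 2) = a^-1 * \int[mu]_(t in `[0, y]) s t ^+ 2.
    by apply: RintegralZl => //; exact: rs2'.
  have -> : \int[mu]_(t in `[0, y]) (a * convR t ^+ 2) = a * \int[mu]_(t in `[0, y]) convR t ^+ 2.
    by apply: RintegralZl => //; exact: rL2.
  have := int_sub_le y0; set I := \int[mu]_(t in _) _; set J := \int[mu]_(t in _) _ => h1 h2.
  have h3 : a * J <= a^-1 * n2 f + (2 * a)^-1 * n2 f.
    have : a^-1 * I <= a^-1 * n2 f by rewrite ler_wpM2l ?invr_ge0// ltW.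
    by lra.
  rewrite -(ler_pM2l a0); apply: le_trans h3 _.
  have -> : (2 * a)^-1 * n2 f = 2^-1 * (a^-1 * n2 f) by move: (n2 f) => m; field; rewrite gt_eqF.
  have -> : a * ((2 / a) ^+ 2 * n2 f) = 4 * (a^-1 * n2 f) by move: (n2 f) => m; field; rewrite gt_eqF.
  have : 0 <= a^-1 * n2 f by rewrite mulr_ge0 ?invr_ge0 ?n2_ge0// ltW.
  by lra.
have [r1 r2] := @ri_exhaust _ _ (measurable_funX 2 mL) (fun x => sqr_ge0 _) rL2 B.
have E x : sqn (convR x)%:C = convR x ^+ 2 by rewrite /sqn /= expr0n/= addr0.
split; last by apply: le_trans r2; rewrite /n2 le_eqVlt; apply/orP; left; apply/eqP/eq_Rint.
apply/L2sqn; split; first exact: cmeasC.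
by apply: eq_ri r1.
Qed.

Lemma conv_majorant : exists m, [/\ L2 (fun y => (m y)%:C), nn (fun y => (m y)%:C) <= 4 / a * nn f &
  forall y, 0 <= y ->
   expR (- a * y) * \int[mu]_(t in `[0, y]) (expR (a * t) * s t) +
   expR (a * y) * \int[mu]_(t in `]y, +oo[) (expR (- a * t) * s t) <= m y].
Proof.
have [l1 l2] := convL_L2; have [r1 r2] := convR_L2.
have K F : n2 F <= (2 / a) ^+ 2 * n2 f -> nn F <= 2 / a * nn f.
  rewrite -!nn_sqr -exprMn ler_pXn2r// nnegrE ?nn_ge0// mulr_ge0 ?nn_ge0//.
  by rewrite divr_ge0// ltW.
exists (fun y => convL y + convR y); split.
- by apply: eq_L2 (L2D l1 r1) => x _; rewrite rmorphD.
- rewrite (@eq_nn _ _ (fun y => (convL y)%:C + (convR y)%:C)); last by move=> x _; rewrite rmorphD.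
  apply: le_trans (nnD l1 r1) _; apply: le_trans (lerD (K _ l2) (K _ r2)) _.
  by rewrite -mulrDl -mulrDl -natrD.
- by move=> y y0; rewrite convRE.
Qed.
End Conv.
Lemma cac_eq F G H : cac F H -> cac G H -> F 0 = G 0 -> forall y, 0 <= y -> F y = G y.
Proof. by move=> hF hG e y y0; rewrite (cacE hF y0) (cacE hG y0) e. Qed.

(** * Uniqueness and decay of solutions of the homogeneous equation *)

Section Decay.
Variables (q : R -> R[i]) (K eta a : R).
Hypotheses (mq : cmeas Rp q) (K0 : 0 < K) (eta0 : 0 < eta) (a0 : 0 < a)
  (qK : forall y, 0 <= y -> normc (q y) <= K * expR (- eta * y)).
Variables (F0 F1 : R -> R[i]).
Hypotheses (h0 : cac F0 F1) (h1 : cac F1 (fun y => (a%:C ^+ 2 + q y) * F0 y)).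

(** From the factorisation of d^2 - a^2 as (d - a)(d + a): [z] solves the first order equation z' -
    a z = q F0, and [F0] is recovered from F0' + a F0 = z. *)
Let z y := F1 y + a%:C * F0 y.

Lemma cac_z : cac (fun y => ex (- a) y * z y) (fun y => ex (- a) y * (q y * F0 y)).
Proof.
have hz : cac z (fun y => (a%:C ^+ 2 + q y) * F0 y + a%:C * F1 y) by apply: cacD => //; exact: cacZ.
apply: eq_cac (cacM (cac_ex (- a)) hz) => y y0 //.
have aN : (- a)%:C = - a%:C :> R[i] by apply: complex_eq => //=; rewrite oppr0.
rewrite aN /z; move: (a%:C) (ex _ y) (q y) (F0 y) (F1 y) => *; ring.
Qed.

Lemma cac_eF0 : cac (fun y => ex a y * F0 y) (fun y => ex a y * z y).
Proof.
apply: eq_cac (cacM (cac_ex a) h0) => y y0 //.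
by rewrite /z; move: (a%:C) (ex _ y) (F0 y) (F1 y) => *; ring.
Qed.

(** With zero Cauchy data the two first order equations integrate to the quantities [Pv], so [F0] is
    a fixed point of [Tv]. A function bounded by B is admissible with constant B exp(lam), because
    [om] is at least exp(- lam). *)
Lemma ode_unique B : 0 <= B -> (forall y, 0 <= y -> normc (F0 y) <= B) ->
  F0 0 = 0 -> F1 0 = 0 -> forall y, 0 <= y -> F0 y = 0.
Proof.
move=> B0 hB F00 F10.
have hF : adm K eta a (B * expR (lam K eta a)) F0.
  split; first exact: cac_meas h0.
  move=> y y0; apply: le_trans (hB y y0) _.
  rewrite -mulrA -[leLHS]mulr1 ler_wpM2l//.
  have g1 : 1 <= expR (lam K eta a) * gw K eta a y.
    rewrite -(expRxMexpNx_1 (lam K eta a)) ler_wpM2l ?expR_ge0//.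
    exact: gw_ge.
  have g2 : 1 <= expR (a * y) by rewrite -expR0 ler_expR mulr_ge0// ltW.
  by rewrite /om mulrCA (le_trans g2)// ler_peMr ?expR_ge0.
have A0 : 0 <= B * expR (lam K eta a) by rewrite mulr_ge0 ?expR_ge0.
have as_Na' : 0 <= a + - a by rewrite subrr.
have as_a' : 0 <= a + a by rewrite addr_ge0// ltW.
apply: (contraction_eq0 mq K0 eta0 a0 qK hF A0) => y y0.
have hP := Pv_cac mq K0 eta0 a0 qK hF A0 as_Na'.
have hQ := Pv_cac mq K0 eta0 a0 qK hF A0 as_a'.
have E1 : ex (- a) y * z y = Pv q (- a) F0 y.
  have e0 : ex (- a) 0 * z 0 = Pv q (- a) F0 0 by rewrite Pv0 /z F00 F10 mulr0 addr0 mulr0.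
  exact: (cac_eq cac_z hP e0 y0).
have hw : cac (fun y => ex a y * (F1 y - a%:C * F0 y)) (fun y => ex a y * (q y * F0 y)).
  have hz : cac (fun y => F1 y - a%:C * F0 y) (fun y => (a%:C ^+ 2 + q y) * F0 y - a%:C * F1 y).
    by apply: cacB => //; exact: cacZ.
  apply: eq_cac (cacM (cac_ex a) hz) => t t0 //.
  by move: (a%:C) (ex _ t) (q t) (F0 t) (F1 t) => *; ring.
have E2 : ex a y * (F1 y - a%:C * F0 y) = Pv q a F0 y.
  have e0 : ex a 0 * (F1 0 - a%:C * F0 0) = Pv q a F0 0 by rewrite Pv0 F00 F10 mulr0 subr0 mulr0.
  exact: (cac_eq hw hQ e0 y0).
rewrite /Tv -E1 -E2 /z !mulrA exM [ex (- a) y * _]mulrC exM.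
have := aC_neq0 a0; move: (a%:C) (F0 y) (F1 y) => c d e cn.
by field; rewrite cn.
Qed.

Hypotheses (L0 : L2 F0) (L1 : L2 F1) (F00 : F0 0 = 0).

Lemma L2_ex k : 0 < k -> L2 (ex (- k) : R -> R[i]).
Proof.
move=> k0; apply/L2sqn; split; first exact: cac_meas (cac_ex _).
have k20 : 0 < 2 * k by rewrite mulr_gt0.
have [re _] := expR_halfline k20; apply: eq_ri re => // y _.
by rewrite sqn_normc normc_ex expr2 -expRD; congr expR; ring.
Qed.

(** Square integrability removes the growing part of [z], so exp(- a y) z is minus a tail integral
    of exp(- a t) q F0. The decay of [q] then improves the rate b of [F0] to eta + b for [z]. *)
Lemma z_decay B b : 0 <= B -> 0 <= b -> (forall y, 0 <= y -> normc (F0 y) <= B * expR (- b * y)) ->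
  forall y, 0 <= y -> normc (z y) <= K * B / a * expR (- (eta + b) * y).
Proof.
move=> B0 b0 hB y y0.
have k0 : 0 < a + eta + b by rewrite ltr_wpDr// addr_gt0.
have [re ie] := expR_halfline k0.
have rg : ri Rp (fun t => K * B * expR (- (a + eta + b) * t)) by exact: riZ.
have G t : 0 <= t -> normc (ex (- a) t * (q t * F0 t)) <= K * B * expR (- (a + eta + b) * t).
  move=> t0; rewrite !normcM normc_ex.
  have -> : expR (- (a + eta + b) * t) = expR (- a * t) * (expR (- eta * t) * expR (- b * t)).
    by rewrite -!expRD; congr expR; ring.
  have q1 := qK t0; have q2 := hB _ t0.
  have -> : K * B * (expR (- a * t) * (expR (- eta * t) * expR (- b * t))) =
    expR (- a * t) * ((K * expR (- eta * t)) * (B * expR (- b * t))).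
    by move: (expR _) (expR _) (expR _) => *; ring.
  by rewrite ler_wpM2l ?expR_ge0// ler_pM ?normc_ge0.
have iG : ci Rp (fun t => ex (- a) t * (q t * F0 t)).
  apply: le_ci rg => //; last by move=> t /halfline_ge0; exact: G.
  apply: cmeasM; first exact: cac_meas (cac_ex _).
  by apply: cmeasM => //; exact: cac_meas h0.
have Lz : L2 z by apply: L2D => //; case: (L2Z a%:C L0).
have iZ : ci Rp (fun t => ex (- a) t * z t) by apply: L2_ciM Lz; exact: L2_ex.
have := cac_tail_le cac_z iZ iG y0 rg (fun t yt => G t (ltW (le_lt_trans y0 yt))).
have -> : \int[mu]_(t in `]y, +oo[) (K * B * expR (- (a + eta + b) * t)) =
   K * B * ((a + eta + b)^-1 * expR (- (a + eta + b) * y)).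
  rewrite -ie//; apply: RintegralZl => //.
  by apply: riS re => //; exact: tail_halfline.
rewrite normcM normc_ex => H.
rewrite -(ler_pM2l (expR_gt0 (- a * y))); apply: le_trans H _.
have -> : expR (- (a + eta + b) * y) = expR (- a * y) * expR (- (eta + b) * y).
  by rewrite -expRD; congr expR; ring.
move: (expR_gt0 (- a * y)) (expR_gt0 (- (eta + b) * y)); move: (expR _) (expR _) => e1 e2 e10 e20.
have -> : K * B * ((a + eta + b)^-1 * (e2 * e1)) = (a + eta + b)^-1 * (K * B * e2 * e1) by ring.
have -> : e2 * (K * B / a * e1) = a^-1 * (K * B * e2 * e1) by ring.
rewrite ler_wpM2r//; first by rewrite !mulr_ge0// ltW.
by rewrite lef_pV2// -addrA lerDl addr_ge0// ltW.
Qed.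

Lemma F0_decay_step B b h : 0 <= B -> 0 <= b -> 0 < h -> 2 * h <= eta -> b + h <= a ->
  (forall y, 0 <= y -> normc (F0 y) <= B * expR (- b * y)) ->
  forall y, 0 <= y -> normc (F0 y) <= K * B / a / h * expR (- (b + h) * y).
Proof.
move=> B0 b0 hpos heta hba hB y y0.
have C0 : 0 <= K * B / a by rewrite divr_ge0 ?mulr_ge0// ltW.
have hn : h != 0 by rewrite gt_eqF.
have := cacE cac_eF0 y0; rewrite F00 mulr0 add0r => E.
have re : ri `[0, y] (fun t => expR (- h * t)) by apply: ri_cont; exact: ac_cont (ac_expR (- h)).
(* The two rate conditions are used here: b + h <= a lets exp((a - b - h) t) be replaced by its
   value at y, and 2 h <= eta leaves a factor exp(- h t), whose integral is at most 1 / h. *)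
pose D := K * B / a * expR ((a - b - h) * y).
have D0 : 0 <= D by rewrite mulr_ge0 ?expR_ge0.
have rD : ri `[0, y] (fun t => D * expR (- h * t)) by exact: riZ.
have H : normc (ex a y * F0 y) <= \int[mu]_(t in `[0, y]) (D * expR (- h * t)).
  rewrite E; apply: normc_cint_le => //; first exact: cac_ci cac_eF0 y0.
  move=> t; rewrite /= in_itv/= => /andP[t0 ty]; rewrite normcM normc_ex.
  have Z := z_decay B0 b0 hB t0.
  apply: le_trans (ler_wpM2l (expR_ge0 _) Z) _.
  have -> : expR (a * t) * (K * B / a * expR (- (eta + b) * t)) =
      K * B / a * (expR (a * t) * expR (- (eta + b) * t)).
    by move: (K * B / a) (expR _) (expR _) => *; ring.
  rewrite /D -[leRHS]mulrA; apply: ler_wpM2l => //; rewrite -!expRD ler_expR.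
  have -> : a * t + - (eta + b) * t = (a - b - h) * t + (h - eta) * t by ring.
  apply: lerD; first by rewrite ler_wpM2l//; lra.
  by rewrite ler_wpM2r//; lra.
have I : \int[mu]_(t in `[0, y]) (D * expR (- h * t)) <= D / h.
  rewrite RintegralZl// ler_wpM2l//.
  have := acE (ac_expR (- h)) y0; rewrite mulr0 expR0 RintegralZl// => EI.
  have -> : \int[mu]_(t in `[0, y]) expR (- h * t) = (1 - expR (- h * y)) / h.
    by rewrite EI; field.
  by rewrite ler_pdivrMr// mulVf// gerBl expR_ge0.
have {}H := le_trans H I; rewrite normcM normc_ex in H.
rewrite -(ler_pM2l (expR_gt0 (a * y))); apply: le_trans H _.
have -> : expR (a * y) * (K * B / a / h * expR (- (b + h) * y)) =
    K * B / a * (expR (a * y) * expR (- (b + h) * y)) / h by move: (expR _) (expR _) => *; ring.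
rewrite -expRD /D; have -> : a * y + - (b + h) * y = (a - b - h) * y by ring.
by [].
Qed.

Lemma rayleigh_decay : exists2 B, 0 <= B &
  forall y, 0 <= y -> normc (F0 y) <= B * expR (- a * y) /\ normc (F1 y) <= B * expR (- a * y).
Proof.
have [M M0 HM] := L2_bounded h0 L0 L1.
(* Since N > 2 a / eta, the gain h = a / N per step is at most eta / 2, and N steps starting from
   mere boundedness arrive exactly at the rate a. *)
pose N := (Num.truncn (2 * a / eta)).+1.
have N0 : 0 < N%:R :> R by rewrite ltr0n.
pose h := a / N%:R.
have hpos : 0 < h by rewrite divr_gt0.
have heta : 2 * h <= eta.
  have : 2 * a / eta < N%:R by exact: truncnS_gt.
  rewrite ltr_pdivrMr// => /ltW H; rewrite /h mulrA ler_pdivrMr//.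
  by rewrite [eta * _]mulrC.
have step k : (k <= N)%N -> exists2 B, 0 <= B & forall y, 0 <= y -> normc (F0 y) <= B * expR (- (k%:R * h) * y).
  elim: k => [_|k IH kN].
    by exists M => // y y0; rewrite mul0r oppr0 mul0r expR0 mulr1 HM.
  have [B B0 hB] := IH (ltnW kN).
  have kh : 0 <= k%:R * h by rewrite mulr_ge0// ltW.
  exists (K * B / a / h); first by rewrite !divr_ge0 ?mulr_ge0// ltW.
  have E : k.+1%:R * h = k%:R * h + h by rewrite -natr1 mulrDl mul1r.
  rewrite E; apply: F0_decay_step => //.
  by rewrite -E /h mulrCA ler_piMr ?(ltW a0)// ler_pdivrMr// mul1r ler_nat.
have [B B0 hB] := step N (leqnn N).
have Nh : N%:R * h = a by rewrite /h mulrC divfK// gt_eqF.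
rewrite Nh in hB.
exists (B + (K * B / a + a * B)).
  by rewrite !addr_ge0 ?divr_ge0 ?mulr_ge0// ltW.
move=> y y0; have F0y := hB y y0.
have X0 : 0 <= K * B / a * expR (- a * y) by rewrite !mulr_ge0 ?expR_ge0 ?invr_ge0// ltW.
have Y0 : 0 <= a * B * expR (- a * y) by rewrite !mulr_ge0 ?expR_ge0// ltW.
have Z0 : 0 <= B * expR (- a * y) by rewrite mulr_ge0 ?expR_ge0.
split; first by rewrite !mulrDl; lra.
have -> : F1 y = z y - a%:C * F0 y by rewrite /z addrK.
rewrite (le_trans (le_normcD _ _))// normcN normcM normcR gtr0_norm//.
have Z := z_decay B0 (ltW a0) hB y0.
have E : expR (- (eta + a) * y) <= expR (- a * y).
  rewrite ler_expR ler_wpM2r// lerN2 lerDr; exact: ltW.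
have C0 : 0 <= K * B / a by rewrite divr_ge0 ?mulr_ge0// ltW.
have {}Z := le_trans Z (ler_wpM2l C0 E).
have A := ler_wpM2l (ltW a0) F0y.
by rewrite !mulrDl -[a * B * _]mulrA; lra.
Qed.
End Decay.

(** * The inhomogeneous equation *)

Section Solve.
Variables (q : R -> R[i]) (K eta a : R).
Hypotheses (mq : cmeas Rp q) (K0 : 0 < K) (eta0 : 0 < eta) (a0 : 0 < a)
  (qK : forall y, 0 <= y -> normc (q y) <= K * expR (- eta * y)).
Variables (F0 F1 : R -> R[i]).
Hypotheses (h0 : cac F0 F1) (h1 : cac F1 (fun y => (a%:C ^+ 2 + q y) * F0 y))
  (L0 : L2 F0) (L1 : L2 F1) (F00 : F0 0 = 0) (Fn0 : nn F0 != 0).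

(** Otherwise the Cauchy data vanish and [ode_unique] gives the zero function. This slope is the
    Wronskian by which variation of constants divides. *)
Lemma rayleigh_slope_neq0 : F1 0 != 0.
Proof.
apply: contra Fn0 => /eqP F10; apply/eqP.
have [M M0 HM] := L2_bounded h0 L0 L1.
apply: nn0_ae => //; apply: aeW => x /halfline_ge0.
exact: (ode_unique mq K0 eta0 a0 qK h0 h1 M0 HM F00 F10).
Qed.

(* Variation of constants; the orthogonality of f and F0 makes the coefficient of the
   growing solution decay. *)
Lemma rayleigh_solve : exists2 C, 0 <= C & forall f : R -> R[i], L2 f ->
  cint Rp (fun y => F0 y * f y) = 0 ->
  exists X0 X1, [/\ cac X0 X1, cac X1 (fun y => (a%:C ^+ 2 + q y) * X0 y + f y), X0 0 = 0 &
    [/\ L2 X0, L2 X1, nn X0 <= C * nn f & nn X1 <= C * nn f]].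
Proof.
have [V [V1 [B [hV hV1 V0 [B0 HV HV1]]]]] := growing_solution mq K0 eta0 a0 qK.
have [D D0 HF] := rayleigh_decay mq K0 eta0 a0 qK h0 h1 L0 L1 F00.
have Wn := rayleigh_slope_neq0; set W := F1 0 in Wn.
(* The equation has no first order term, so the Wronskian is constant; its value at 0 uses [V 0 = 1]
   and [F0 0 = 0]. *)
have wronsk y : 0 <= y -> V y * F1 y - V1 y * F0 y = W.
  have hW : cac (fun y => V y * F1 y - V1 y * F0 y) (fun=> 0).
    apply: eq_cac (cacB (cacM hV h1) (cacM hV1 h0)) => t t0 //.
    by move: (a%:C) (q t) (V t) (V1 t) (F0 t) (F1 t) => *; ring.
  move=> y0; rewrite (cac_eq hW (cac_cst W)) //.
  by rewrite F00 V0 mul1r mulr0 subr0.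
pose w := normc W^-1.
pose C := w * (D * B) * (4 / a).
have w0 : 0 <= w by exact: normc_ge0.
have C0 : 0 <= C by rewrite /C !mulr_ge0 ?invr_ge0// ltW.
exists C => // f hf Ff0.
have mf := L2_meas hf.
pose A y := W^-1 * cint `[0, y] (fun t => V t * f t).
pose E y := - W^-1 * cint `[0, y] (fun t => F0 t * f t).
have iVf y : 0 <= y -> ci `[0, y] (fun t => V t * f t).
  move=> y0; have [M M0 HM] := cac_bounded y hV.
  have rf : ri `[0, y] (fun t => M * (1 + sqn (f t))).
    apply: riZ => //; apply: riD => //; first exact: ri_cst.
    by have /L2sqn[_ r] := hf; apply: riS r => //; exact: itv_halfline.
  apply: le_ci rf => //.
    by apply: cmeasM; [apply: cmeasS (cac_meas hV) => //|apply: cmeasS mf => //]; exact: itv_halfline.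
  move=> t; rewrite /= in_itv/= => t0y; rewrite normcM ler_pM ?normc_ge0 ?HM//.
  by rewrite sqn_normc; have := sqr_ge0 (normc (f t) - 1); have := normc_ge0 (f t); nra.
have iFf : ci Rp (fun t => F0 t * f t) by exact: L2_ciM.
have iFfy y : 0 <= y -> ci `[0, y] (fun t => F0 t * f t).
  by move=> y0; apply: ciS iFf => //; exact: itv_halfline.
have c0 G : cint `[0, 0] G = 0.
  by apply: complex_eq; rewrite !reimE set_itv1 Rintegral_set1.
have hA : cac A (fun t => W^-1 * (V t * f t)).
  apply: cacZ; apply/cacP => y y0; split; first exact: iVf.
  by rewrite c0 add0r.
have hE : cac E (fun t => - W^-1 * (F0 t * f t)).
  apply: cacZ; apply/cacP => y y0; split; first exact: iFfy.
  by rewrite c0 add0r.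
pose X0 y := A y * F0 y + E y * V y.
pose X1 y := A y * F1 y + E y * V1 y.
have hX0 : cac X0 X1.
  apply: eq_cac (cacD (cacM hA h0) (cacM hE hV)) => y y0 //.
  by rewrite /X1; move: (W^-1) (V y) (V1 y) (F0 y) (F1 y) (f y) (A y) (E y) => *; ring.
have hX1 : cac X1 (fun y => (a%:C ^+ 2 + q y) * X0 y + f y).
  apply: eq_cac (cacD (cacM hA h1) (cacM hE hV1)) => y y0 //.
  rewrite /X0; have Wy := wronsk y y0.
  transitivity ((a%:C ^+ 2 + q y) * (A y * F0 y + E y * V y) + W^-1 * (V y * F1 y - V1 y * F0 y) * f y).
    by move: (a%:C) (q y) (W^-1) (V y) (V1 y) (F0 y) (F1 y) (f y) (A y) (E y) => *; ring.
  by rewrite Wy mulVf// mul1r.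
have [m [Lm nm Hm]] := conv_majorant a0 hf.
have bA y : 0 <= y -> normc (A y) <= w * B * \int[mu]_(t in `[0, y]) (expR (a * t) * normc (f t)).
  move=> y0; rewrite normcM -mulrA ler_wpM2l//.
  have rs : ri `[0, y] (fun t => expR (a * t) * normc (f t)).
    apply: riMcont; first exact: ac_cont (ac_expR a).
    have [i1 i2] := L2_ci_itv y0 hf.
    apply: (@le_ri _ _ _ (fun t => `|Re (f t)| + `|Im (f t)|)) => //.
    - by apply: measurable_normc; apply: cmeasS mf => //; exact: itv_halfline.
    - by move=> t _; rewrite ger0_norm ?normc_ge0// normc_le_ReIm.
    - by apply: riD => //; exact: integrable_norm.
  rewrite -RintegralZl//; apply: normc_cint_le => //; [exact: iVf|exact: riZ|].
  move=> t; rewrite /= in_itv/= => /andP[t0 _]; rewrite normcM mulrA.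
  by rewrite ler_wpM2r ?normc_ge0// HV.
have bE y : 0 <= y -> normc (E y) <= w * D * \int[mu]_(t in `]y, +oo[) (expR (- a * t) * normc (f t)).
  move=> y0.
  have -> : E y = W^-1 * cint `]y, +oo[ (fun t => F0 t * f t).
    have := cint_setU y0 iFf; rewrite Ff0 /E => /esym/eqP.
    by rewrite addr_eq0 => /eqP ->; rewrite mulrNN.
  rewrite normcM -mulrA ler_wpM2l//.
  have S := tail_halfline y0.
  have ra : ri `]y, +oo[ (fun t => expR (- a * t) * normc (f t)).
    have a20 : 0 < 2 * a by rewrite mulr_gt0.
    have [re _] := expR_halfline a20.
    have /L2sqn[_ r] := hf.
    apply: (@le_ri _ _ _ (fun t => expR (- (2 * a) * t) + sqn (f t))) => //.
    - apply: measurable_funM; first by apply: measurable_funS (ac_measurable (ac_expR (- a))).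
      by apply: measurable_normc; apply: cmeasS mf.
    - move=> t _; rewrite ger0_norm ?mulr_ge0 ?expR_ge0 ?normc_ge0// sqn_normc.
      have -> : expR (- (2 * a) * t) = expR (- a * t) ^+ 2 by rewrite expr2 -expRD; congr expR; ring.
      have := sqr_ge0 (expR (- a * t) - normc (f t)).
      by have := mulr_ge0 (expR_ge0 (- a * t)) (normc_ge0 (f t)); nra.
    - by apply: riD => //; [exact: riS re|exact: riS r].
  rewrite -RintegralZl//; apply: normc_cint_le => //; [exact: ciS iFf|exact: riZ|].
  move=> t; rewrite /= in_itv/= andbT => yt; rewrite normcM mulrA.
  by rewrite ler_wpM2r ?normc_ge0//; case: (HF t (ltW (le_lt_trans y0 yt))).
(* The decaying factor multiplies the integral over [[0, y]] and the growing factor multiplies the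
   tail, so both products sit below the convolution [m]. The pair (F0, V) gives the bound on [X0],
   the pair (F1, V1) the bound on its derivative. *)
have bound (P Q : R -> R[i]) : cmeas Rp (fun y => A y * P y + E y * Q y) ->
    (forall y, 0 <= y -> normc (P y) <= D * expR (- a * y)) ->
    (forall y, 0 <= y -> normc (Q y) <= B * expR (a * y)) ->
    L2 (fun y => A y * P y + E y * Q y) /\ nn (fun y => A y * P y + E y * Q y) <= C * nn f.
  move=> mX HP HQ.
  have wDB : 0 <= w * (D * B) by rewrite !mulr_ge0.
  have H y : 0 <= y -> normc (A y * P y + E y * Q y) <= w * (D * B) * normc (m y)%:C.
    move=> y0; rewrite (le_trans (le_normcD _ _))// (normcM (A y)) (normcM (E y)) normcR.
    have p1 := ler_pM (normc_ge0 _) (normc_ge0 _) (bA y y0) (HP y y0).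
    have p2 := ler_pM (normc_ge0 _) (normc_ge0 _) (bE y y0) (HQ y y0).
    apply: le_trans (lerD p1 p2) _.
    apply: le_trans (ler_wpM2l wDB (le_trans (Hm y y0) (ler_norm _))).
    rewrite le_eqVlt; apply/orP; left; apply/eqP.
    by move: (expR _) (expR _) (\int[mu]_(t in _) _) (\int[mu]_(t in _) _) => *; ring.
  have [LX nX] := L2_le wDB Lm mX H; split=> //.
  by apply: le_trans nX _; rewrite /C -[leRHS]mulrA ler_wpM2l.
have HF0 y (y0 : 0 <= y) := proj1 (HF y y0).
have HF1 y (y0 : 0 <= y) := proj2 (HF y y0).
have [b0 b1] := bound F0 V (cac_meas hX0) HF0 HV.
have [b2 b3] := bound F1 V1 (cac_meas hX1) HF1 HV1.
exists X0, X1; split=> //.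
by rewrite /X0 /A /E !c0 !mulr0 !mul0r addr0.
Qed.
End Solve.

End RayleighODE.

(** * The shear flow *)

Section ShearFlow.
Variable R : realType.
Notation mu := (@lebesgue_measure R).
Notation ri D f := (mu.-integrable D (EFin \o f)).
Notation Rp := (@halfline R).
Notation Re := (@complex.Re R).
Notation Im := (@complex.Im R).
Implicit Types (f g : R -> R) (F G H : R -> R[i]) (x y b M : R) (z c : R[i]) (D E : set R).

(** At x > 0 the constraint 0 <= h + x holds for all small h, so the restricted filter is the
    punctured neighbourhood of 0. *)
Lemma quotient_is_derive f x : 0 < x -> cvg (halfline_quotient f x) ->
  is_derive x 1 f (halfline_deriv f x).
Proof.
move=> x0 cv.
have E : within [set h | 0 <= h + x] (nbhs (0 : R)^') = (0 : R)^'.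
  apply/seteqP; split=> P; last by move=> h; apply: cvg_within h.
  rewrite /within/= => h; near=> t; apply: (near h t) => //=.
  suff : `|t| < x by rewrite ltr_norml => /andP[? _]; lra.
  near: t; apply: nbhs_dnbhs; near=> t.
  rewrite -[t]subr0 distrC; near: t; exact: nbhsx_ballx.
have E' : halfline_quotient f x = (h^-1 *: ((f \o shift x) (h *: 1) - f x)) @[h --> 0^'].
  rewrite /halfline_quotient E.
  suff -> : (fun h : R => h^-1 * (f (h + x) - f x)) = (fun h : R => h^-1 *: ((f \o shift x) (h *: 1) - f x)) by [].
  by apply/funext => h /=; rewrite [h *: 1]mulr1.
have dv : derivable f x 1 by rewrite /derivable -E'.
apply: DeriveDef => //.
by rewrite /halfline_deriv E'.
Unshelve. all: by end_near. Qed.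

Lemma quotient_cvg f x : cvg (halfline_quotient f x) ->
  f y @[y --> within Rp (nbhs x)] --> f x.
Proof.
move=> /cvg_ex[l cv].
apply/cvgrPdist_lt => e e0; rewrite !near_withinE.
have /cvgrPdist_lt/(_ 1 ltr01) := cv.
rewrite near_simpl near_withinE => H.
have {}H : \forall h \near (0 : R), h != 0 -> 0 <= h + x -> `|l - h^-1 * (f (h + x) - f x)| < 1.
  by move: H; rewrite near_withinE.
have HS : \forall y \near x, y - x != 0 -> 0 <= y -> `|l - (y - x)^-1 * (f y - f x)| < 1.
  have cs : (y - x) @[y --> x] --> (0 : R).
    by rewrite -[0](subrr x); apply: cvgB => //; exact: cvg_cst.
  have H' : \forall y \near x, y - x != 0 -> 0 <= y - x + x ->
    `|l - (y - x)^-1 * (f (y - x + x) - f x)| < 1 := cs _ H.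
  by near=> y => yx y0; have := near H' y; rewrite subrK; apply.
have l10 : 0 < `|l| + 1 by rewrite ltr_wpDl.
near=> y; move=> /halfline_ge0 y0.
have [->|yx] := eqVneq y x; first by rewrite subrr normr0.
have yx0 : y - x != 0 by rewrite subr_eq0.
have q1 : `|l - (y - x)^-1 * (f y - f x)| < 1 by apply: (near HS y).
have q2 : `|(y - x)^-1 * (f y - f x)| < `|l| + 1.
  rewrite -[X in `|X|](subKr l) (le_lt_trans (ler_normB _ _))//.
  by rewrite ltrD2l.
have d : `|y - x| < e / (`|l| + 1).
  near: y; have e1 : 0 < e / (`|l| + 1) by rewrite divr_gt0.
  have := nbhsx_ballx x _ e1; apply: filterS => y; rewrite /ball/= distrC; exact.
rewrite distrC -[f y - f x](mulVKf yx0) normrM.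
rewrite (lt_trans (y := `|y - x| * (`|l| + 1)))//.
  by rewrite ltr_pM2l// normr_gt0.
by rewrite -ltr_pdivlMr.
Unshelve. all: by end_near. Qed.

Lemma halfline_smooth_within U k : halfline_smooth U ->
  {within Rp, continuous (halfline_derivn k U : R -> R)}.
Proof.
move=> sU; apply/subspace_continuousP => x /halfline_ge0 x0.
exact: quotient_cvg (sU k x x0).
Qed.

Lemma halfline_smooth_is_derive U k x : halfline_smooth U -> 0 < x ->
  is_derive x 1 (halfline_derivn k U) (halfline_derivn k.+1 U x).
Proof. by move=> sU x0; apply: quotient_is_derive => //; apply: sU; exact: ltW. Qed.

Lemma ac_comp_C1 (h h' : R -> R) f g : (forall u : R, is_derive u 1 h (h' u)) -> continuous h' ->
  {within Rp, continuous f} -> {within Rp, continuous g} ->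
  (forall x, 0 < x -> is_derive x 1 f (g x)) -> ac (h \o f) (fun x => h' (f x) * g x).
Proof.
move=> dh ch' cf cg df; apply: ac_C1.
- move=> x; apply: (@continuous_comp _ _ _ (f : subspace Rp -> R)); first exact: cf.
  by apply/differentiable_continuous/derivable1_diffP; apply: ex_derive.
- move=> x; apply: continuousM; last exact: cg.
  by apply: (@continuous_comp _ _ _ (f : subspace Rp -> R)); [exact: cf|exact: ch'].
- move=> x x0; have := df x x0 => dfx; have := dh (f x) => dhx.
  exact: is_derive1_comp.
Qed.
Lemma cReV z : Re z^-1 = Re z / sqn z.
Proof. by case: z. Qed.

Lemma cImV z : Im z^-1 = - (Im z / sqn z).
Proof. by case: z => a b /=; rewrite /sqn/= ?mulNr. Qed.

(** The two functions of the real variable u are the real and imaginary parts of 1 / (u - (p + i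
    m)). They are composed with the velocity profile in [cac_res]. *)
Lemma is_derive_res (p m u : R) : m != 0 ->
  is_derive u 1 (fun u => (u - p) / ((u - p) ^+ 2 + m ^+ 2))
   ((m ^+ 2 - (u - p) ^+ 2) / ((u - p) ^+ 2 + m ^+ 2) ^+ 2) /\
  is_derive u 1 (fun u => m / ((u - p) ^+ 2 + m ^+ 2))
   (- (2 * m * (u - p)) / ((u - p) ^+ 2 + m ^+ 2) ^+ 2).
Proof.
move=> m0.
have N0 v : (v - p) ^+ 2 + m ^+ 2 != 0.
  by rewrite gt_eqF// ltr_wpDl ?sqr_ge0// exprn_even_gt0.
have d1 : is_derive u 1 (fun u : R => u - p) 1.
  by apply: is_derive_eq; rewrite subr0.
have d2 : is_derive u 1 (fun u : R => (u - p) ^+ 2 + m ^+ 2) (2 * (u - p)).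
  have -> : (fun u : R => (u - p) ^+ 2 + m ^+ 2) = (fun u => (u - p) * (u - p) + m ^+ 2).
    by apply/funext => v; rewrite expr2.
  by apply: is_derive_eq; rewrite /GRing.scale/= addr0; ring.
have d3 : is_derive u 1 (fun u : R => ((u - p) ^+ 2 + m ^+ 2)^-1) (- ((u - p) ^+ 2 + m ^+ 2) ^- 2 *: (2 * (u - p))).
  exact: (@is_deriveV _ (fun u : R => (u - p) ^+ 2 + m ^+ 2) u _ 1 (N0 u) d2).
split.
  apply: is_derive_eq; rewrite /GRing.scale/=; field; exact: N0.
apply: is_derive_eq; rewrite /GRing.scale/=; field; exact: N0.
Qed.

Definition res U c y : R[i] := ((U y)%:C - c)^-1.

Lemma res_neq0 (U : R -> R) c y : Im c != 0 -> (U y)%:C - c != 0.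
Proof.
move=> c0; apply/negP => /eqP E; have := congr1 (@complex.Im R) E.
by rewrite cImD cImN cImC sub0r /= => /eqP; rewrite oppr_eq0 (negPf c0).
Qed.

Lemma cac_res U g c : Im c != 0 ->
  {within Rp, continuous U} -> {within Rp, continuous g} ->
  (forall x, 0 < x -> is_derive x 1 U (g x)) ->
  cac (res U c) (fun y => - ((g y)%:C * res U c y ^+ 2)).
Proof.
move=> m0 cU cg dU; set p := Re c; set m := Im c.
have N0 v : (v - p) ^+ 2 + m ^+ 2 != 0.
  by rewrite gt_eqF// ltr_wpDl ?sqr_ge0// exprn_even_gt0.
have cN : continuous (fun v : R => (v - p) ^+ 2 + m ^+ 2).
  move=> v; apply: cvgD; last exact: cvg_cst.
  have : (fun v : R => (v - p) * (v - p)) @ v --> (v - p) * (v - p).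
    by apply: cvgM; apply: cvgB => //; exact: cvg_cst.
  by rewrite expr2; under [X in _ -> X @ _ --> _]eq_fun do rewrite expr2.
have cN2 : continuous (fun v : R => (((v - p) ^+ 2 + m ^+ 2) ^+ 2)^-1).
  move=> v; apply: cvgV; first by rewrite expf_neq0.
  rewrite expr2; under [X in X @ _ --> _]eq_fun do rewrite expr2.
  by apply: cvgM; exact: cN.
have c2 : continuous (fun v : R => v - p).
  by move=> v; apply: cvgB => //; exact: cvg_cst.
have rE y : Re (res U c y) = (U y - p) / ((U y - p) ^+ 2 + m ^+ 2).
  by rewrite /res cReV /sqn !reimE sub0r sqrrN.
have iE y : Im (res U c y) = m / ((U y - p) ^+ 2 + m ^+ 2).
  by rewrite /res cImV /sqn !reimE sub0r sqrrN mulNr opprK.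
split.
  have := ac_comp_C1 (fun u => proj1 (is_derive_res p u m0)) _ cU cg dU.
  move=> H; apply: eq_ac (H _) => [x _|x _|]; first by rewrite rE.
    rewrite expr2 !reimE rE iE -/m; move: (U x) (g x) (N0 (U x)) => u v N.
    by field; rewrite N.
  move=> v; apply: cvgM; last exact: cN2.
  apply: cvgB; first exact: cvg_cst.
  by rewrite expr2; under [X in X @ _ --> _]eq_fun do rewrite expr2; apply: cvgM; exact: c2.
have := ac_comp_C1 (fun u => proj2 (is_derive_res p u m0)) _ cU cg dU.
move=> H; apply: eq_ac (H _) => [x _|x _|]; first by rewrite iE.
  rewrite expr2 !reimE rE iE -/m; move: (U x) (g x) (N0 (U x)) => u v N.
  by field; rewrite N.
move=> v; apply: cvgM; last exact: cN2.
by apply: cvgN; apply: cvgM; [exact: cvg_cst|exact: c2].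
Qed.

(** The form in which the shear flow enters the estimates: absolutely continuous data with a single
    bound [M], exponential decay of the second derivative, and the differentiation rule for 1 / (U -
    c) off the real axis. *)
Definition flow (U U1 U2 : R -> R) M eta := [/\
  [/\ ac U U1, ac U1 U2 & measurable_fun Rp U2], 0 < M, 0 < eta,
  forall y, 0 <= y -> [/\ `|U y| <= M, `|U1 y| <= M & `|U2 y| <= M * expR (- eta * y)]
  & forall c, Im c != 0 -> cac (res U c) (fun y => - ((U1 y)%:C * res U c y ^+ 2))].

Lemma shear_flow_flow U : shear_flow U ->
  exists M eta, flow U (halfline_derivn 1 U) (halfline_derivn 2 U) M eta.
Proof.
move=> [sU [M0 bU] _ _ [eta eta0 dec]].
have [C1 C10 H1] := dec 1 isT; have [C2 C20 H2] := dec 2 isT.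
have c k : {within Rp, continuous (halfline_derivn k U : R -> R)} := @halfline_smooth_within U k sU.
have d k x (x0 : 0 < x) := halfline_smooth_is_derive k sU x0.
exists (`|M0| + C1 + C2), eta; split=> //.
- split; [exact: ac_C1 (c 0) (c 1) (d 0)|exact: ac_C1 (c 1) (c 2) (d 1)|].
  exact: within_halfline_measurable.
- by rewrite ltr_wpDr ?ltW// ltr_wpDl.
- move=> y y0; have e1 : expR (- eta * y) <= 1.
    by rewrite -expR0 ler_expR mulNr oppr_le0 mulr_ge0// ltW.
  have e0 := expR_ge0 (- eta * y).
  have n0 := normr_ge0 M0; have n1 := ler_norm M0.
  split.
  + by apply: le_trans (bU y y0) _; lra.
  + by apply: le_trans (H1 y y0) _; nra.
  + by apply: le_trans (H2 y y0) _; rewrite ler_wpM2r//; lra.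
- by move=> z z0; exact: cac_res (c 0) (c 1) (d 0).
Qed.
End ShearFlow.

(** * The Orr-Sommerfeld form *)

Section Forms.
Variable R : realType.
Notation mu := (@lebesgue_measure R).
Notation ri D f := (mu.-integrable D (EFin \o f)).
Notation Rp := (@halfline R).
Notation Re := (@complex.Re R).
Notation Im := (@complex.Im R).
Implicit Types (f g : R -> R) (F G H : R -> R[i]) (x y b : R) (z c : R[i]) (D E : set R).

Lemma L2Zl c F : L2 F -> L2 (fun x => c * F x).
Proof. by move=> h; case: (L2Z c h). Qed.

Lemma L2_mulb B P F : 0 <= B -> cmeas Rp P -> (forall y, 0 <= y -> normc (P y) <= B) -> L2 F ->
  L2 (fun y => P y * F y) /\ nn (fun y => P y * F y) <= B * nn F.
Proof.
move=> B0 mP bP hF; apply: L2_le => //; first by apply: cmeasM => //; exact: L2_meas.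
by move=> x x0; rewrite normcM ler_wpM2r ?normc_ge0// bP.
Qed.

Lemma cint_opp F G H : ci Rp F -> ci Rp G ->
  (forall y, 0 <= y -> F y + G y = H y) -> cint Rp H = 0 -> cint Rp F = - cint Rp G.
Proof.
move=> iF iG E E0; apply/eqP; rewrite -addr_eq0 -cintD//.
by rewrite (eq_cint (G := H)) ?E0// => y /halfline_ge0; exact: E.
Qed.

Definition H1 F0 F1 := [/\ cac F0 F1, L2 F0 & L2 F1].

Lemma H2_H1 F0 F1 F2 : H2 F0 F1 F2 -> H1 F0 F1.
Proof. by move=> [h _ []]. Qed.

Lemma H2_H1' F0 F1 F2 : H2 F0 F1 F2 -> H1 F1 F2.
Proof. by move=> [_ h []]. Qed.

Lemma H1_parts F F1 G G1 : H1 F F1 -> H1 G G1 ->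
  cint Rp (fun y => F1 y * G y) + cint Rp (fun y => F y * G1 y) = - (F 0 * G 0).
Proof. by move=> [? ? ?] [? ? ?]; exact: cint_by_parts. Qed.

Variables (U U1 U2 : R -> R) (M eta a : R).
Hypotheses (hU : flow U U1 U2 M eta) (a0 : 0 < a).

Definition sh c y : R[i] := (U y)%:C - c.

Lemma cac_sh c : cac (sh c) (fun y => (U1 y)%:C).
Proof.
have [[h _ _] _ _ _ _] := hU.
apply: eq_cac (cacB (cacC h) (cac_cst c)) => y _ //.
by rewrite subr0.
Qed.

Lemma cac_U1 : cac (fun y => (U1 y)%:C) (fun y => (U2 y)%:C).
Proof. by have [[_ h _] _ _ _ _] := hU; exact: cacC. Qed.

Let M0 : 0 <= M. Proof. by have [_ /ltW] := hU. Qed.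

Lemma normc_sh c y : 0 <= y -> normc (sh c y) <= M + normc c.
Proof.
move=> y0; rewrite /sh (le_trans (le_normcD _ _))// normcN lerD// normcR.
by have [_ _ _ /(_ y y0)[]] := hU.
Qed.

Lemma normc_U1 y : 0 <= y -> normc (U1 y)%:C <= M.
Proof. by move=> y0; rewrite normcR; have [_ _ _ /(_ y y0)[]] := hU. Qed.

Lemma normc_U2 y : 0 <= y -> normc (U2 y)%:C <= M * expR (- eta * y).
Proof. by move=> y0; rewrite normcR; have [_ _ _ /(_ y y0)[]] := hU. Qed.

Lemma normc_U2' y : 0 <= y -> normc (U2 y)%:C <= M.
Proof.
move=> y0; apply: le_trans (normc_U2 y0) _; have [_ _ e0 _ _] := hU.
by rewrite -[leRHS]mulr1 ler_wpM2l// -expR0 ler_expR mulNr oppr_le0 mulr_ge0// ltW.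
Qed.

Lemma cmeas_U2 : cmeas Rp (fun y => (U2 y)%:C).
Proof. by have [[_ _ h] _ _ _ _] := hU; split => //; exact: measurable_cst. Qed.

Lemma L2sh c F : L2 F ->
  L2 (fun y => sh c y * F y) /\ nn (fun y => sh c y * F y) <= (M + normc c) * nn F.
Proof.
apply: L2_mulb; [by rewrite addr_ge0 ?normc_ge0|exact: cac_meas (cac_sh c)|].
by move=> y; exact: normc_sh.
Qed.

Lemma L2U1 F : L2 F ->
  L2 (fun y => (U1 y)%:C * F y) /\ nn (fun y => (U1 y)%:C * F y) <= M * nn F.
Proof. apply: L2_mulb => //; [exact: cac_meas cac_U1|exact: normc_U1]. Qed.

Lemma L2U2 F : L2 F ->
  L2 (fun y => (U2 y)%:C * F y) /\ nn (fun y => (U2 y)%:C * F y) <= M * nn F.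
Proof. apply: L2_mulb => //; [exact: cmeas_U2|exact: normc_U2']. Qed.

Let Lsh c F : L2 F -> L2 (fun y => sh c y * F y). Proof. by case/(L2sh c). Qed.
Let LU1 F : L2 F -> L2 (fun y => (U1 y)%:C * F y). Proof. by case/L2U1. Qed.
Let LU2 F : L2 F -> L2 (fun y => (U2 y)%:C * F y). Proof. by case/L2U2. Qed.

(** Recursion on the shape of the function. Products with [sh], [U1] and [U2] are tried before
    products with a constant, whose pattern would match any product. *)
Ltac l2 := lazymatch goal with
  | |- L2 (fun y => _ + _) => apply: L2D; l2
  | |- L2 (fun y => - _) => apply: L2N; l2
  | |- L2 (fun y => sh _ y * _) => apply: Lsh; l2
  | |- L2 (fun y => (U1 y)%:C * _) => apply: LU1; l2
  | |- L2 (fun y => (U2 y)%:C * _) => apply: LU2; l2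
  | |- L2 (fun y => (_ y)^*) => apply: L2J; l2
  | |- L2 (fun y => _ * _) => apply: L2Zl; l2
  | |- _ => eassumption
  end.
Ltac l2ci := apply: L2_ciM; l2.

Local Notation aC := (a%:C).

(* The inviscid part of the pairing with G, integrated by parts so that only first
   derivatives occur; see bformE_r and bformE_l. *)
Definition bform c F0 F1 G0 G1 : R[i] := - cint Rp (fun y =>
  (sh c y * F1 y) * G1 y + ((U1 y)%:C * F1 y) * G0 y +
  (aC ^+ 2 * (sh c y * F0 y) + (U2 y)%:C * F0 y) * G0 y).

Lemma bform_ci c F0 F1 G0 G1 : L2 F0 -> L2 F1 -> L2 G0 -> L2 G1 ->
  ci Rp (fun y => (sh c y * F1 y) * G1 y + ((U1 y)%:C * F1 y) * G0 y +
  (aC ^+ 2 * (sh c y * F0 y) + (U2 y)%:C * F0 y) * G0 y).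
Proof. by move=> *; apply: ciD => //; [apply: ciD => //|]; l2ci. Qed.

Lemma bformE_r c F0 F1 F2 G0 G1 : H2 F0 F1 F2 -> H1 G0 G1 -> G0 0 = 0 ->
  cint Rp (fun y => (sh c y * (F2 y - aC ^+ 2 * F0 y) - (U2 y)%:C * F0 y) * G0 y)
  = bform c F0 F1 G0 G1.
Proof.
move=> [h0 h1 [L0 L1 L2']] [k0 K0 K1] G00; rewrite /bform.
have hP : H1 (fun y => sh c y * G0 y) (fun y => (U1 y)%:C * G0 y + sh c y * G1 y).
  by split; [exact: cacM (cac_sh c) k0|l2..].
have [_ LP LP1] := hP.
have := H1_parts hP (And3 h1 L1 L2'); rewrite G00 mulr0 mul0r oppr0 -cintD//; [|l2ci..].
apply: cint_opp; [l2ci|exact: bform_ci|] => y _.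
by move: (sh c y) (F0 y) (F1 y) (F2 y) (G0 y) (G1 y) (U1 y)%:C (U2 y)%:C aC => *; ring.
Qed.

(** The integrand holds the transposed Rayleigh operator Delta ((U - c) G) - U'' G, in which U''
    cancels and 2 U' G' remains. One integration by parts treats the second derivative, another
    trades one copy of U' G' F for the U'' term; [F0 0 = 0] removes both boundary terms. *)
Lemma bformE_l c F0 F1 G0 G1 G2 : H1 F0 F1 -> H2 G0 G1 G2 -> F0 0 = 0 ->
  cint Rp (fun y => (sh c y * (G2 y - aC ^+ 2 * G0 y) + 2 * ((U1 y)%:C * G1 y)) * F0 y)
  = bform c F0 F1 G0 G1.
Proof.
move=> [k0 K0 K1] [h0 h1 [L0 L1 L2']] F00; rewrite /bform.
have hP : H1 (fun y => sh c y * F0 y) (fun y => (U1 y)%:C * F0 y + sh c y * F1 y).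
  by split; [exact: cacM (cac_sh c) k0|l2..].
have hQ : H1 (fun y => (U1 y)%:C * F0 y) (fun y => (U2 y)%:C * F0 y + (U1 y)%:C * F1 y).
  by split; [exact: cacM cac_U1 k0|l2..].
have E1 := H1_parts hP (And3 h1 L1 L2'); rewrite F00 mulr0 mul0r oppr0 in E1.
have E2 := H1_parts hQ (And3 h0 L0 L1); rewrite F00 mulr0 mul0r oppr0 in E2.
have [_ LP LP1] := hP; have [_ LQ LQ1] := hQ.
rewrite -cintD// in E1; [|l2ci..]; rewrite -cintD// in E2; [|l2ci..].
have := congr2 (fun z t => z + t) E1 E2; rewrite addr0 -cintD//; [|apply: ciD => //; l2ci..].
apply: cint_opp; [l2ci|exact: bform_ci|] => y _.
by move: (sh c y) (F0 y) (F1 y) (G0 y) (G1 y) (G2 y) (U1 y)%:C (U2 y)%:C aC => *; ring.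
Qed.

Lemma bform_le c F0 F1 G0 G1 : L2 F0 -> L2 F1 -> L2 G0 -> L2 G1 ->
  normc (bform c F0 F1 G0 G1) <= (1 + a ^+ 2) * (3 * M + normc c) * (nn F0 + nn F1) * (nn G0 + nn G1).
Proof.
move=> F0L F1L G0L G1L; rewrite /bform normcN.
have w0 : 0 <= normc c := normc_ge0 c.
rewrite cintD//; [|apply: ciD => //; l2ci|l2ci].
rewrite cintD//; [|l2ci|l2ci].
have b1 : normc (cint Rp (fun y => sh c y * F1 y * G1 y)) <= (M + normc c) * nn F1 * nn G1.
  apply: le_trans (cauchy_schwarz _ _) _; [l2..|].
  by rewrite ler_wpM2r ?nn_ge0//; case: (L2sh c F1L).
have b2 : normc (cint Rp (fun y => (U1 y)%:C * F1 y * G0 y)) <= M * nn F1 * nn G0.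
  apply: le_trans (cauchy_schwarz _ _) _; [l2..|].
  by rewrite ler_wpM2r ?nn_ge0//; case: (L2U1 F1L).
have b3 : normc (cint Rp (fun y => (aC ^+ 2 * (sh c y * F0 y) + (U2 y)%:C * F0 y) * G0 y))
   <= (a ^+ 2 * (M + normc c) + M) * nn F0 * nn G0.
  apply: le_trans (cauchy_schwarz _ _) _; [l2..|].
  rewrite ler_wpM2r ?nn_ge0//; apply: le_trans (nnD _ _) _; [l2..|].
  have [l1 n1] := L2sh c F0L; have [_ n2] := L2U2 F0L.
  have [_ ->] := L2Z (aC ^+ 2) l1.
  have -> : normc (aC ^+ 2) = a ^+ 2 by rewrite -rmorphXn normcR ger0_norm// sqr_ge0.
  by rewrite mulrDl lerD// -mulrA ler_wpM2l// sqr_ge0.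
apply: le_trans (le_normcD _ _) _; apply: le_trans (lerD (le_normcD _ _) b3) _.
have := nn_ge0 F0; have := nn_ge0 F1; have := nn_ge0 G0; have := nn_ge0 G1.
move: b1 b2; move: (normc (cint _ _)) (normc (cint _ _)) (nn F0) (nn F1) (nn G0) (nn G1) w0.
move: (normc c) => w p q f0 f1 g0 g1 w0 b1 b2 g10 g00 f10 f00.
have A0 : 0 <= a ^+ 2 by exact: sqr_ge0.
move: (a ^+ 2) A0 => A A0.
apply: le_trans (lerD (lerD b1 b2) (lexx _)) _.
rewrite -subr_ge0.
have -> : (1 + A) * (3 * M + w) * (f0 + f1) * (g0 + g1) -
   ((M + w) * f1 * g1 + M * f1 * g0 + (A * (M + w) + M) * f0 * g0) =
   2 * M * (f1 * g1) + (2 * M + w) * (f1 * g0) + (2 * M + w + 2 * M * A) * (f0 * g0) +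
   (3 * M + w) * (f0 * g1) + A * (3 * M + w) * (f0 * g1 + f1 * g0 + f1 * g1) by ring.
by rewrite !addr_ge0// ?mulr_ge0// ?addr_ge0// ?mulr_ge0.
Qed.

Lemma bform_shiftE c c0 F0 F1 G0 G1 : L2 F0 -> L2 F1 -> L2 G0 -> L2 G1 ->
  bform c F0 F1 G0 G1 = bform c0 F0 F1 G0 G1 +
    (c - c0) * (cint Rp (fun y => F1 y * G1 y) + aC ^+ 2 * cint Rp (fun y => F0 y * G0 y)).
Proof.
move=> F0L F1L G0L G1L; apply/eqP; rewrite addrC -subr_eq; apply/eqP.
have i1 : ci Rp (fun y => F1 y * G1 y) by l2ci.
have i2 : ci Rp (fun y => F0 y * G0 y) by l2ci.
rewrite -cintZ// -cintD//; last exact: ciZ.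
rewrite -cintZ//; last by apply: ciD => //; exact: ciZ.
rewrite /bform opprK addrC -cintB//; [|exact: bform_ci..].
apply: eq_cint => y _; rewrite /sh.
by move: (U y)%:C (F0 y) (F1 y) (G0 y) (G1 y) (U1 y)%:C (U2 y)%:C aC => *; ring.
Qed.

Lemma bform_shift c c0 F0 F1 G0 G1 : L2 F0 -> L2 F1 -> L2 G0 -> L2 G1 ->
  normc (bform c F0 F1 G0 G1 - bform c0 F0 F1 G0 G1) <=
  normc (c - c0) * ((1 + a ^+ 2) * (nn F0 + nn F1) * (nn G0 + nn G1)).
Proof.
move=> F0L F1L G0L G1L.
rewrite (bform_shiftE c c0)// addrC addKr.
rewrite normcM ler_wpM2l ?normc_ge0//.
apply: le_trans (le_normcD _ _) _; rewrite normcM.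
have -> : normc (aC ^+ 2) = a ^+ 2 by rewrite -rmorphXn normcR ger0_norm// sqr_ge0.
have A0 : 0 <= a ^+ 2 by exact: sqr_ge0.
have c1 := cauchy_schwarz F1L G1L; have c2 := cauchy_schwarz F0L G0L.
apply: le_trans (lerD c1 (ler_wpM2l A0 c2)) _.
have := nn_ge0 F0; have := nn_ge0 F1; have := nn_ge0 G0; have := nn_ge0 G1.
move: (nn F0) (nn F1) (nn G0) (nn G1) (a ^+ 2) A0 => f0 f1 g0 g1 A A0 g10 g00 f10 f00.
rewrite -subr_ge0.
have -> : (1 + A) * (f0 + f1) * (g0 + g1) - (f1 * g1 + A * (f0 * g0)) =
   f0 * g0 + f0 * g1 + f1 * g0 + A * (f0 * g1 + f1 * g0 + f1 * g1) by ring.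
by rewrite !addr_ge0// ?mulr_ge0// ?addr_ge0// ?mulr_ge0.
Qed.
Lemma H2J F0 F1 F2 : H2 F0 F1 F2 ->
  H2 (fun y => (F0 y)^*) (fun y => (F1 y)^*) (fun y => (F2 y)^*).
Proof. by move=> [h0 h1 [? ? ?]]; split; [exact: cacJ|exact: cacJ|split; l2]. Qed.

Lemma H2_lap F0 F1 F2 F3 F4 : H2 F0 F1 F2 -> H2 F2 F3 F4 ->
  H2 (fun y => F2 y - aC ^+ 2 * F0 y) (fun y => F3 y - aC ^+ 2 * F1 y) (fun y => F4 y - aC ^+ 2 * F2 y).
Proof.
move=> [h0 h1 [? ? ?]] [k0 k1 [? ? ?]].
by split; [apply: cacB => //; exact: cacZ|apply: cacB => //; exact: cacZ|split; l2].
Qed.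

Lemma normc_aC2 : normc (aC ^+ 2) = a ^+ 2.
Proof. by rewrite -rmorphXn normcR ger0_norm// sqr_ge0. Qed.

Lemma trace_le F0 F1 : H1 F0 F1 -> normc (F0 0) <= nn F0 + nn F1.
Proof.
move=> [h L0 L1].
have hJ : H1 (fun y => (F0 y)^*) (fun y => (F1 y)^*) by split; [exact: cacJ|l2|l2].
have E := H1_parts (And3 h L0 L1) hJ; have [_ J0 J1] := hJ.
rewrite -(@ler_pXn2r _ 2)// ?nnegrE ?addr_ge0 ?nn_ge0 ?normc_ge0//.
have -> : normc (F0 0) ^+ 2 = normc (F0 0 * (F0 0)^*) by rewrite normcM normc_conjc expr2.
rewrite -normcN -E.
apply: le_trans (le_normcD _ _) _.
have c1 := cauchy_schwarz L1 J0; have c2 := cauchy_schwarz L0 J1.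
apply: le_trans (lerD c1 c2) _; rewrite !nnJ.
by have := sqr_ge0 (nn F0); have := sqr_ge0 (nn F1); nra.
Qed.

(** * The viscous form, its boundary term and duality *)

Definition dform F0 F2 G0 G2 : R[i] :=
  cint Rp (fun y => (F2 y - aC ^+ 2 * F0 y) * (G2 y - aC ^+ 2 * G0 y)).

Lemma dform_le F0 F2 G0 G2 : L2 F0 -> L2 F2 -> L2 G0 -> L2 G2 ->
  normc (dform F0 F2 G0 G2) <= nn (fun y => F2 y - aC ^+ 2 * F0 y) * (nn G2 + a ^+ 2 * nn G0).
Proof.
move=> ? ? LG0 ?; apply: le_trans (cauchy_schwarz _ _) _; [l2..|].
rewrite ler_wpM2l ?nn_ge0//; apply: le_trans (nnD _ _) _; [l2..|].
by rewrite nnN lerD2l; have [_ ->] := L2Z (aC ^+ 2) LG0; rewrite normc_aC2.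
Qed.

(** Two integrations by parts move one Laplacian onto G. Both functions vanish at 0, so the
    Laplacian of F there is [F2 0] and the only surviving boundary term is [F2 0 * G1 0]. *)
Lemma visc_pair F0 F1 F2 F3 F4 G0 G1 G2 : H2 F0 F1 F2 -> H2 F2 F3 F4 -> H2 G0 G1 G2 ->
  F0 0 = 0 -> G0 0 = 0 ->
  cint Rp (fun y => (F4 y - aC ^+ 2 * F2 y - aC ^+ 2 * (F2 y - aC ^+ 2 * F0 y)) * G0 y) =
  dform F0 F2 G0 G2 + F2 0 * G1 0.
Proof.
move=> hF hF2 hG F00 G00.
have hP := H2_lap hF hF2; set P0 := fun y => F2 y - _ in hP; set P1 := fun y => F3 y - _ in hP.
set P2 := fun y => F4 y - _ in hP.
have E1 := H1_parts (H2_H1' hP) (H2_H1 hG); rewrite G00 mulr0 oppr0 in E1.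
have E2 := H1_parts (H2_H1 hP) (H2_H1' hG).
have P00 : P0 0 = F2 0 by rewrite /P0 F00 mulr0 subr0.
have [_ _ [LP0 LP1 LP2]] := hP; have [_ _ [LG0 LG1 LG2]] := hG.
have -> : dform F0 F2 G0 G2 = cint Rp (fun y => P0 y * G2 y) - aC ^+ 2 * cint Rp (fun y => P0 y * G0 y).
  rewrite -cintZ//; last l2ci.
  rewrite -cintB//; [|l2ci|by apply: ciZ => //; l2ci].
  by apply: eq_cint => y _; rewrite /P0; move: (F0 y) (F2 y) (G0 y) (G2 y) aC => *; ring.
have -> : cint Rp (fun y => (F4 y - aC ^+ 2 * F2 y - aC ^+ 2 * (F2 y - aC ^+ 2 * F0 y)) * G0 y) =
   cint Rp (fun y => P2 y * G0 y) - aC ^+ 2 * cint Rp (fun y => P0 y * G0 y).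
  rewrite -cintZ//; last l2ci.
  rewrite -cintB//; [|l2ci|by apply: ciZ => //; l2ci].
  by apply: eq_cint => y _; rewrite /P0 /P2; move: (F0 y) (F2 y) (F4 y) (G0 y) aC => *; ring.
rewrite -P00; set s := cint Rp (fun y => P0 y * G0 y).
move: E1 E2; set p := cint Rp (fun y => P2 y * G0 y); set q := cint Rp (fun y => P1 y * G1 y).
set r := cint Rp (fun y => P0 y * G2 y) => E1 E2.
have -> : p = - q by apply/eqP; rewrite -addr_eq0 E1.
have -> : q = - (P0 0 * G1 0) - r by rewrite -E2 addrK.
by move: {E1 E2} r s; move: (P0 0) (G1 0) aC => *; ring.
Qed.

Definition orr c k F0 F2 F4 y : R[i] :=
  sh c y * (F2 y - aC ^+ 2 * F0 y) - (U2 y)%:C * F0 y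
  + k * (F4 y - aC ^+ 2 * F2 y - aC ^+ 2 * (F2 y - aC ^+ 2 * F0 y)).

(* orrT applied to K is the conjugate of the adjoint operator applied to conj K. *)
Definition orrT c k F0 F1 F2 F4 y : R[i] :=
  sh c y * (F2 y - aC ^+ 2 * F0 y) + 2 * ((U1 y)%:C * F1 y)
  + k * (F4 y - aC ^+ 2 * F2 y - aC ^+ 2 * (F2 y - aC ^+ 2 * F0 y)).

Lemma orr_L2 c k F0 F1 F2 F3 F4 : H2 F0 F1 F2 -> H2 F2 F3 F4 -> L2 (orr c k F0 F2 F4).
Proof. by move=> [_ _ [? ? ?]] [_ _ [? ? ?]]; rewrite /orr; l2. Qed.

Lemma orrT_L2 c k F0 F1 F2 F3 F4 : H2 F0 F1 F2 -> H2 F2 F3 F4 -> L2 (orrT c k F0 F1 F2 F4).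
Proof. by move=> [_ _ [? ? ?]] [_ _ [? ? ?]]; rewrite /orrT; l2. Qed.

Lemma orr_pair c k F0 F1 F2 F3 F4 G0 G1 G2 : H2 F0 F1 F2 -> H2 F2 F3 F4 -> H2 G0 G1 G2 ->
  F0 0 = 0 -> G0 0 = 0 ->
  cint Rp (fun y => orr c k F0 F2 F4 y * G0 y) =
  bform c F0 F1 G0 G1 + k * (dform F0 F2 G0 G2 + F2 0 * G1 0).
Proof.
move=> hF hF2 hG F00 G00; rewrite -(visc_pair hF hF2 hG F00 G00) -(bformE_r c hF (H2_H1 hG) G00).
have [_ _ [? ? ?]] := hF; have [_ _ [? ? ?]] := hF2; have [_ _ [? ? ?]] := hG.
rewrite -cintZ//; last l2ci.
rewrite -cintD//; [|l2ci|by apply: ciZ => //; l2ci].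
apply: eq_cint => y _; rewrite /orr; move: (sh c y) (F0 y) (F2 y) (F4 y) (G0 y) (U2 y)%:C aC => *; ring.
Qed.

Lemma orrT_pair c k F0 F1 F2 F3 F4 G0 G1 G2 : H2 F0 F1 F2 -> H2 F2 F3 F4 -> H2 G0 G1 G2 ->
  F0 0 = 0 -> G0 0 = 0 ->
  cint Rp (fun y => orrT c k F0 F1 F2 F4 y * G0 y) =
  bform c G0 G1 F0 F1 + k * (dform F0 F2 G0 G2 + F2 0 * G1 0).
Proof.
move=> hF hF2 hG F00 G00; rewrite -(visc_pair hF hF2 hG F00 G00) -(bformE_l c (H2_H1 hG) hF G00).
have [_ _ [? ? ?]] := hF; have [_ _ [? ? ?]] := hF2; have [_ _ [? ? ?]] := hG.
rewrite -cintZ//; last l2ci.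
rewrite -cintD//; [|l2ci|by apply: ciZ => //; l2ci].
apply: eq_cint => y _; rewrite /orrT; move: (sh c y) (F0 y) (F1 y) (F2 y) (F4 y) (G0 y) (U1 y)%:C aC => *; ring.
Qed.

(** Under a common slip condition the boundary term becomes t F''(0) G''(0), symmetric in the two
    functions, like [dform]. The domain is therefore its own transpose. *)
Lemma orr_duality c k (t : R[i]) F0 F1 F2 F3 F4 G0 G1 G2 G3 G4 :
  H2 F0 F1 F2 -> H2 F2 F3 F4 -> H2 G0 G1 G2 -> H2 G2 G3 G4 ->
  F0 0 = 0 -> G0 0 = 0 -> F1 0 = t * F2 0 -> G1 0 = t * G2 0 ->
  cint Rp (fun y => orr c k F0 F2 F4 y * G0 y) = cint Rp (fun y => orrT c k G0 G1 G2 G4 y * F0 y).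
Proof.
move=> hF hF2 hG hG2 F00 G00 F10 G10.
rewrite (orr_pair c k hF hF2 hG)// (orrT_pair c k hG hG2 hF)//; congr (_ + k * (_ + _)).
  by apply: eq_cint => y _; rewrite mulrC.
by rewrite F10 G10 mulrCA [G2 0 * _]mulrCA [F2 0 * _]mulrC.
Qed.
(** Integrating the derivative - 2 k E^2 of the square of the exponential E from 0 to infinity gives
    -1. *)
Lemma nn_ex_sqr (k : R) : 0 < k -> nn (ex (- k)) ^+ 2 = (2 * k)^-1.
Proof.
move=> k0; have Le := L2_ex k0; have kn : 2 * k != 0 by rewrite mulf_neq0// gt_eqF.
have h : H1 (ex (- k) : R -> R[i]) (fun y => (- k)%:C * ex (- k) y).
  by split; [exact: cac_ex|exact: Le|exact: L2Zl].
have e0 : ex (- k) 0 = 1 :> R[i] by rewrite /ex mulr0 expR0.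
have eJ y : (ex (- k) y : R[i]) = (ex (- k) y)^*%C by rewrite /ex conjc_real.
have ii : ci Rp (fun y => ex (- k) y * (ex (- k) y)^*%C) by apply: L2_ciM; [|apply: L2J].
have := H1_parts h h; rewrite e0 mulr1 (eq_cint (G := fun y => (- k)%:C * (ex (- k) y * (ex (- k) y)^*%C))); last first.
  by move=> y _; rewrite -eJ mulrA.
rewrite [X in _ + X](eq_cint (G := fun y => (- k)%:C * (ex (- k) y * (ex (- k) y)^*%C))); last first.
  by move=> y _; rewrite -eJ mulrCA.
rewrite !cintZ// cint_sqn nn_sqr -!rmorphM -rmorphD => /(congr1 (@complex.Re R)) /=.
move: (n2 _) => n E; apply: (mulfI kn); rewrite mulfV//.
by move: E; rewrite !mulNr => E; lra.
Qed.

(** The witness is s^2 (exp(- k y) - exp(- 2 k y)) with k = s^-2: the difference vanishes at 0 and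
    has slope s^2 k = 1 there. Each exponential has norm at most s, so the constants 2, 3 and 5 are
    sums of absolute values of coefficients. *)
Lemma boundary_layer (s : R) : 0 < s -> exists G0 G1 G2,
  [/\ H2 G0 G1 G2, G0 0 = 0, G1 0 = 1 &
   [/\ nn G0 <= 2 * s ^+ 3, nn G1 <= 3 * s & nn G2 <= 5 / s]].
Proof.
move=> s0; pose k := (s ^+ 2)^-1; have k0 : 0 < k by rewrite invr_gt0 exprn_gt0.
have sn : s != 0 by rewrite gt_eqF.
have sg : 0 <= s by exact: ltW.
have k20 : 0 < 2 * k by rewrite mulr_gt0.
have sk : s ^+ 2 * k = 1 by rewrite /k mulfV// expf_neq0.
have s20 : 0 <= s ^+ 2 by exact: sqr_ge0.
have b1 : nn (ex (- k)) <= s.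
  rewrite -(@ler_pXn2r _ 2)// ?nnegrE ?nn_ge0// nn_ex_sqr// invfM invrK.
  by lra.
have b2 : nn (ex (- (2 * k))) <= s.
  rewrite -(@ler_pXn2r _ 2)// ?nnegrE ?nn_ge0// nn_ex_sqr// !invfM invrK.
  by lra.
have Le1 := L2_ex k0; have Le2 := L2_ex k20.
have comb (p q : R) : nn (fun y => p%:C * ex (- k) y + q%:C * ex (- (2 * k)) y) <= (`|p| + `|q|) * s.
  apply: le_trans (nnD _ _) _; [l2..|].
  have [_ ->] := L2Z p%:C Le1; have [_ ->] := L2Z q%:C Le2.
  rewrite (normcR p) (normcR q) (mulrDl `|p|).
  move: b1 b2; move: (nn _) (nn _) => m n b1 b2.
  by apply: lerD; apply: ler_wpM2l.
have hE (j : R) : cac (fun y => ex (- j) y : R[i]) (fun y => (- j)%:C * ex (- j) y) by exact: cac_ex.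
exists (fun y => (s ^+ 2)%:C * ex (- k) y + (- s ^+ 2)%:C * ex (- (2 * k)) y),
  (fun y => (-1)%:C * ex (- k) y + 2%:C * ex (- (2 * k)) y),
  (fun y => k%:C * ex (- k) y + (- (4 * k))%:C * ex (- (2 * k)) y).
split.
- split; last by split; l2.
  + apply: eq_cac (cacD (cacZ (s ^+ 2)%:C (hE k)) (cacZ (- s ^+ 2)%:C (hE (2 * k)))) => y _ //.
    rewrite /ex -!rmorphM -!rmorphD; congr (_%:C).
    move: (expR _) (expR _) => p q.
    transitivity (- (s ^+ 2 * k) * q + 2 * (s ^+ 2 * k) * p); first by ring.
    by rewrite sk; ring.
  + apply: eq_cac (cacD (cacZ (-1)%:C (hE k)) (cacZ 2%:C (hE (2 * k)))) => y _ //.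
    rewrite /ex -!rmorphM -!rmorphD; congr (_%:C).
    by move: (expR _) (expR _) => p q; ring.
- by rewrite /ex !mulr0 expR0 !mulr1 -rmorphD subrr.
- by rewrite /ex !mulr0 expR0 !mulr1 -rmorphD; congr (_%:C); ring.
split.
- apply: le_trans (comb _ _) _; rewrite normrN ger0_norm//.
  by rewrite le_eqVlt; apply/orP; left; apply/eqP; ring.
- apply: le_trans (comb _ _) _; rewrite normrN1 normr_nat.
  by rewrite le_eqVlt; apply/orP; left; apply/eqP; ring.
- apply: le_trans (comb _ _) _; rewrite normrN !ger0_norm ?mulr_ge0 ?(ltW k0)//.
  by rewrite le_eqVlt; apply/orP; left; apply/eqP; rewrite /k; field.
Qed.
Lemma conjcMr x z : (x%:C * z)^*%C = x%:C * z^*%C.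
Proof. by case: z => p q; apply: complex_eq => /=; ring. Qed.

Lemma conjcB z w : (z - w)^*%C = z^*%C - w^*%C.
Proof. by case: z w => [p q] [r s]; apply: complex_eq => /=; ring. Qed.

Lemma aC2E : aC ^+ 2 = (a ^+ 2)%:C.
Proof. by rewrite rmorphXn. Qed.

(** [B] is kept abstract so that the mode may occupy either slot of [bform], covering direct and
    transposed modes at once. The slip length [t] enters the energy identity with a favourable sign,
    and the constant does not depend on it. *)
Lemma small_functional (m0 CB : R) : 0 < m0 -> 0 <= CB -> exists2 C : R, 0 <= C &
  forall (s t : R) (k : R[i]) (B : (R -> R[i]) -> (R -> R[i]) -> R[i]) F0 F1 F2 F3 F4,
  0 < s -> s <= 1 -> Re k = 0 -> Im k = s ^+ 4 -> 0 <= t ->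
  H2 F0 F1 F2 -> H2 F2 F3 F4 -> F0 0 = 0 -> F1 0 = t%:C * F2 0 ->
  (forall G0 G1 G2, H2 G0 G1 G2 -> G0 0 = 0 ->
     B G0 G1 + k * (dform F0 F2 G0 G2 + F2 0 * G1 0) = 0) ->
  (forall G0 G1, L2 G0 -> L2 G1 -> normc (B G0 G1) <= CB * (nn F0 + nn F1) * (nn G0 + nn G1)) ->
  m0 * nn F1 ^+ 2 - M * nn F1 * nn F0 <= Im (B (fun y => (F0 y)^*%C) (fun y => (F1 y)^*%C)) ->
  nn F1 <= C * nn F0 /\ forall G0 G1 G2, H2 G0 G1 G2 -> G0 0 = 0 ->
    normc (B G0 G1) <= C * s * nn F0 * (nn G0 + nn G1 + nn G2).
Proof.
(* [C1] bounds F' by absorption in the energy identity, [C2] bounds s^2 |Delta F|, with + 1 so that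
   M C1 <= C2^2 without a square root, and [C3] collects what the layer test function yields for s^4
   |F''(0)| after dividing by s |F|. *)
move=> m00 CB0; pose C1 := M / m0; pose C2 := M * C1 + 1.
pose C3 := 5 * (CB * (1 + C1)) + C2 * (5 + 2 * a ^+ 2).
have C10 : 0 <= C1 by rewrite divr_ge0// ltW.
have C20 : 0 <= C2 by rewrite addr_ge0// mulr_ge0.
have a20 : 0 <= a ^+ 2 := sqr_ge0 a.
have C30 : 0 <= C3 by rewrite /C3 addr_ge0// mulr_ge0// ?mulr_ge0// addr_ge0// mulr_ge0.
exists (C1 + (C2 * (1 + a ^+ 2) + C3)).
  by rewrite addr_ge0// addr_ge0// mulr_ge0// addr_ge0.
move=> s t k B F0 F1 F2 F3 F4 s0 s1 Rk Ik t0 hF hF2 F00 F10 weak bB eB.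
have nk : normc k = s ^+ 4.
  by case: k Rk Ik {weak} => p q /= -> ->; rewrite expr0n/= add0r sqrtr_sqr ger0_norm// exprn_ge0// ltW.
have [_ _ [LF0 LF1 LF2]] := hF.
pose D := fun y => F2 y - aC ^+ 2 * F0 y; have LD : L2 D by rewrite /D; l2.
have n00 := nn_ge0 F0; have n10 := nn_ge0 F1; have d0 := nn_ge0 D.
have sg := ltW s0.
(* Test with the conjugate of F0. *)
have energy : m0 * nn F1 ^+ 2 + (s ^+ 2 * nn D) ^+ 2 <= M * nn F1 * nn F0.
  have := weak _ _ _ (H2J hF); rewrite F00 conjc0 => /(_ erefl).
  have -> : dform F0 F2 (fun y => (F0 y)^*%C) (fun y => (F2 y)^*%C) = (nn D ^+ 2)%:C.
    rewrite nn_sqr -cint_sqn; apply: eq_cint => y _; rewrite /D; congr (_ * _).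
    by rewrite aC2E -conjcMr -conjcB.
  rewrite F10 conjcMr mulrCA mulJ -rmorphM -rmorphD.
  move/(congr1 (@complex.Im R)); rewrite cImD cImM Rk Ik mul0r /= => E.
  have tF : 0 <= t * sqn (F2 0) by rewrite mulr_ge0 ?sqn_ge0.
  have s4 : 0 <= s ^+ 4 by rewrite exprn_ge0.
  have := mulr_ge0 s4 tF; move: eB E; move: (Im (B _ _)) => u eB E sF.
  rewrite -subr_ge0; have -> : M * nn F1 * nn F0 - (m0 * nn F1 ^+ 2 + (s ^+ 2 * nn D) ^+ 2) =
    - (m0 * nn F1 ^+ 2 - M * nn F1 * nn F0) - s ^+ 4 * nn D ^+ 2 by ring.
  by rewrite ?add0r ?addr0 mulrDr in E; lra.
have n1 : nn F1 <= C1 * nn F0.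
  have [->|F1n] := eqVneq (nn F1) 0; first by rewrite mulr_ge0.
  have F1p : 0 < nn F1 by rewrite lt_def F1n.
  have H : m0 * nn F1 ^+ 2 <= M * nn F1 * nn F0.
    by apply: le_trans energy; rewrite lerDl sqr_ge0.
  rewrite -(ler_pM2l m00) -(ler_pM2r F1p).
  have -> : m0 * (C1 * nn F0) * nn F1 = M * nn F1 * nn F0 by rewrite /C1; field; rewrite gt_eqF.
  by rewrite -mulrA -expr2.
have dd : s ^+ 2 * nn D <= C2 * nn F0.
  rewrite -(@ler_pXn2r _ 2)// ?nnegrE ?mulr_ge0 ?sqr_ge0//.
  have H : (s ^+ 2 * nn D) ^+ 2 <= M * nn F1 * nn F0.
    by apply: le_trans energy; rewrite lerDr mulr_ge0 ?sqr_ge0// ltW.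
  apply: le_trans H _.
  apply: le_trans (_ : M * (C1 * nn F0) * nn F0 <= _).
    by rewrite ler_wpM2r// ler_wpM2l.
  have -> : M * (C1 * nn F0) * nn F0 = (M * C1) * nn F0 ^+ 2 by ring.
  rewrite exprMn ler_wpM2r ?sqr_ge0// /C2.
  have MC : 0 <= M * C1 by rewrite mulr_ge0.
  by move: (M * C1) MC => q q0; nra.
have dv G0 G1 G2 : H2 G0 G1 G2 ->
    s ^+ 4 * normc (dform F0 F2 G0 G2) <= s ^+ 2 * (C2 * nn F0) * (nn G2 + a ^+ 2 * nn G0).
  move=> [_ _ [? ? ?]].
  have H := dform_le LF0 LF2 (_ : L2 G0) (_ : L2 G2).
  apply: le_trans (ler_wpM2l (exprn_ge0 4 sg) (H _ _)) _ => //.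
  have -> : s ^+ 4 * (nn (fun y => F2 y - aC ^+ 2 * F0 y) * (nn G2 + a ^+ 2 * nn G0)) =
    s ^+ 2 * (s ^+ 2 * nn D) * (nn G2 + a ^+ 2 * nn G0) by rewrite /D; ring.
  apply: ler_wpM2r; first by rewrite addr_ge0 ?nn_ge0// mulr_ge0 ?nn_ge0.
  by rewrite ler_wpM2l ?sqr_ge0.
(* Test with a boundary layer of width s^2. *)
have bd : s ^+ 4 * normc (F2 0) <= C3 * s * nn F0.
  have [G0 [G1 [G2 [hG G00 G10 [nG0 nG1 nG2]]]]] := boundary_layer s0.
  have := weak _ _ _ hG G00; rewrite G10 mulr1 mulrDr addrA => /eqP.
  rewrite addr_eq0 => /eqP/(congr1 (@normc _)); rewrite normcN => E.
  rewrite -nk -normcM -E; apply: le_trans (le_normcD _ _) _.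
  rewrite normcM nk; have H1 := dv _ _ _ hG.
  have [_ _ [LG0 LG1 LG2]] := hG; have H2 := bB G0 G1 LG0 LG1.
  apply: le_trans (lerD H2 H1) _.
  have s3 : s ^+ 3 <= s by rewrite exprS ler_piMr// exprn_ile1.
  have nG0' : nn G0 <= 2 * s by apply: le_trans nG0 _; rewrite ler_pM2l.
  have q1 : CB * (nn F0 + nn F1) * (nn G0 + nn G1) <= CB * ((1 + C1) * nn F0) * (5 * s).
    rewrite ler_pM ?mulr_ge0 ?addr_ge0 ?nn_ge0//; first by rewrite ler_wpM2l// mulrDl mul1r lerD2l.
    by move: (lerD nG0' nG1); rewrite -mulrDl -natrD.
  have q2 : s ^+ 2 * (C2 * nn F0) * (nn G2 + a ^+ 2 * nn G0) <= s ^+ 2 * (C2 * nn F0) * (5 / s + a ^+ 2 * (2 / s)).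
    apply: ler_wpM2l; first by rewrite !mulr_ge0 ?sqr_ge0.
    apply: lerD => //; apply: ler_wpM2l => //; apply: le_trans nG0' _.
    by rewrite ler_wpM2l// (le_trans s1)// invf_ge1.
  apply: le_trans (lerD q1 q2) _; rewrite le_eqVlt; apply/orP; left; apply/eqP.
  by rewrite /C3; move: (nn F0) => n; field; rewrite gt_eqF.
split.
  apply: le_trans n1 _; rewrite ler_wpM2r// lerDl addr_ge0// mulr_ge0// addr_ge0//.
move=> G0 G1 G2 hG G00.
have := weak _ _ _ hG G00; rewrite mulrDr => /eqP.
rewrite addr_eq0 => /eqP ->; rewrite normcN; apply: le_trans (le_normcD _ _) _.
rewrite !normcM nk mulrA.
have tr := trace_le (H2_H1' hG).
have [_ _ [LG0 LG1 LG2]] := hG.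
have g0 := nn_ge0 G0; have g1 := nn_ge0 G1; have g2 := nn_ge0 G2.
have q2 : s ^+ 4 * normc (F2 0) * normc (G1 0) <= C3 * s * nn F0 * (nn G1 + nn G2).
  by apply: ler_pM => //; rewrite ?mulr_ge0 ?normc_ge0// exprn_ge0.
apply: le_trans (lerD (dv _ _ _ hG) q2) _.
move: (nn F0) (nn G0) (nn G1) (nn G2) (a ^+ 2) C1 C2 C3 s s1 sg n00 g0 g1 g2 a20 C10 C20 C30 {s0 Ik dv bd q2 nk energy n1 dd}.
move=> n f0 f1 f2 A c1 c2 c3 r r1 r0 n0 f00 f10 f20 A0 c10 c20 c30.
have r2 : r ^+ 2 <= r by rewrite expr2 ler_piMr.
apply: le_trans (_ : r * (c2 * n) * (f2 + A * f0) + c3 * r * n * (f1 + f2) <= _).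
  rewrite lerD2r; apply: ler_wpM2r; first by rewrite addr_ge0// mulr_ge0.
  by rewrite ler_wpM2r// mulr_ge0.
rewrite -subr_ge0.
have -> : (c1 + (c2 * (1 + A) + c3)) * r * n * (f0 + f1 + f2) - (r * (c2 * n) * (f2 + A * f0) + c3 * r * n * (f1 + f2)) =
  r * n * (c1 * (f0 + f1 + f2) + c2 * (f0 + f1) + c2 * A * (f1 + f2) + c3 * f0) by ring.
by rewrite !mulr_ge0// !addr_ge0// !mulr_ge0// !addr_ge0.
Qed.
(** After moving c to its real part, every coefficient is real, and the only term of the quadratic
    form with an imaginary part is the one with U'. The shift itself contributes Im c times the H^1
    norm, whose zeroth order part is nonnegative and dropped. *)
Lemma bform_energy c F0 F1 : 0 <= Im c -> L2 F0 -> L2 F1 ->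
  Im c * nn F1 ^+ 2 - M * nn F1 * nn F0 <= Im (bform c F0 F1 (fun y => (F0 y)^*%C) (fun y => (F1 y)^*%C)).
Proof.
move=> c0 L0 L1; have J0 := L2J L0; have J1 := L2J L1.
rewrite (bform_shiftE c (Re c)%:C)// !cint_sqn aC2E -!rmorphM -!rmorphD cImD.
have -> : Im ((c - (Re c)%:C) * (n2 F1 + a ^+ 2 * n2 F0)%:C) = Im c * (n2 F1 + a ^+ 2 * n2 F0).
  by rewrite cImM !reimE subr0 mulr0 add0r.
have E : Im (bform (Re c)%:C F0 F1 (fun y => (F0 y)^*%C) (fun y => (F1 y)^*%C)) =
    - Im (cint Rp (fun y => (U1 y)%:C * F1 y * (F0 y)^*%C)).
  rewrite /bform cImN; congr (- _); rewrite !Im_cint; apply: eq_Rint => y _.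
  have -> : sh (Re c)%:C y = (U y - Re c)%:C by rewrite /sh -rmorphB.
  rewrite -[(U y - Re c)%:C * F1 y * _]mulrA mulJ aC2E.
  have K (p q r : R) (z w : R[i]) : (p%:C * (q%:C * z) + r%:C * z) * w = (p * q + r)%:C * (z * w).
    by apply: complex_eq; rewrite !reimE; ring.
  rewrite K.
  by rewrite mulJ -!rmorphM 2!cImD !cImC add0r addr0.
rewrite E -!nn_sqr.
have B1 : Im (cint Rp (fun y => (U1 y)%:C * F1 y * (F0 y)^*%C)) <= M * nn F1 * nn F0.
  apply: le_trans (ler_norm _) _; apply: le_trans (Im_le_normc _) _.
  apply: le_trans (cauchy_schwarz _ J0) _; first by l2.
  by rewrite nnJ ler_wpM2r ?nn_ge0//; case: (L2U1 L1).
have P : 0 <= Im c * (a ^+ 2 * nn F0 ^+ 2) by rewrite mulr_ge0// mulr_ge0 ?sqr_ge0.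
by rewrite [Im c * (_ + _)]mulrDr; lra.
Qed.

Lemma bform_energy' c F0 F1 : 0 <= Im c -> L2 F0 -> L2 F1 ->
  Im c * nn F1 ^+ 2 - M * nn F1 * nn F0 <= Im (bform c (fun y => (F0 y)^*%C) (fun y => (F1 y)^*%C) F0 F1).
Proof.
move=> c0 L0 L1; have := bform_energy c0 (L2J L0) (L2J L1); rewrite !nnJ.
have K F : (fun y => ((F y)^*%C)^*%C) = F by apply/funext => y; rewrite conjcK.
by rewrite !K.
Qed.

Lemma cint_ae0 F G : L2 F -> L2 G -> {ae mu, forall x, Rp x -> F x = 0} ->
  cint Rp (fun y => F y * G y) = 0.
Proof.
move=> LF LG F0; apply: eq0_normc; apply/eqP; rewrite eq_le normc_ge0 andbT.
by have := cauchy_schwarz LF LG; rewrite (nn0_ae F0)// mul0r.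
Qed.

(** [small_functional] is applied with [bform c], then c is replaced by the limit [c0] at a cost
    proportional to |c - c0|. The lower bound [m0] on Im c and the upper bound [b] on |c| make the
    constant uniform along the family. *)
Lemma small_c0 c0 (m0 b : R) : 0 < m0 -> 0 <= b -> exists2 C : R, 0 <= C &
  forall (s t : R) (k c : R[i]) F0 F1 F2 F3 F4,
  0 < s -> s <= 1 -> Re k = 0 -> Im k = s ^+ 4 -> 0 <= t -> m0 <= Im c -> normc c <= b ->
  H2 F0 F1 F2 -> H2 F2 F3 F4 -> F0 0 = 0 -> F1 0 = t%:C * F2 0 ->
  ({ae mu, forall x, Rp x -> orr c k F0 F2 F4 x = 0} ->
    forall G0 G1 G2, H2 G0 G1 G2 -> G0 0 = 0 ->
    normc (bform c0 F0 F1 G0 G1) <= C * (normc (c - c0) + s) * nn F0 * (nn G0 + nn G1 + nn G2)) /\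
  ({ae mu, forall x, Rp x -> orrT c k F0 F1 F2 F4 x = 0} ->
    forall G0 G1 G2, H2 G0 G1 G2 -> G0 0 = 0 ->
    normc (bform c0 G0 G1 F0 F1) <= C * (normc (c - c0) + s) * nn F0 * (nn G0 + nn G1 + nn G2)).
Proof.
move=> m00 b0; pose CB := (1 + a ^+ 2) * (3 * M + b).
have a20 : 0 <= 1 + a ^+ 2 by rewrite addr_ge0// sqr_ge0.
have CB0 : 0 <= CB by rewrite mulr_ge0// addr_ge0// mulr_ge0.
have [C C0 H] := small_functional m00 CB0.
pose C' := C + (1 + a ^+ 2) * (1 + C).
have C'0 : 0 <= C' by rewrite addr_ge0// mulr_ge0// addr_ge0.
exists C' => // s t k c F0 F1 F2 F3 F4 s0 s1 Rk Ik t0 mc cb hF hF2 F00 F10.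
have Ic0 : 0 <= Im c by apply: le_trans mc; exact: ltW.
have [_ _ [L0 L1 L2']] := hF.
have n00 := nn_ge0 F0; have n10 := nn_ge0 F1.
have final (w : R) (z z' : R[i]) (g0 g1 g2 : R) : w = normc (c - c0) -> 0 <= g0 -> 0 <= g1 -> 0 <= g2 ->
    nn F1 <= C * nn F0 ->
    normc z <= C * s * nn F0 * (g0 + g1 + g2) ->
    normc (z - z') <= w * ((1 + a ^+ 2) * (nn F0 + nn F1) * (g0 + g1)) ->
    normc z' <= C' * (w + s) * nn F0 * (g0 + g1 + g2).
  move=> wE g00 g10 g20 e1 b1 b2; have w0 : 0 <= w by rewrite wE normc_ge0.
  have -> : z' = z - (z - z') by rewrite subKr.
  rewrite (le_trans (le_normcD _ _))// normcN; apply: le_trans (lerD b1 b2) _.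
  have q : w * ((1 + a ^+ 2) * (nn F0 + nn F1) * (g0 + g1)) <=
     w * ((1 + a ^+ 2) * ((1 + C) * nn F0) * (g0 + g1 + g2)).
    apply: ler_wpM2l => //; apply: ler_pM; [by rewrite mulr_ge0// addr_ge0|by rewrite addr_ge0| |by rewrite lerDl].
    by apply: ler_wpM2l => //; rewrite mulrDl mul1r lerD2l.
  apply: le_trans (lerD (lexx _) q) _.
  have s0' := ltW s0.
  move: (nn F0) n00 {H e1 b2 b1 q} => n n0'.
  rewrite -subr_ge0.
  have -> : C' * (w + s) * n * (g0 + g1 + g2) - (C * s * n * (g0 + g1 + g2) + w * ((1 + a ^+ 2) * ((1 + C) * n) * (g0 + g1 + g2))) =
    (C' - (1 + a ^+ 2) * (1 + C)) * w * n * (g0 + g1 + g2) + (C' - C) * s * n * (g0 + g1 + g2) by ring.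
  have C'1 : 0 <= C' - (1 + a ^+ 2) * (1 + C) by rewrite /C' addrK.
  have C'2 : 0 <= C' - C by rewrite /C' addrC addKr; apply: mulr_ge0 => //; exact: addr_ge0.
  by apply: addr_ge0; rewrite !mulr_ge0// !addr_ge0.
have bB c' P0 P1 G0 G1 : normc c' <= b -> L2 P0 -> L2 P1 -> L2 G0 -> L2 G1 ->
    normc (bform c' P0 P1 G0 G1) <= CB * (nn P0 + nn P1) * (nn G0 + nn G1).
  move=> cb' LP0 LP1 LG0 LG1; apply: le_trans (bform_le c' LP0 LP1 LG0 LG1) _.
  by rewrite /CB ler_wpM2r ?addr_ge0 ?nn_ge0// ler_wpM2r ?addr_ge0 ?nn_ge0// ler_wpM2l// lerD2l.
have en : m0 * nn F1 ^+ 2 - M * nn F1 * nn F0 <= Im c * nn F1 ^+ 2 - M * nn F1 * nn F0.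
  by rewrite lerD2r ler_wpM2r ?sqr_ge0.
split=> o G0 G1 G2 hG G00.
  have weak P0 P1 P2 : H2 P0 P1 P2 -> P0 0 = 0 ->
      bform c F0 F1 P0 P1 + k * (dform F0 F2 P0 P2 + F2 0 * P1 0) = 0.
    move=> hP P00; rewrite -(orr_pair c k hF hF2 hP F00 P00).
    by have [_ _ [? ? ?]] := hP; apply: cint_ae0 => //; exact: orr_L2 hF hF2.
  have [e1 e2] := H s t k (bform c F0 F1) F0 F1 F2 F3 F4 s0 s1 Rk Ik t0 hF hF2 F00 F10 weak
    (fun P0 P1 => bB c F0 F1 P0 P1 cb L0 L1) (le_trans en (bform_energy Ic0 L0 L1)).
  have [_ _ [LG0 LG1 LG2]] := hG.
  exact: final (erefl _) (nn_ge0 _) (nn_ge0 _) (nn_ge0 _) e1 (e2 _ _ _ hG G00) (bform_shift c c0 L0 L1 LG0 LG1).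
have weak P0 P1 P2 : H2 P0 P1 P2 -> P0 0 = 0 ->
    bform c P0 P1 F0 F1 + k * (dform F0 F2 P0 P2 + F2 0 * P1 0) = 0.
  move=> hP P00; rewrite -(orrT_pair c k hF hF2 hP F00 P00).
  by have [_ _ [? ? ?]] := hP; apply: cint_ae0 => //; exact: orrT_L2 hF hF2.
have bB' P0 P1 : L2 P0 -> L2 P1 -> normc (bform c P0 P1 F0 F1) <= CB * (nn F0 + nn F1) * (nn P0 + nn P1).
  by move=> LP0 LP1; rewrite mulrAC; exact: bB.
have [e1 e2] := H s t k (fun P0 P1 => bform c P0 P1 F0 F1) F0 F1 F2 F3 F4 s0 s1 Rk Ik t0 hF hF2 F00 F10 weak
  bB' (le_trans en (bform_energy' Ic0 L0 L1)).
have [_ _ [LG0 LG1 LG2]] := hG.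
have sh' := bform_shift c c0 LG0 LG1 L0 L1; rewrite [(1 + _) * _ * _]mulrAC in sh'.
exact: final (erefl _) (nn_ge0 _) (nn_ge0 _) (nn_ge0 _) e1 (e2 _ _ _ hG G00) sh'.
Qed.
(** Hermitian projection onto P, stated through bilinear pairings: the conjugate of the remainder is
    what [rayleigh_inhom] accepts as right-hand side, and pairing it with F gives the squared norm
    of the remainder. *)
Lemma projection P F : L2 P -> L2 F -> nn P != 0 -> exists A,
  cint Rp (fun y => P y * (F y - A * P y)^*%C) = 0 /\
  cint Rp (fun y => F y * (F y - A * P y)^*%C) = (nn (fun y => F y - A * P y) ^+ 2)%:C.
Proof.
move=> LP LF P0; have JP := L2J LP; have JF := L2J LF.
pose A := ((cint Rp (fun y => P y * (F y)^*%C)) / (nn P ^+ 2)%:C)^*%C.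
have n0 : (nn P ^+ 2)%:C != 0 :> R[i].
  by apply/negP => /eqP/(congr1 (@complex.Re R)) /= /eqP; rewrite expf_eq0/= (negPf P0).
exists A; pose r y := F y - A * P y; have Lr : L2 r by rewrite /r; l2.
have JA y : (r y)^*%C = (F y)^*%C - A^*%C * (P y)^*%C.
  rewrite /r; case: (F y) (A) (P y) => [p q] [s t] [u v]; apply: complex_eq => /=; ring.
have E1 : cint Rp (fun y => P y * (r y)^*%C) = 0.
  rewrite (eq_cint (G := fun y => P y * (F y)^*%C - A^*%C * (P y * (P y)^*%C))); last first.
    by move=> y _; rewrite JA; move: (P y)^*%C (F y)^*%C A^*%C => *; ring.
  have i1 : ci Rp (fun y => P y * (F y)^*%C) by l2ci.
  have i2 : ci Rp (fun y => P y * (P y)^*%C) by l2ci.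
  by rewrite cintB// ?cintZ//; [rewrite cint_sqn -nn_sqr /A conjcK divfK// subrr|exact: ciZ].
split=> //.
rewrite nn_sqr -cint_sqn.
have i1 : ci Rp (fun y => r y * (r y)^*%C) by apply: L2_ciM => //; exact: L2J.
have i2 : ci Rp (fun y => P y * (r y)^*%C) by apply: L2_ciM => //; exact: L2J.
rewrite (eq_cint (G := fun y => r y * (r y)^*%C + A * (P y * (r y)^*%C))); last first.
  by move=> y _; rewrite -/(r y); move: (r y)^*%C => R'; rewrite /r; move: (F y) (P y) => *; ring.
by rewrite cintD//; [rewrite cintZ// E1 mulr0 addr0|exact: ciZ].
Qed.

(** * Distance of approximate modes to the inviscid modes *)

Section Rigidity.
Variables (c0 : R[i]) (P0 P1 : R -> R[i]).
Hypotheses (Ic0 : 0 < Im c0).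
Local Notation G := (res U c0).
Let q y := (U2 y)%:C * G y.
Hypotheses (h0 : cac P0 P1) (h1 : cac P1 (fun y => (aC ^+ 2 + q y) * P0 y))
  (L0 : L2 P0) (L1 : L2 P1) (P00 : P0 0 = 0) (Pn0 : nn P0 != 0).

Lemma res_sh y : G y * sh c0 y = 1.
Proof. by rewrite /res mulVf// res_neq0// gt_eqF. Qed.

Lemma cac_G : cac G (fun y => - ((U1 y)%:C * G y ^+ 2)).
Proof. by have [_ _ _ _ h] := hU; apply: h; rewrite gt_eqF. Qed.

Lemma normc_G y : 0 <= y -> normc (G y) <= (Im c0)^-1.
Proof.
move=> y0; rewrite /res normcV lef_pV2 ?posrE//.
  have := Im_le_normc ((U y)%:C - c0); rewrite !reimE sub0r normrN gtr0_norm//; exact.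
apply: lt_le_trans Ic0 _.
have := Im_le_normc ((U y)%:C - c0); rewrite !reimE sub0r normrN gtr0_norm//; exact.
Qed.

Let iv0 : 0 <= (Im c0)^-1. Proof. by rewrite invr_ge0 ltW. Qed.

Lemma L2G F : L2 F -> L2 (fun y => G y * F y) /\ nn (fun y => G y * F y) <= (Im c0)^-1 * nn F.
Proof. by apply: L2_mulb => //; [exact: cac_meas cac_G|exact: normc_G]. Qed.

Let K := M * (Im c0)^-1.
Let K0 : 0 < K.
Proof. by have [_ m0 _ _ _] := hU; rewrite mulr_gt0// invr_gt0. Qed.

Let mq : cmeas Rp q.
Proof. by apply: cmeasM; [exact: cmeas_U2|exact: cac_meas cac_G]. Qed.

Let eta0 : 0 < eta. Proof. by have [] := hU. Qed.

Let qK y : 0 <= y -> normc (q y) <= K * expR (- eta * y).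
Proof.
move=> y0; rewrite normcM /K mulrAC; apply: ler_pM; rewrite ?normc_ge0//; [exact: normc_U2|exact: normc_G].
Qed.

Lemma L2q F : L2 F -> L2 (fun y => q y * F y) /\ nn (fun y => q y * F y) <= K * nn F.
Proof.
apply: L2_mulb => //; first exact: ltW.
move=> y y0; apply: le_trans (qK y0) _; rewrite -[leRHS]mulr1 ler_wpM2l ?(ltW K0)//.
by rewrite -expR0 ler_expR mulNr oppr_le0 mulr_ge0// ltW.
Qed.

Lemma rayleigh_inhom : exists2 C, 0 <= C & forall f : R -> R[i], L2 f ->
  cint Rp (fun y => P0 y * f y) = 0 ->
  exists X0 X1 X2, [/\ H2 X0 X1 X2, X0 0 = 0,
    forall y, X2 y = (aC ^+ 2 + q y) * X0 y + f y &
    nn X0 + nn X1 + nn X2 <= C * nn f].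
Proof.
have [C C0 H] := rayleigh_solve mq K0 eta0 a0 qK h0 h1 L0 L1 P00 Pn0.
have C'0 : 0 <= C + C + ((a ^+ 2 + K) * C + 1).
  by rewrite !addr_ge0// mulr_ge0// addr_ge0 ?sqr_ge0// ltW.
exists (C + C + ((a ^+ 2 + K) * C + 1)) => // f Lf f0.
have [X0 [X1 [k0 k1 X00 [LX0 LX1 n0 n1]]]] := H f Lf f0.
have [Lq nq] := L2q LX0; have [Lz nz] := L2Z (aC ^+ 2) LX0.
have LX2 : L2 (fun y => (aC ^+ 2 + q y) * X0 y + f y).
  apply: (eq_L2 (F := fun y => aC ^+ 2 * X0 y + q y * X0 y + f y)); first by move=> y _; rewrite mulrDl.
  by apply: L2D => //; exact: L2D.
exists X0, X1, (fun y => (aC ^+ 2 + q y) * X0 y + f y); split=> //.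
have n2' : nn (fun y => (aC ^+ 2 + q y) * X0 y + f y) <= (a ^+ 2 + K) * nn X0 + nn f.
  rewrite (eq_nn (G := fun y => aC ^+ 2 * X0 y + q y * X0 y + f y)); last by move=> y _; rewrite mulrDl.
  apply: le_trans (nnD _ _) _ => //; first exact: L2D.
  rewrite lerD2r; apply: le_trans (nnD _ _) _ => //.
  by rewrite nz normc_aC2 mulrDl lerD2l.
have aK : 0 <= a ^+ 2 + K by rewrite addr_ge0 ?sqr_ge0// ltW.
have n3 := ler_wpM2l aK n0.
rewrite [leRHS]mulrDl [(C + C) * _]mulrDl; apply: lerD; first exact: lerD.
by apply: le_trans n2' _; rewrite [leRHS]mulrDl mul1r lerD2r -mulrA.
Qed.

(** The two derivatives of 1 / (U - c0) are bounded, so the quotient of an H^2 function is again an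
    admissible test function, with comparable norm. The factor 2 covers the repeated cross terms of
    the product rule. *)
Lemma H2_res : exists2 C, 0 <= C & forall X0 X1 X2, H2 X0 X1 X2 -> exists Y1 Y2,
  H2 (fun y => G y * X0 y) Y1 Y2 /\
  nn (fun y => G y * X0 y) + nn Y1 + nn Y2 <= C * (nn X0 + nn X1 + nn X2).
Proof.
set i := (Im c0)^-1.
pose G1 y := - ((U1 y)%:C * G y ^+ 2).
pose G2 y := - ((U2 y)%:C * G y ^+ 2 + 2 * ((U1 y)%:C * G y * G1 y)).
have hG1 : cac G G1 by exact: cac_G.
have hG2 : cac G1 G2.
  apply: eq_cac (cacN (cacM cac_U1 (cacM hG1 hG1))) => y _; first by rewrite /G1 expr2.
  by rewrite /G2; move: (U1 y)%:C (U2 y)%:C (G y) (G1 y) => *; ring.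
have g0 y : 0 <= y -> normc (G y) <= i by exact: normc_G.
pose c1 := M * i ^+ 2; pose c2 := M * i ^+ 2 + 2 * (M * i * c1).
have i0 : 0 <= i by [].
have c10 : 0 <= c1 by rewrite mulr_ge0// sqr_ge0.
have c20 : 0 <= c2 by rewrite addr_ge0 ?mulr_ge0 ?sqr_ge0.
have gg y : 0 <= y -> normc (G y ^+ 2) <= i ^+ 2.
  by move=> y0; rewrite expr2 normcM expr2 ler_pM ?normc_ge0 ?g0.
have g1 y : 0 <= y -> normc (G1 y) <= c1.
  by move=> y0; rewrite /G1 normcN normcM ler_pM ?normc_ge0 ?normc_U1 ?gg.
have g2 y : 0 <= y -> normc (G2 y) <= c2.
  move=> y0; rewrite /G2 normcN (le_trans (le_normcD _ _))// lerD//.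
    by rewrite normcM ler_pM ?normc_ge0 ?normc_U2' ?gg.
  have -> : 2 * ((U1 y)%:C * G y * G1 y) = (2 : R)%:C * ((U1 y)%:C * G y * G1 y) by rewrite rmorph_nat.
  rewrite normcM normcR ger0_norm// ler_wpM2l// !normcM.
  by rewrite !ler_pM ?mulr_ge0 ?normc_ge0 ?normc_U1 ?g0 ?g1.
have m1 : cmeas Rp G1 by exact: cac_meas hG2.
have m2 : cmeas Rp G2.
  apply: cmeasN; apply: cmeasD.
    by apply: cmeasM; [exact: cmeas_U2|apply: cmeasM; exact: cac_meas hG1].
  apply: cmeasM; first exact: cmeas_cst.
  by apply: cmeasM => //; apply: cmeasM; [exact: cac_meas cac_U1|exact: cac_meas hG1].
exists (2 * (i + c1 + c2)) => [|X0 X1 X2 [k0 k1 [LX0 LX1 LX2]]].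
  by apply: mulr_ge0 => //; apply: addr_ge0 => //; exact: addr_ge0.
exists (fun y => G1 y * X0 y + G y * X1 y), (fun y => G2 y * X0 y + G1 y * X1 y + (G1 y * X1 y + G y * X2 y)).
have [l0 n0] := L2G LX0; have [l1 n1] := L2G LX1; have [l2' n2'] := L2G LX2.
have [l3 n3] := L2_mulb c10 m1 g1 LX0; have [l4 n4] := L2_mulb c10 m1 g1 LX1.
have [l5 n5] := L2_mulb c20 m2 g2 LX0.
split.
  split; [exact: cacM|exact: cacD (cacM hG2 k0) (cacM hG1 k1)|split=> //].
    exact: L2D.
  by apply: L2D; exact: L2D.
have a1 := nnD l3 l1.
have a2 := nnD (L2D l5 l4) (L2D l4 l2').
have a3 := nnD l5 l4; have a4 := nnD l4 l2'.
have p0 := nn_ge0 X0; have p1 := nn_ge0 X1; have p2 := nn_ge0 X2.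
move: p0 p1 p2 n0 n1 n2' n3 n4 n5 a1 a2 a3 a4; rewrite -/i.
move: (nn X0) (nn X1) (nn X2) (nn (fun y => G y * X0 y)) => x0 x1 x2 w.
move: (nn _) (nn _) (nn _) (nn _) (nn _) (nn _) (nn _) (nn _) (nn _) => ? ? ? ? ? ? ? ? ? p0 p1 p2 *.
have := (mulr_ge0 i0 p0, mulr_ge0 i0 p1, mulr_ge0 i0 p2, mulr_ge0 c10 p0, mulr_ge0 c10 p1, mulr_ge0 c10 p2).
have := (mulr_ge0 c20 p0, mulr_ge0 c20 p1, mulr_ge0 c20 p2) => -[[r1 r2] r3] [[[[[r4 r5] r6] r7] r8] r9].
lra.
Qed.
Lemma green F0 F1 F2 X0 X1 X2 : H2 F0 F1 F2 -> H2 X0 X1 X2 -> F0 0 = 0 -> X0 0 = 0 ->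
  cint Rp (fun y => F2 y * X0 y) = cint Rp (fun y => F0 y * X2 y).
Proof.
move=> hF hX F00 X00.
have := H1_parts (H2_H1' hF) (H2_H1 hX); rewrite X00 mulr0 oppr0.
have := H1_parts (H2_H1 hF) (H2_H1' hX); rewrite F00 mul0r oppr0.
move: (cint _ _) (cint _ _) (cint _ _) => p r t /eqP; rewrite addr_eq0 => /eqP -> /eqP.
by rewrite addr_eq0 opprK => /eqP ->.
Qed.

Lemma nn_G_neq0 : nn (fun y => G y * P0 y) != 0.
Proof.
have [Lk nk] := L2G L0.
apply: contra Pn0 => /eqP k0; apply/eqP; apply: nn0_ae => //.
apply: aeS (nn_eq0 Lk k0) => y H Dy; have := H Dy => /eqP.
rewrite mulf_eq0 => /orP[/eqP g0|/eqP//].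
by have := res_sh y; rewrite g0 mul0r => /esym/eqP; rewrite oner_eq0.
Qed.

(** The weight G cancels U - c0, so at the test function G X0 the form is the integral of (L F) X0.
    By symmetry of L it equals the integral of F times L X0, that is |r|^2. Smallness bounds it by T
    D C |r|, and one factor |r| is divided out. *)
Lemma rigid_direct : exists2 C : R, 0 <= C & forall F0 F1 F2 (T : R), H2 F0 F1 F2 -> F0 0 = 0 -> 0 <= T ->
  (forall G0 G1 G2, H2 G0 G1 G2 -> G0 0 = 0 ->
    normc (bform c0 F0 F1 G0 G1) <= T * (nn G0 + nn G1 + nn G2)) ->
  exists A, nn (fun y => F0 y - A * P0 y) <= C * T.
Proof.
have [C C0 solve] := rayleigh_inhom; have [D D0 lift] := H2_res.
exists (D * C) => [|F0 F1 F2 T hF F00 T0 small]; first exact: mulr_ge0.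
have [_ _ [LF0 LF1 LF2]] := hF.
have [A [r0 r1]] := projection L0 LF0 Pn0; exists A.
set r := fun y => F0 y - _ in r0 r1 *; have Lr : L2 r by rewrite /r; l2.
have [X0 [X1 [X2 [hX X00 eX nX]]]] := solve _ (L2J Lr) r0.
have [Y1 [Y2 [hY nY]]] := lift _ _ _ hX; rewrite nnJ in nX.
have Y00 : G 0 * X0 0 = 0 by rewrite X00 mulr0.
have := small _ _ _ hY Y00; rewrite -(bformE_r c0 hF (H2_H1 hY) Y00).
have [_ _ [LX0 LX1 LX2]] := hX; have [_ _ [LY0 _ _]] := hY.
have -> : cint Rp (fun y => (sh c0 y * (F2 y - aC ^+ 2 * F0 y) - (U2 y)%:C * F0 y) * (G y * X0 y)) =
    (nn r ^+ 2)%:C.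
  rewrite -r1; have [Lq _] := L2q LX0; have JR := L2J Lr.
  have -> : cint Rp (fun y => F0 y * (r y)^*%C) =
      cint Rp (fun y => F0 y * X2 y) - cint Rp (fun y => F0 y * (aC ^+ 2 * X0 y + q y * X0 y)).
    have Ls : L2 (fun y => aC ^+ 2 * X0 y + q y * X0 y) by apply: L2D => //; exact: L2Zl.
    rewrite -cintB//; [|l2ci|exact: L2_ciM].
    apply: eq_cint => y _; rewrite eX; move: (r y)^*%C => w.
    by move: (F0 y) (X0 y) (q y) aC => *; ring.
  have Ls : L2 (fun y => aC ^+ 2 * X0 y + q y * X0 y) by apply: L2D => //; exact: L2Zl.
  rewrite -(green hF hX)// -cintB//; [|l2ci|exact: L2_ciM].
  apply: eq_cint => y _; have := res_sh y; rewrite /q; move: (G y) (sh c0 y) (U2 y)%:C => g s u gs.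
  transitivity (g * s * ((F2 y - aC ^+ 2 * F0 y) * X0 y) - u * g * F0 y * X0 y).
    by move: (F0 y) (F2 y) (X0 y) aC => *; ring.
  by rewrite gs; move: (F0 y) (F2 y) (X0 y) aC => *; ring.
rewrite normcR ger0_norm ?sqr_ge0// => H.
have [->|rn] := eqVneq (nn r) 0; first by rewrite !mulr_ge0.
have rp : 0 < nn r by rewrite lt_def rn nn_ge0.
rewrite -(ler_pM2r rp) -expr2; apply: le_trans H _.
have -> : D * C * T * nn r = T * (D * (C * nn r)) by ring.
by rewrite ler_wpM2l//; apply: le_trans nY _; rewrite ler_wpM2l.
Qed.

(** Here the mode sits in the second slot and its limit is G P0. The test function X0 solves L X0 =
    G conj(r) and is used without division: (U - c0) L X0 is conj(r). The solvability condition
    holds because P0 paired with G conj(r) is G P0 paired with conj(r). *)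
Lemma rigid_adjoint : exists2 C : R, 0 <= C & forall F0 F1 F2 (T : R), H2 F0 F1 F2 -> F0 0 = 0 -> 0 <= T ->
  (forall G0 G1 G2, H2 G0 G1 G2 -> G0 0 = 0 ->
    normc (bform c0 G0 G1 F0 F1) <= T * (nn G0 + nn G1 + nn G2)) ->
  exists A, nn (fun y => F0 y - A * (G y * P0 y)) <= C * T.
Proof.
have [C C0 solve] := rayleigh_inhom.
exists (C * (Im c0)^-1) => [|F0 F1 F2 T hF F00 T0 small]; first exact: mulr_ge0.
have [_ _ [LF0 LF1 LF2]] := hF; have [Lk nk] := L2G L0.
have [A [r0 r1]] := projection Lk LF0 nn_G_neq0; exists A.
set r := fun y => F0 y - _ in r0 r1 *; have Lr : L2 r by rewrite /r; apply: L2B => //; exact: L2Zl.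
have [LGr nGr] := L2G (L2J Lr); rewrite nnJ in nGr.
have f0 : cint Rp (fun y => P0 y * (G y * (r y)^*%C)) = 0.
  by rewrite -r0; apply: eq_cint => y _; rewrite mulrA [P0 y * _]mulrC.
have [X0 [X1 [X2 [hX X00 eX nX]]]] := solve _ LGr f0.
have := small _ _ _ hX X00; rewrite -(bformE_r c0 hX (H2_H1 hF) F00).
have -> : cint Rp (fun y => (sh c0 y * (X2 y - aC ^+ 2 * X0 y) - (U2 y)%:C * X0 y) * F0 y) = (nn r ^+ 2)%:C.
  rewrite -r1; apply: eq_cint => y _; rewrite -/(r y) eX /q; have := res_sh y.
  move: (r y)^*%C (G y) (sh c0 y) (U2 y)%:C => w g s u gs.
  transitivity ((g * s * (u * X0 y + w) - u * X0 y) * F0 y).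
    by move: (F0 y) (X0 y) aC => *; ring.
  by rewrite gs; move: (F0 y) (X0 y) aC => *; ring.
rewrite normcR ger0_norm ?sqr_ge0// => H.
have [->|rn] := eqVneq (nn r) 0; first by rewrite !mulr_ge0.
have rp : 0 < nn r by rewrite lt_def rn nn_ge0.
rewrite -(ler_pM2r rp) -expr2; apply: le_trans H _.
have -> : C * (Im c0)^-1 * T * nn r = T * (C * ((Im c0)^-1 * nn r)) by ring.
by rewrite ler_wpM2l//; apply: le_trans nX _; rewrite ler_wpM2l.
Qed.

(* The integrand is [(U - c0) * |k|^2] with [k = G * P0], whose imaginary part has a sign. *)
Lemma hermitian_pairing_neq0 : cint Rp (fun y => P0 y * (G y * P0 y)^*%C) != 0.
Proof.
have [Lk nk] := L2G L0; have kn := nn_G_neq0.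
apply/negP => /eqP/(congr1 (@complex.Im R)).
have /L2sqn[_ rk] := Lk.
rewrite Im_cint (eq_Rint (g := fun y => - Im c0 * sqn (G y * P0 y))); last first.
  move=> y _; have -> : P0 y * (G y * P0 y)^*%C = sh c0 y * ((G y * P0 y) * (G y * P0 y)^*%C).
    rewrite [RHS]mulrA; congr (_ * _); rewrite mulrA [sh c0 y * _]mulrC res_sh mul1r//.
  by rewrite mulJ /sh cImM !reimE sub0r mulr0 add0r.
have -> : \int[mu]_(y in Rp) (- Im c0 * sqn (G y * P0 y)) = - Im c0 * n2 (fun y => G y * P0 y) by apply: RintegralZl.
rewrite -nn_sqr /= => /eqP; rewrite mulf_eq0 oppr_eq0 expf_eq0/= (negPf kn) orbF.
by rewrite gt_eqF.
Qed.

Lemma bilinear_pairing_eq0 : cint Rp (fun y => P0 y * (G y * P0 y)) = 0 ->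
  exists X0 X1 X2, [/\ H2 X0 X1 X2, X0 0 = 0 &
   forall y, sh c0 y * (X2 y - aC ^+ 2 * X0 y) - (U2 y)%:C * X0 y = P0 y].
Proof.
have [C C0 solve] := rayleigh_inhom; have [Lk _] := L2G L0.
move=> /(solve _ Lk)[X0 [X1 [X2 [hX X00 eX nX]]]]; exists X0, X1, X2; split=> // y.
rewrite eX /q; have := res_sh y; move: (G y) (sh c0 y) (U2 y)%:C => g s u gs.
transitivity (g * s * (u * X0 y + P0 y) - u * X0 y).
  by move: (P0 y) (X0 y) aC => *; ring.
by rewrite gs; move: (P0 y) (X0 y) => *; ring.
Qed.

End Rigidity.

(** With remainders r and s, the pairing is A B J plus three terms containing a remainder. Each is
    at most |A| |B| times a small multiple of |P| |Q|, so A and B factor out of the comparison and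
    no normalisation of the modes is needed. *)
Lemma pairing_neq0 (P Q : R -> R[i]) : L2 P -> L2 Q -> cint Rp (fun y => P y * Q y) != 0 ->
  exists2 t : R, 0 < t & forall F G A B, L2 F -> L2 G -> nn F != 0 -> nn G != 0 ->
   nn (fun y => F y - A * P y) <= t * nn F -> nn (fun y => G y - B * Q y) <= t * nn G ->
   cint Rp (fun y => F y * G y) != 0.
Proof.
move=> LP LQ J0; set J := cint _ _ in J0 *.
pose j := normc J; have j0 : 0 < j.
  rewrite lt_def normc_ge0 andbT; apply: contra J0 => /eqP; rewrite /j => /eq0_normc ->; exact: eqxx.
pose m := nn P * nn Q; have m0 : 0 <= m by rewrite mulr_ge0 ?nn_ge0.
(* The bound 1 / 2 lets |F| and |G| be absorbed, giving |F| <= 2 |A| |P|, and reduces the quadratic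
   remainder to a linear one. The errors then total 6 t m, which 16 t (m + 1) <= j keeps below j; m
   + 1 guards against m = 0. *)
pose t := Num.min (1 / 2) (j / (16 * (m + 1))).
have t0 : 0 < t by rewrite lt_min divr_gt0//= divr_gt0// mulr_gt0// ltr_wpDl.
exists t => // F G A B LF LG nF nG dF dG; apply/negP => /eqP E.
set r := fun y => F y - _ in dF; set s := fun y => G y - _ in dG.
have Lr : L2 r by rewrite /r; l2.
have Ls : L2 s by rewrite /s; l2.
have th : t <= 1 / 2 by rewrite /t ge_min lexx.
have tj : t * (16 * (m + 1)) <= j.
  by rewrite -ler_pdivlMr ?mulr_gt0// ?ltr_wpDl// /t ge_min lexx orbT.
have half (H : R -> R[i]) (Z : R -> R[i]) C : L2 H -> L2 Z -> nn (fun y => H y - C * Z y) <= t * nn H ->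
    nn H <= 2 * (normc C * nn Z).
  move=> LH LZ d; have h0 := nn_ge0 H.
  have [l n] := L2Z C LZ; rewrite -n.
  have : nn H <= nn (fun y => C * Z y) + nn (fun y => H y - C * Z y).
    rewrite -(eq_nn (F := fun y => C * Z y + (H y - C * Z y))); last by move=> y _; rewrite addrC subrK.
    by apply: nnD => //; exact: L2B.
  have := ler_wpM2r h0 th; lra.
have hF := half _ _ _ LF LP dF; have hG := half _ _ _ LG LQ dG.
have An : 0 < normc A.
  rewrite lt_def normc_ge0 andbT; apply: contra nF => /eqP e; move: hF; rewrite e mul0r mulr0.
  by move=> h; rewrite eq_le h nn_ge0.
have Bn : 0 < normc B.
  rewrite lt_def normc_ge0 andbT; apply: contra nG => /eqP e; move: hG; rewrite e mul0r mulr0.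
  by move=> h; rewrite eq_le h nn_ge0.
have i1 : ci Rp (fun y => P y * s y) by exact: L2_ciM.
have i2 : ci Rp (fun y => r y * Q y) by exact: L2_ciM.
have i3 : ci Rp (fun y => r y * s y) by exact: L2_ciM.
have i4 : ci Rp (fun y => P y * Q y) by exact: L2_ciM.
have E2 : A * B * J + A * cint Rp (fun y => P y * s y) + B * cint Rp (fun y => r y * Q y) + cint Rp (fun y => r y * s y) = 0.
  have z1 : ci Rp (fun y => A * B * (P y * Q y)) by exact: ciZ.
  have z2 : ci Rp (fun y => A * (P y * s y)) by exact: ciZ.
  have z3 : ci Rp (fun y => B * (r y * Q y)) by exact: ciZ.
  have z12 := ciD (@measurable_halfline R) z1 z2.
  have z123 := ciD (@measurable_halfline R) z12 z3.
  rewrite -E /J -!cintZ// -cintD// -cintD// -cintD//.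
  by apply: eq_cint => y _; rewrite /r /s; move: (F y) (G y) (P y) (Q y) => *; ring.
have b1 : normc A * normc B * j <= normc A * (nn P * nn s) + normc B * (nn r * nn Q) + nn r * nn s.
  have -> : normc A * normc B * j = normc (A * cint Rp (fun y => P y * s y) + B * cint Rp (fun y => r y * Q y) + cint Rp (fun y => r y * s y)).
    rewrite /j -!normcM -normcN; congr normc; apply/eqP; rewrite eq_sym -subr_eq0 opprK.
    by rewrite addrC !addrA E2.
  rewrite (le_trans (le_normcD _ _))// lerD ?cauchy_schwarz//.
  rewrite (le_trans (le_normcD _ _))// lerD// normcM ler_wpM2l ?normc_ge0 ?cauchy_schwarz//.
have p0 := nn_ge0 P; have q0 := nn_ge0 Q; have r0 := nn_ge0 r; have s0 := nn_ge0 s.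
have rb : nn r <= t * (2 * (normc A * nn P)) by apply: le_trans dF _; rewrite ler_wpM2l// ltW.
have sb : nn s <= t * (2 * (normc B * nn Q)) by apply: le_trans dG _; rewrite ler_wpM2l// ltW.
have k1 : normc A * (nn P * nn s) <= normc A * normc B * (2 * t * m).
  apply: le_trans (ler_wpM2l (ltW An) (ler_wpM2l p0 sb)) _.
  by rewrite /m le_eqVlt; apply/orP; left; apply/eqP; ring.
have k2 : normc B * (nn r * nn Q) <= normc A * normc B * (2 * t * m).
  apply: le_trans (ler_wpM2l (ltW Bn) (ler_wpM2r q0 rb)) _.
  by rewrite /m le_eqVlt; apply/orP; left; apply/eqP; ring.
have k3 : nn r * nn s <= normc A * normc B * (2 * t * m).
  apply: le_trans (ler_pM r0 s0 rb sb) _.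
  have -> : t * (2 * (normc A * nn P)) * (t * (2 * (normc B * nn Q))) =
    normc A * normc B * (4 * t * t * m) by rewrite /m; ring.
  apply: ler_wpM2l; first by rewrite mulr_ge0// ltW.
  by apply: ler_wpM2r => //; have := t0; nra.
have : normc A * normc B * j <= normc A * normc B * (6 * t * m).
  apply: le_trans b1 _; apply: le_trans (lerD (lerD k1 k2) k3) _.
  by rewrite le_eqVlt; apply/orP; left; apply/eqP; ring.
rewrite ler_pM2l ?mulr_gt0// => F1.
have tm : 0 <= t * m by rewrite mulr_ge0// ltW.
move: F1 tj t0 tm; rewrite -[6 * t * m]mulrA; have -> : t * (16 * (m + 1)) = 16 * (t * m) + 16 * t by ring.
by move: (t * m) => *; lra.
Qed.
End Forms.

(** * Eigenmodes and images *)

Section Assembly.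
Variable R : realType.
Notation mu := (@lebesgue_measure R).
Notation Rp := (@halfline R).
Notation Re := (@complex.Re R).
Notation Im := (@complex.Im R).
Implicit Types (F G H : R -> R[i]) (x y b : R) (z c : R[i]) (D E : set R).
Variables (U : R -> R) (M eta : R) (alpha : nat).
Local Notation U1 := (halfline_derivn 1 U).
Local Notation U2 := (halfline_derivn 2 U).
Local Notation a := (alpha%:R : R).
Local Notation aC := (a%:C).
Hypotheses (hU : flow U U1 U2 M eta) (alpha0 : (0 < alpha)%N).

Let a0 : 0 < a. Proof. by rewrite ltr0n. Qed.

Lemma natC : (alpha%:R : R[i]) = aC.
Proof. by rewrite rmorph_nat. Qed.

(** The number i nu / alpha, equal to the coefficient - nu / (i alpha) of the squared Laplacian in
    the Orr-Sommerfeld operator. *)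
Definition visc nu : R[i] := 0 +i* (nu / a).

Lemma viscE nu : nu%:C / ('i * alpha%:R) = - visc nu.
Proof.
have an : a != 0 by rewrite gt_eqF.
have d : 'i * alpha%:R != 0 :> R[i].
  rewrite natC; apply/negP => /eqP/(congr1 (@complex.Im R)) /=.
  by rewrite mulr0 mul1r add0r => /eqP; rewrite (negPf an).
apply: (mulIf d); rewrite divfK// natC.
by apply: complex_eq => /=; field.
Qed.

Lemma Orr_chain c nu phi F0 F1 F2 F3 F4 : L2 phi -> H2 F0 F1 F2 -> H2 F2 F3 F4 -> aeeq F0 phi ->
  aeeq (Orr U alpha c nu phi) (orr U U2 a c (visc nu) F0 F2 F4).
Proof.
move=> Lphi hF hF2 e; have [l1 L1] := laplacianE alpha hF Lphi (aeeq_sym e).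
have hL := H2_lap a hF hF2.
have l1' : aeeq (laplacian alpha phi) (fun y => F2 y - aC ^+ 2 * F0 y) by rewrite -natC.
have [l2 _] := laplacianE alpha hL L1 l1'.
have := aeI e (aeI l1' l2); apply: aeS => y [E1 [E2 E3]] Dy.
by rewrite /Orr /orr viscE mulNr opprK E2// E3// -E1// /sh natC.
Qed.

(** The U'' created by the product rule in Delta ((U - conj c) phi) cancels the one subtracted in
    the adjoint operator. The identity is isolated on plain numbers so that it can be checked on
    real and imaginary parts. *)
Lemma conj_adj_algebra (f0 f1 f2 f4 v z : R[i]) (u u1 u2 A : R) :
  (u2%:C * f0 + u1%:C * f1 + (u1%:C * f1 + (u%:C - z^*%C) * f2) - A%:C * ((u%:C - z^*%C) * f0)
   - u2%:C * f0 + - v * (f4 - A%:C * f2 - A%:C * (f2 - A%:C * f0)))^*%C =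
  (u%:C - z) * (f2^*%C - A%:C * f0^*%C) + 2 * (u1%:C * f1^*%C) +
   - v^*%C * (f4^*%C - A%:C * f2^*%C - A%:C * (f2^*%C - A%:C * f0^*%C)).
Proof.
have -> : 2 * (u1%:C * f1^*%C) = u1%:C * f1^*%C + u1%:C * f1^*%C by ring.
move: f0 f1 f2 f4 v z => [p0 q0] [p1 q1] [p2 q2] [p4 q4] [v w] [r s].
by apply: complex_eq => /=; ring.
Qed.

Lemma Orr_adj_chain c nu phi F0 F1 F2 F3 F4 : L2 phi -> H2 F0 F1 F2 -> H2 F2 F3 F4 -> aeeq F0 phi ->
  aeeq (fun y => (Orr_adj U alpha c nu phi y)^*%C)
    (orrT U U1 a c (visc nu) (fun y => (F0 y)^*%C) (fun y => (F1 y)^*%C) (fun y => (F2 y)^*%C) (fun y => (F4 y)^*%C)).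
Proof.
move=> Lphi hF hF2 e; have [l1 L1] := laplacianE alpha hF Lphi (aeeq_sym e).
have hL := H2_lap a hF hF2.
have l1' : aeeq (laplacian alpha phi) (fun y => F2 y - aC ^+ 2 * F0 y) by rewrite -natC.
have [l2 _] := laplacianE alpha hL L1 l1'.
have [k0 k1 [LF0 LF1 LF2]] := hF.
have hw := cac_sh hU c^*%C; have hw1 := cac_U1 hU.
have hP : H2 (fun y => sh U c^*%C y * F0 y)
    (fun y => (U1 y)%:C * F0 y + sh U c^*%C y * F1 y)
    (fun y => (U2 y)%:C * F0 y + (U1 y)%:C * F1 y + ((U1 y)%:C * F1 y + sh U c^*%C y * F2 y)).
  have [s0 _] := L2sh hU c^*%C LF0; have [s1 _] := L2sh hU c^*%C LF1; have [s2 _] := L2sh hU c^*%C LF2.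
  have [u0 _] := L2U1 hU LF0; have [u1 _] := L2U1 hU LF1; have [v0 _] := L2U2 hU LF0.
  split; [exact: cacM|exact: cacD (cacM hw1 k0) (cacM hw k1)|split=> //].
    exact: L2D.
  by apply: L2D; exact: L2D.
have [Lw _] := L2sh hU c^*%C Lphi.
have ew : aeeq (fun t => ((U t)%:C - c^*%C) * phi t) (fun y => sh U c^*%C y * F0 y).
  by move: e; apply: aeS => y E Dy; rewrite E.
have [l3 _] := laplacianE alpha hP Lw ew.
have := aeI e (aeI l3 l2); apply: aeS => y [E1 [E2 E3]] Dy.
rewrite /Orr_adj /orrT viscE E2// E3// -E1// /sh natC (aC2E a).
(* The viscous coefficient is purely imaginary: conjugation reverses its sign and compensates the
   opposite sign of that term in the adjoint operator. *)
have V : visc nu = - (visc nu)^*%C by apply: complex_eq => /=; rewrite ?oppr0 ?opprK.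
rewrite [in RHS]V.
exact: conj_adj_algebra.
Qed.

Lemma Dnu_chain gamma nu phi : Dnu gamma nu phi -> exists F0 F1 F2 F3 F4,
  [/\ H2 F0 F1 F2, H2 F2 F3 F4, aeeq F0 phi, F0 0 = 0 &
   F1 0 = (nu `^ gamma)%:C * F2 0] /\ L2 phi.
Proof.
move=> [s4 t0 t1]; have [F0 [F1 [F2 [F3 [F4 [h1 h2 e0 e1 e2]]]]]] := sobolev_H4 s4.
exists F0, F1, F2, F3, F4; split; last exact: sobolev_L2 s4.
have [k0 k1 _] := h1; have [k2 _ _] := h2.
split=> //; first by rewrite -(trace0E k0 e0).
by rewrite -(trace0E k1 e1) t1 (trace0E k2 e2).
Qed.

Lemma aeeq0_nn F phi : L2 F -> aeeq F phi -> ~ aeeq phi (fun=> 0) -> nn F != 0.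
Proof.
move=> LF e n0; apply/negP => /eqP /(nn_eq0 LF) H; apply: n0.
exact: aeeq_trans (aeeq_sym e) H.
Qed.

Lemma D0_chain phi : @D0 R phi -> exists F0 F1 F2,
  [/\ H2 F0 F1 F2, aeeq F0 phi, F0 0 = 0 & L2 phi].
Proof.
move=> [s2 t0]; have [F0 [F1 [F2 [h1 e0 e1 e2]]]] := sobolev_H2 s2.
exists F0, F1, F2; split=> //; last exact: sobolev_L2 s2.
by have [k0 _ _] := h1; rewrite -(trace0E k0 e0).
Qed.

Lemma Ray_chain c phi F0 F1 F2 : L2 phi -> H2 F0 F1 F2 -> aeeq F0 phi ->
  aeeq (Ray U alpha c phi) (fun y => sh U c y * (F2 y - aC ^+ 2 * F0 y) - (U2 y)%:C * F0 y).
Proof.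
move=> Lphi hF e; have [l1 L1] := laplacianE alpha hF Lphi (aeeq_sym e).
have := aeI e l1; apply: aeS => y [E1 E2] Dy.
by rewrite /Ray E2// -E1// /sh natC.
Qed.

(** Dividing the eigenvalue equation by U - c0 gives the differential equation on a representative;
    the second derivative is changed on a null set so that the equation holds in the exact form
    required by the decay and solvability results. *)
Lemma Rayleigh_mode c0 phi0 : 0 < Im c0 -> eigenmode (Ray U alpha c0) (@D0 R) phi0 ->
  exists P0 P1, [/\ cac P0 P1,
    cac P1 (fun y => (aC ^+ 2 + (U2 y)%:C * res U c0 y) * P0 y),
    [/\ L2 P0, L2 P1 & aeeq P0 phi0], P0 0 = 0 & nn P0 != 0].
Proof.
move=> Ic0 [d0 n0 r0]; have [P0 [P1 [P2 [hP e P00 Lphi]]]] := D0_chain d0.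
have [k0 k1 [L0 L1 L2']] := hP.
exists P0, P1; split=> //; last exact: aeeq0_nn e n0.
apply: cac_ae k1 _ _.
  apply: cmeasM; last exact: cac_meas k0.
  apply: cmeasD; first exact: cmeas_cst.
  by apply: cmeasM; [exact: cmeas_U2 hU|exact: cac_meas (cac_G hU Ic0)].
have := aeI (Ray_chain c0 Lphi hP e) r0; apply: aeS => y [E1 E2] Dy.
have := E1 Dy; rewrite E2// => /esym/eqP; rewrite subr_eq0 => /eqP E3.
have gs := res_sh U Ic0 y.
have := congr1 (fun z => res U c0 y * z) E3; rewrite mulrA gs mul1r => /eqP.
rewrite subr_eq => /eqP ->.
by move: (res U c0 y) (U2 y)%:C (P0 y) aC => *; ring.
Qed.

Lemma image_Ray c0 P0 X0 X1 X2 phi0 : H2 X0 X1 X2 -> X0 0 = 0 -> aeeq P0 phi0 ->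
  (forall y, sh U c0 y * (X2 y - aC ^+ 2 * X0 y) - (U2 y)%:C * X0 y = P0 y) ->
  image_on (Ray U alpha c0) (@D0 R) phi0.
Proof.
move=> hX X00 e E; have [k0 k1 [L0 L1 L2']] := hX; exists X0.
  by split; [exact: H2_sobolev hX|rewrite (trace0E k0 (aeeq_refl X0))].
apply: aeeq_trans (Ray_chain c0 L0 hX (aeeq_refl X0)) _.
by move: e; apply: aeS => y H Dy; rewrite E H.
Qed.
Lemma cint_aeeq F G H : L2 F -> L2 G -> L2 H -> aeeq F G ->
  cint Rp (fun y => F y * H y) = cint Rp (fun y => G y * H y).
Proof.
move=> LF LG LH e; apply/eqP; rewrite -subr_eq0 -cintB//; [|exact: L2_ciM..].
rewrite (eq_cint (G := fun y => (F y - G y) * H y)); last by move=> y _; rewrite mulrBl.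
apply/eqP/cint_ae0 => //; first exact: L2B.
by move: e; apply: aeS => y E Dy; rewrite E// subrr.
Qed.

(** If the operator maps chi to g, duality moves it from chi to G, where it gives zero. [F] is any
    L^2 representative of g. *)
Lemma Orr_image_orth gamma nu c g F G0 G1 G2 G3 G4 :
  image_on (Orr U alpha c nu) (Dnu gamma nu) g -> aeeq g F -> L2 F ->
  H2 G0 G1 G2 -> H2 G2 G3 G4 -> G0 0 = 0 -> G1 0 = (nu `^ gamma)%:C * G2 0 ->
  aeeq (orrT U U1 a c (visc nu) G0 G1 G2 G4) (fun=> 0) ->
  cint Rp (fun y => F y * G0 y) = 0.
Proof.
move=> [chi dchi e] gF LF hG hG2 G00 G10 zG.
have [X0 [X1 [X2 [X3 [X4 [[hX hX2 eX X00 X10] Lchi]]]]]] := Dnu_chain dchi.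
have e2 := aeeq_trans (aeeq_sym (Orr_chain c nu Lchi hX hX2 eX)) (aeeq_trans e gF).
have [_ _ [LX0 _ _]] := hX; have [_ _ [LG0 _ _]] := hG.
rewrite -(cint_aeeq (orr_L2 a hU c (visc nu) hX hX2) LF LG0 e2).
rewrite (orr_duality a hU c (visc nu) hX hX2 hG hG2 X00 G00 X10 G10).
exact: cint_ae0 (orrT_L2 a hU c (visc nu) hG hG2) LX0 zG.
Qed.

Lemma Dnu_chainJ F0 F1 F2 F3 F4 (t : R) : H2 F0 F1 F2 -> H2 F2 F3 F4 -> F0 0 = 0 -> F1 0 = t%:C * F2 0 ->
  [/\ H2 (fun y => (F0 y)^*%C) (fun y => (F1 y)^*%C) (fun y => (F2 y)^*%C),
   H2 (fun y => (F2 y)^*%C) (fun y => (F3 y)^*%C) (fun y => (F4 y)^*%C), (F0 0)^*%C = 0 &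
   (F1 0)^*%C = t%:C * (F2 0)^*%C].
Proof.
move=> h1 h2 z e; split; [exact: H2J|exact: H2J|by rewrite z conjc0|by rewrite e conjcMr].
Qed.

Lemma Orr_adj_image_orth gamma nu c g F G0 G1 G2 G3 G4 :
  image_on (Orr_adj U alpha c nu) (Dnu gamma nu) g -> aeeq (fun y => (g y)^*%C) F -> L2 F ->
  H2 G0 G1 G2 -> H2 G2 G3 G4 -> G0 0 = 0 -> G1 0 = (nu `^ gamma)%:C * G2 0 ->
  aeeq (orr U U2 a c (visc nu) G0 G2 G4) (fun=> 0) ->
  cint Rp (fun y => F y * G0 y) = 0.
Proof.
move=> [chi dchi e] gF LF hG hG2 G00 G10 zG.
have [X0 [X1 [X2 [X3 [X4 [[hX hX2 eX X00 X10] Lchi]]]]]] := Dnu_chain dchi.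
have [hY hY2 Y00 Y10] := Dnu_chainJ hX hX2 X00 X10.
have eJ : aeeq (fun y => (Orr_adj U alpha c nu chi y)^*%C) (fun y => (g y)^*%C).
  by move: e; apply: aeS => y E Dy; rewrite E.
have e2 := aeeq_trans (aeeq_sym (Orr_adj_chain c nu Lchi hX hX2 eX)) (aeeq_trans eJ gF).
have [_ _ [LX0 _ _]] := hY; have [_ _ [LG0 _ _]] := hG.
rewrite -(cint_aeeq (orrT_L2 a hU c (visc nu) hY hY2) LF LG0 e2).
rewrite -(orr_duality a hU c (visc nu) hG hG2 hY hY2 G00 Y00 G10 Y10).
exact: cint_ae0 (orr_L2 a hU c (visc nu) hG hG2) LX0 zG.
Qed.

(** The parameter s = (nu / alpha)^(1/4), whose fourth power is the imaginary part of [visc nu]. *)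
Definition layer nu : R := Num.sqrt (Num.sqrt (nu / a)).

Section NearModes.
Variables (c0 : R[i]) (P0 P1 : R -> R[i]).
Hypotheses (Ic0 : 0 < Im c0) (h0 : cac P0 P1)
  (h1 : cac P1 (fun y => (aC ^+ 2 + (U2 y)%:C * res U c0 y) * P0 y))
  (L0 : L2 P0) (L1 : L2 P1) (P00 : P0 0 = 0) (Pn0 : nn P0 != 0).

Lemma near_modes (t : R) : 0 < t -> exists2 d, 0 < d & forall (nu : R) c gamma phi psi, 0 < nu ->
  normc (c - c0) + layer nu <= d ->
  eigenmode (Orr U alpha c nu) (Dnu gamma nu) phi ->
  eigenmode (Orr_adj U alpha c nu) (Dnu gamma nu) psi ->
  (exists F0 F1 F2 F3 F4, [/\ H2 F0 F1 F2, H2 F2 F3 F4, F0 0 = 0 & F1 0 = (nu `^ gamma)%:C * F2 0] /\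
    [/\ aeeq F0 phi, nn F0 != 0, aeeq (orr U U2 a c (visc nu) F0 F2 F4) (fun=> 0) &
      exists A, nn (fun y => F0 y - A * P0 y) <= t * nn F0]) /\
  (exists G0 G1 G2 G3 G4, [/\ H2 G0 G1 G2, H2 G2 G3 G4, G0 0 = 0 & G1 0 = (nu `^ gamma)%:C * G2 0] /\
    [/\ aeeq G0 (fun y => (psi y)^*%C), nn G0 != 0, aeeq (orrT U U1 a c (visc nu) G0 G1 G2 G4) (fun=> 0) &
      exists B, nn (fun y => G0 y - B * (res U c0 y * P0 y)) <= t * nn G0]).
Proof.
move=> t0; have m00 : 0 < Im c0 / 2 by rewrite divr_gt0.
have b0 : 0 <= normc c0 + Im c0 / 2 by rewrite addr_ge0 ?normc_ge0// ltW.
have [C1 C10 small] := small_c0 a hU c0 m00 b0.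
have [C2 C20 rig1] := rigid_direct hU a0 Ic0 h0 h1 L0 L1 P00 Pn0.
have [C3 C30 rig2] := rigid_adjoint hU a0 Ic0 h0 h1 L0 L1 P00 Pn0.
pose N := (C2 + C3) * C1 + 1.
have N0 : 0 < N by rewrite ltr_wpDl// mulr_ge0// addr_ge0.
(* The bound 1 gives s <= 1; Im c0 / 2 keeps Im c above Im c0 / 2 and |c| bounded; t / N turns the
   rigidity estimates into relative distance t, N dominating the product of constants for both
   modes. *)
exists (Num.min (Num.min 1 (Im c0 / 2)) (t / N)).
  by rewrite !lt_min ltr01 m00 divr_gt0.
move=> nu c gamma phi psi nu0; rewrite !le_min -andbA => /and3P[d1 d2 d3] ephi epsi.
have w0 : 0 <= normc (c - c0) := normc_ge0 _.
have na0 : 0 < nu / a by rewrite divr_gt0.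
have s0 : 0 < layer nu by rewrite !sqrtr_gt0.
have s1 : layer nu <= 1 by apply: le_trans d1; rewrite lerDr.
have Rv : Re (visc nu) = 0 by [].
have s4 : Im (visc nu) = layer nu ^+ 4.
  by rewrite /= (exprM _ 2 2) !sqr_sqrtr ?sqrtr_ge0// ltW.
have w2 : normc (c - c0) <= Im c0 / 2 by apply: le_trans d2; rewrite lerDl ltW.
have mc : Im c0 / 2 <= Im c.
  have := le_trans (Im_le_normc (c - c0)) w2; rewrite cImD cImN ler_norml => /andP[+ _].
  by move: (Im c0) (Im c) => *; lra.
have bc : normc c <= normc c0 + Im c0 / 2.
  have -> : c = c0 + (c - c0) by rewrite addrC subrK.
  by rewrite (le_trans (le_normcD _ _))// lerD2l.
have p0 : 0 <= nu `^ gamma := powR_ge0 _ _.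
have T0 F : 0 <= C1 * (normc (c - c0) + layer nu) * nn F.
  by rewrite !mulr_ge0 ?nn_ge0// addr_ge0// ltW.
have fin C F : 0 <= C -> C <= C2 + C3 -> C * (C1 * (normc (c - c0) + layer nu) * nn F) <= t * nn F.
  move=> C0 CC; rewrite !mulrA; apply: ler_wpM2r; first exact: nn_ge0.
  have CN : C * C1 <= N by rewrite /N; apply: le_trans (ler_wpM2r C10 CC) _; rewrite lerDl.
  rewrite -[t](divfK (lt0r_neq0 N0)) mulrC; apply: ler_pM => //.
  - by rewrite addr_ge0// ltW.
  - exact: mulr_ge0.
split.
  have [dphi n0 z] := ephi.
  have [F0 [F1 [F2 [F3 [F4 [[hF hF2 eF F00 F10] Lphi]]]]]] := Dnu_chain dphi.
  have zF := aeeq_trans (aeeq_sym (Orr_chain c nu Lphi hF hF2 eF)) z.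
  exists F0, F1, F2, F3, F4; split=> //; split=> //.
    by have [_ _ [LF0 _ _]] := hF; exact: aeeq0_nn eF n0.
  have [sm _] := small _ _ _ c _ _ _ _ _ s0 s1 Rv s4 p0 mc bc hF hF2 F00 F10.
  have [A HA] := rig1 _ _ _ _ hF F00 (T0 F0) (sm zF).
  by exists A; apply: le_trans HA _; apply: fin => //; rewrite lerDl.
have [dpsi n0 z] := epsi.
have [F0 [F1 [F2 [F3 [F4 [[hF hF2 eF F00 F10] Lpsi]]]]]] := Dnu_chain dpsi.
have [hY hY2 Y00 Y10] := Dnu_chainJ hF hF2 F00 F10.
have zJ : aeeq (fun y => (Orr_adj U alpha c nu psi y)^*%C) (fun=> 0).
  by move: z; apply: aeS => y E Dy; rewrite E// conjc0.
have zF := aeeq_trans (aeeq_sym (Orr_adj_chain c nu Lpsi hF hF2 eF)) zJ.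
exists (fun y => (F0 y)^*%C), (fun y => (F1 y)^*%C), (fun y => (F2 y)^*%C), (fun y => (F3 y)^*%C), (fun y => (F4 y)^*%C).
split=> //; split=> //.
- by move: eF; apply: aeS => y E Dy; rewrite E.
- by rewrite nnJ; have [_ _ [LF0 _ _]] := hF; exact: aeeq0_nn eF n0.
have [_ sm] := small _ _ _ c _ _ _ _ _ s0 s1 Rv s4 p0 mc bc hY hY2 Y00 Y10.
have [A HA] := rig2 _ _ _ _ hY Y00 (T0 _) (sm zF).
by exists A; apply: le_trans HA _; apply: fin => //; rewrite lerDr.
Qed.

Lemma conj_images : exists2 d, 0 < d & forall (nu : R) c gamma phi psi, 0 < nu ->
  normc (c - c0) + layer nu <= d ->
  eigenmode (Orr U alpha c nu) (Dnu gamma nu) phi ->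
  eigenmode (Orr_adj U alpha c nu) (Dnu gamma nu) psi ->
  ~ image_on (Orr U alpha c nu) (Dnu gamma nu) (fun y => (phi y)^*%C) /\
  ~ image_on (Orr_adj U alpha c nu) (Dnu gamma nu) (fun y => (psi y)^*%C).
Proof.
have [Lk _] := L2G hU Ic0 L0.
have J1 := hermitian_pairing_neq0 hU Ic0 L0 Pn0.
have [d d0 pair] := pairing_neq0 L0 (L2J Lk) J1.
have [e e0 H] := near_modes d0; exists e => // nu c gamma phi psi nu0 small ephi epsi.
have [] := H nu c gamma phi psi nu0 small ephi epsi.
move=> [F0 [F1 [F2 [F3 [F4 [[hF hF2 F00 F10] [eF Fn zF [A HA]]]]]]]].
move=> [G0 [G1 [G2 [G3 [G4 [[hG hG2 G00 G10] [eG Gn zG [B HB]]]]]]]].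
have [_ _ [LF _ _]] := hF; have [_ _ [LG _ _]] := hG.
have N : cint Rp (fun y => F0 y * (G0 y)^*%C) != 0.
  apply: (pair F0 (fun y => (G0 y)^*%C) A B^*%C) => //; [exact: L2J|by rewrite nnJ|].
  rewrite nnJ; apply: le_trans HB; rewrite -[leRHS]nnJ le_eqVlt; apply/orP; left; apply/eqP.
  apply: eq_nn => y _; move: (G0 y) B (res U c0 y * P0 y) => z w v.
  by rewrite conjcB; case: w v => [p q] [r s]; congr (_ - _); apply: complex_eq => /=; ring.
(* Both exclusions contradict the same nonzero number: the first orthogonality gives the conjugate
   of the pairing in [N], the second the pairing itself. *)
split=> im; apply: (negP N); apply/eqP.
  have eJ : aeeq (fun y => (phi y)^*%C) (fun y => (F0 y)^*%C).
    by move: eF; apply: aeS => y E Dy; rewrite E.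
  have E := Orr_image_orth im eJ (L2J LF) hG hG2 G00 G10 zG.
  have i : ci Rp (fun y => (F0 y)^*%C * G0 y) by apply: L2_ciM => //; exact: L2J.
  have := cintJ (@measurable_halfline R) i; rewrite E conjc0 => <-.
  apply: eq_cint => y _; case: (F0 y) (G0 y) => [p q] [r s]; apply: complex_eq => /=; ring.
have eJ : aeeq (fun y => ((psi y)^*%C)^*%C) (fun y => (G0 y)^*%C).
  by move: eG; apply: aeS => y E Dy; rewrite E.
have <- := Orr_adj_image_orth im eJ (L2J LG) hF hF2 F00 F10 zF.
by apply: eq_cint => y _; rewrite mulrC.
Qed.

Lemma images phi0 : aeeq P0 phi0 -> ~ image_on (Ray U alpha c0) (@D0 R) phi0 ->
  exists2 d, 0 < d & forall (nu : R) c gamma phi psi, 0 < nu ->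
  normc (c - c0) + layer nu <= d ->
  eigenmode (Orr U alpha c nu) (Dnu gamma nu) phi ->
  eigenmode (Orr_adj U alpha c nu) (Dnu gamma nu) psi ->
  ~ image_on (Orr U alpha c nu) (Dnu gamma nu) phi /\
  ~ image_on (Orr_adj U alpha c nu) (Dnu gamma nu) psi.
Proof.
move=> eP noim; have [Lk _] := L2G hU Ic0 L0.
have J2 : cint Rp (fun y => P0 y * (res U c0 y * P0 y)) != 0.
  apply/negP => /eqP J0; apply: noim.
  have [X0 [X1 [X2 [hX X00 EX]]]] := bilinear_pairing_eq0 hU a0 Ic0 h0 h1 L0 L1 P00 Pn0 J0.
  exact: image_Ray hX X00 eP EX.
have [d d0 pair] := pairing_neq0 L0 Lk J2.
have [e e0 H] := near_modes d0; exists e => // nu c gamma phi psi nu0 small ephi epsi.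
have [] := H nu c gamma phi psi nu0 small ephi epsi.
move=> [F0 [F1 [F2 [F3 [F4 [[hF hF2 F00 F10] [eF Fn zF [A HA]]]]]]]].
move=> [G0 [G1 [G2 [G3 [G4 [[hG hG2 G00 G10] [eG Gn zG [B HB]]]]]]]].
have [_ _ [LF _ _]] := hF; have [_ _ [LG _ _]] := hG.
have N := pair F0 G0 A B LF LG Fn Gn HA HB.
split=> im; apply: (negP N); apply/eqP.
  exact: Orr_image_orth im (aeeq_sym eF) LF hG hG2 G00 G10 zG.
have <- := Orr_adj_image_orth im (aeeq_sym eG) LG hF hF2 F00 F10 zF.
by apply: eq_cint => y _; rewrite mulrC.
Qed.

End NearModes.

Lemma near_small (c : R -> R[i]) c0 (d K : R) : 0 < d ->
  (\forall nu \near 0^'+, `|c nu - c0| <= (K * Num.sqrt nu)%:C) ->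
  \forall nu \near 0^'+, 0 < nu /\ normc (c nu - c0) + layer nu <= d.
Proof.
(* K may be zero or negative; |K| + 1 is a positive substitute by which one can divide. Half of d is
   allotted to |c - c0|, of order sqrt(nu), and half to [layer nu], at most nu^(1/4) as alpha >=
   1. *)
move=> d0 hr; pose K' := `|K| + 1; have K'0 : 0 < K' by rewrite ltr_wpDl.
have e1 : 0 < (d / (2 * K')) ^+ 2 by rewrite exprn_gt0// divr_gt0// mulr_gt0.
have e2 : 0 < (d / 2) ^+ 4 by rewrite exprn_gt0// divr_gt0.
near=> nu.
have nu0 : 0 < nu by near: nu; exact: nbhs_right_gt.
split=> //.
have n1 : nu <= (d / (2 * K')) ^+ 2 by near: nu; exact: nbhs_right_le.
have n2 : nu <= (d / 2) ^+ 4 by near: nu; exact: nbhs_right_le.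
have q1 : normc (c nu - c0) <= K * Num.sqrt nu by rewrite -lecR; near: nu.
have q2 : Num.sqrt nu <= d / (2 * K').
  by rewrite -(@ler_pXn2r _ 2)// ?nnegrE ?sqrtr_ge0 ?divr_ge0 ?mulr_ge0 ?ltW// sqr_sqrtr// ltW.
have q3 : layer nu <= d / 2.
  have l0 : 0 <= layer nu by exact: sqrtr_ge0.
  have na : 0 <= nu / a by rewrite divr_ge0// ltW.
  have d20 : 0 <= d / 2 by rewrite divr_ge0// ltW.
  rewrite -(@ler_pXn2r _ 4)// (exprM _ 2 2) !sqr_sqrtr ?sqrtr_ge0//.
  by apply: le_trans n2; rewrite ler_pdivrMr// ler_peMr ?(ltW nu0)// ler1n.
have q4 : K * Num.sqrt nu <= d / 2.
  apply: le_trans (_ : K' * Num.sqrt nu <= _).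
    by rewrite ler_wpM2r ?sqrtr_ge0// (le_trans (ler_norm K))// lerDl.
  apply: le_trans (ler_wpM2l (ltW K'0) q2) _.
  by rewrite le_eqVlt; apply/orP; left; apply/eqP; field; rewrite gt_eqF.
by have := le_trans q1 q4; lra.
Unshelve. all: by end_near. Qed.

End Assembly.
Theorem proposition4p9 (R : realType) (U : R -> R) (alpha : nat) (gamma : R)
  (c0 : R[i]) (phi0 : R -> R[i])
  (c : R -> R[i]) (phi phi_adj : R -> R -> R[i])
  (hU : shear_flow U) (halpha : (0 < alpha)%N)
  (hc0 : Rayleigh_eigenvalue U alpha c0) (hImc0 : 0 < @complex.Im R c0)
  (hphi0 : eigenmode (Ray U alpha c0) (@D0 R) phi0)
  (hc : \forall nu \near 0^'+, OS_eigenvalue U alpha gamma (c nu) nu)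
  (hphi : \forall nu \near 0^'+,
     eigenmode (Orr U alpha (c nu) nu) (Dnu gamma nu) (phi nu))
  (hphi_adj : \forall nu \near 0^'+,
     eigenmode (Orr_adj U alpha (c nu) nu) (Dnu gamma nu) (phi_adj nu))
  (hlim : (c : R -> R[i]^o) nu @[nu --> 0^'+] --> (c0 : R[i]^o))
  (hrate : exists K : R, \forall nu \near 0^'+,
     `|c nu - c0| <= (K * Num.sqrt nu)%:C) :
  (\forall nu \near 0^'+,
     ~ image_on (Orr U alpha (c nu) nu) (Dnu gamma nu)
         (fun y => (phi nu y)^*) /\
     ~ image_on (Orr_adj U alpha (c nu) nu) (Dnu gamma nu)
         (fun y => (phi_adj nu y)^*)) /\
  (~ image_on (Ray U alpha c0) (@D0 R) phi0 ->
   \forall nu \near 0^'+,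
     ~ image_on (Orr U alpha (c nu) nu) (Dnu gamma nu) (phi nu) /\
     ~ image_on (Orr_adj U alpha (c nu) nu) (Dnu gamma nu) (phi_adj nu)).
Proof.
have [M [eta fU]] := shear_flow_flow hU.
have [P0 [P1 [h0 h1 [L0 L1 eP] P00 Pn0]]] := Rayleigh_mode fU hImc0 hphi0.
have [K hK] := hrate; split.
  have [d d0 H] := conj_images fU halpha hImc0 h0 h1 L0 L1 P00 Pn0.
  near=> nu; have [nu0 small] : 0 < nu /\ normc (c nu - c0) + layer alpha nu <= d.
    by near: nu; exact: near_small hK.
  by apply: H => //; near: nu.
move=> noim; have [d d0 H] := images fU halpha hImc0 h0 h1 L0 L1 P00 Pn0 eP noim.
near=> nu; have [nu0 small] : 0 < nu /\ normc (c nu - c0) + layer alpha nu <= d.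
  by near: nu; exact: near_small hK.
by apply: H => //; near: nu.
Unshelve. all: by end_near. Qed.
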